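(* Let $n\ge1$. For $w\in S_{n+1}$ we have $$P^{(n)}_w=\sum_{u_1\cdots u_{2n-1}=w}F_{u_1}\otimes\cdots\otimes F_{u_{2n-1}}$$ in $\Lambda^{\otimes 2n-1}$, where the sum is over all reduced factorizations $w=u_1\cdots u_{2n-1}$ such that $u_i\in S_{\min(i,2n-i)+1}$ for each $i$.
   Context: Permutations: $S_n\subset S_{n+1}$ via permutations fixing $n+1$; $s_i=(i,i+1)$; products are compositions of functions; $\ell(w)$ is the length. A reduced factorization $u_1\cdots u_r=w$ means that the product of $u_1,\dots,u_r$ equals $w$ and $\ell(u_1)+\cdots+\ell(u_r)=\ell(w)$; for two factors it is written $u\cdot v=w$. For $w\in S_n$, $1^m\times w\in S_{n+m}$ is the identity on $\{1,\dots,m\}$ and maps $j$ to $w(j-m)+m$ for $j>m$. Schubert polynomials: for the longest element $w_0\in S_n$ set $\mathfrak S_{w_0}(X;Y)=\prod_{i+j\le n}(x_i-y_j)$; if $\ell(ws_i)=\ell(w)+1$ set $\mathfrak S_w(X;Y)=\partial_i\mathfrak S_{ws_i}(X;Y)$, where $\partial_i f=(f-s_if)/(x_i-x_{i+1})$ and $s_i$ exchanges $x_i$ and $x_{i+1}$. Set $\mathfrak S_w(X)=\mathfrak S_w(X;0)$. Stanley symmetric functions: $\Lambda$ is the ring of symmetric functions. $F_w\in\Lambda$ is the unique element with $F_w(x_1,\dots,x_k)=\mathfrak S_{1^m\times w}(x_1,\dots,x_k)$ for all $m\ge k$ (on the right the variables $x_i$, $i>k$, are set to $0$). Universal Schubert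 polynomials: let $c_i(j),d_i(j)$ ($1\le i\le j$) be independent variables, $c_0(j)=d_0(j)=1$, and $c_i(j)=d_i(j)=0$ if $i<0$ or $i>j$. For $w\in S_{n+1}$ write uniquely $\mathfrak S_w(X)=\sum a_{i_1,\dots,i_n}e_{i_1}(x_1)e_{i_2}(x_1,x_2)\cdots e_{i_n}(x_1,\dots,x_n)$ (sum over $i_\alpha\le\alpha$, $\sum i_\alpha=\ell(w)$), and put $\mathfrak S_w(c)=\sum a_{i_1,\dots,i_n}c_{i_1}(1)\cdots c_{i_n}(n)$ and $\mathfrak S_w(c;d)=\sum_{u\cdot v=w}(-1)^{\ell(u)}\mathfrak S_{u^{-1}}(d)\,\mathfrak S_v(c)$. This does not depend on which symmetric group $w$ is regarded as an element of. Schur determinants: for a partition $\alpha$ with $p$ parts and sequences $c=(c_1,c_2,\dots)$, $d=(d_1,d_2,\dots)$, $s_\alpha(c-d)=\det(h_{\alpha_i+j-i})_{p\times p}$ where $\sum_k h_kt^k=\dfrac{1-d_1t+d_2t^2-\cdots}{1-c_1t+c_2t^2-\cdots}$. Write $c(j)=(c_1(j),c_2(j),\dots)$ and $d(j)=(d_1(j),d_2(j),\dots)$. Quiver coefficients: for $w\in S_{n+1}$, the integers $c^{(n)}_{w,\lambda}$ (indexed by sequences of partitions $\lambda=(\lambda^1,\dots,\lambda^{2n-1})$; zero unless $\sum|\lambda^i|=\ell(w)$) are the coefficients of the Buch–Fulton quiver formula for the degeneracy locus attached to $w$; they are uniquely characterized by the requirement that for all $m\ge 0$ $$\mathfrak S_{1^m\times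 w}(c;d)=\sum_\lambda c^{(n)}_{w,\lambda}\ \prod_{i=1}^{n-1}s_{\lambda^i}\big(d(i+1+m)-d(i+m)\big)\cdot s_{\lambda^n}\big(c(n+m)-d(n+m)\big)\cdot\prod_{i=n+1}^{2n-1}s_{\lambda^i}\big(c(2n-i+m)-c(2n-i+1+m)\big).$$ Finally $P^{(n)}_w=\sum_\lambda c^{(n)}_{w,\lambda}\,s_{\lambda^1}\otimes\cdots\otimes s_{\lambda^{2n-1}}\in\Lambda^{\otimes 2n-1}$, with $s_{\lambda^i}\in\Lambda$ the Schur functions. *)

(* Defs.v *)
From HB Require Import structures.
From mathcomp Require Import all_boot all_order all_fingroup all_algebra.
From mathcomp Require Import finmap boolp classical_sets.
From mathcomp Require monalg.
From mathcomp Require Import freeg mpoly.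

Set Implicit Arguments.
Unset Strict Implicit.
Unset Printing Implicit Defensive.

Import GRing.Theory.

Local Open Scope ring_scope.

(* ['S_n] acts on {0, .., n-1}; the integer i of {1, .., n} is the      *)
(* ordinal of value i - 1.                                              *)

(* The composition u o v; MathComp's [u * v] is v o u. *)
Definition pcomp n (u v : 'S_n) : 'S_n := (v * u)%g.

Lemma pcompE n (u v : 'S_n) x : pcomp u v x = u (v x).
Proof. exact: permM. Qed.

Definition plength n (w : 'S_n) : nat :=
  #|[set p : 'I_n * 'I_n | (p.1 < p.2)%N && (w p.2 < w p.1)%N]|.

Definition plongest n : 'S_n := perm (@rev_ord_inj n).

(* Membership in the subgroup S_k of ['S_n] (all of it when n <= k). *)
Definition in_sym n (k : nat) (u : 'S_n) : bool :=
  [forall j : 'I_n, (k <= j)%N ==> (u j == j)].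

Definition pshift_fun m n (w : 'S_n) (i : 'I_(m + n)) : 'I_(m + n) :=
  match fintype.split i with
  | inl _ => i
  | inr j => rshift m (w j)
  end.

Lemma pshift_fun_inj m n (w : 'S_n) : injective (@pshift_fun m n w).
Proof.
move=> i j; rewrite /pshift_fun.
case: (split_ordP i) => a ->; case: (split_ordP j) => b -> //.
- by move/eqP; rewrite eq_lrshift.
- by move/eqP; rewrite eq_rlshift.
- by move/rshift_inj/perm_inj=> ->.
Qed.

(* 1^m x w *)
Definition pshift m n (w : 'S_n) : 'S_(m + n) := perm (@pshift_fun_inj m n w).

(* g = (f - s f) / (x_i - x_j), where s exchanges x_i and x_j.  Such a g *)
(* is unique when R is an integral domain and i != j.                   *)
Definition is_divdiff (R : comNzRingType) n (i j : 'I_n)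
    (f g : {mpoly R[n]}) : Prop :=
  ('X_i - 'X_j) * g = f - msym (tperm i j) f.

(* In {mpoly {mpoly int[n]}[n]} the outer variables are the x_i and the *)
(* inner ones are the y_j.                                              *)
Definition double_schubert_top n : {mpoly {mpoly int[n]}[n]} :=
  \prod_(i < n) \prod_(j < n | (i.+1 + j.+1 <= n)%N) ('X_i - ('X_j)%:MP).

Definition is_double_schubert n
    (S : {ffun 'S_n -> {mpoly {mpoly int[n]}[n]}}) : Prop :=
  S (plongest n) = double_schubert_top n /\
  forall (w : 'S_n) (i j : 'I_n), j = i.+1 :> nat ->
    plength (pcomp w (tperm i j)) = (plength w).+1 ->
    is_divdiff i j (S (pcomp w (tperm i j))) (S w).

(* S_w(X;Y); the family is the unique one with the above property. *)
Definition double_schubert n (w : 'S_n) : {mpoly {mpoly int[n]}[n]} :=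
  xget 0 [set S | is_double_schubert S] w.

(* S_w(X) = S_w(X;0) *)
Definition schubert n (w : 'S_n) : {mpoly int[n]} :=
  map_mpoly (meval (fun=> 0)) (double_schubert w).

(* p(x_1, .., x_k): for k <= N the variables x_i with i > k are set to 0. *)
Definition mrestr (R : comNzRingType) N k (p : {mpoly R[N]}) : {mpoly R[k]} :=
  p \mPo [tuple (if insub (val i) is Some j then 'X_(j : 'I_k) else 0) | i < N].

Section Mrestr.
Variables (R : comNzRingType) (N k : nat).
Implicit Types p q : {mpoly R[N]}.

Lemma mrestr1 : mrestr k (1 : {mpoly R[N]}) = 1.
Proof. exact: comp_mpoly1. Qed.

Lemma mrestrB p q : mrestr k (p - q) = mrestr k p - mrestr k q.
Proof. exact: comp_mpolyB. Qed.

Lemma mrestrM p q : mrestr k (p * q) = mrestr k p * mrestr k q.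
Proof. exact: rmorphM. Qed.
End Mrestr.

Lemma mcoeff_mrestr (R : comNzRingType) k (p : {mpoly R[k.+1]}) m :
  (mrestr k p)@_m = p@_(mnmwiden m).
Proof.
transitivity (\sum_(m' <- msupp p) p@_m' * (m' == mnmwiden m)%:R); last first.
  rewrite [in RHS](mpolyE p) linear_sum /=; apply: eq_bigr => m' _.
  by rewrite mcoeffZ mcoeffX.
rewrite /mrestr comp_mpolyEX linear_sum /=; apply: eq_bigr => m' _.
rewrite mcoeffZ comp_mpolyX; congr (_ * _).
rewrite big_ord_recr /= tnth_mktuple insubF ?ltnn //.
under eq_bigr => i _.
  rewrite tnth_mktuple (insubT (fun x => (x < k)%N) (ltn_ord i)) /=.
  rewrite (_ : Sub _ _ = i); last exact/val_inj.
  over.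
set mm : 'X_{1..k} := [multinom m' (widen_ord (leqnSn k) i) | i < k].
rewrite (_ : \prod_(i < k) _ = 'X_[mm]); last first.
  by rewrite mpolyXE_id; apply: eq_bigr => i _; rewrite mnmE.
rewrite expr0n mulr_natr mcoeffMn mcoeffX -mulrnA mulnb; congr (_ *+ nat_of_bool _).
apply/andP/eqP => [[/eqP <- /eqP m0]|m'E].
  apply/mnmP => i; have [j ->|->] := unliftP ord_max i; last by rewrite mnmwiden_ordmax.
  rewrite (_ : fintype.lift ord_max j = widen_ord (leqnSn k) j); last exact/val_inj/lift_max.
  by rewrite mnmwiden_widen mnmE.
rewrite m'E mnmwiden_ordmax; split=> //.
by apply/eqP/mnmP => i; rewrite mnmE m'E mnmwiden_widen.
Qed.

(* The ring of symmetric functions: sequences of symmetric polynomials  *)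
(* f_k in x_1, .., x_k with f_{k+1}(x_1, .., x_k, 0) = f_k and bounded  *)
(* degree.                                                              *)

Definition mpolys : Type := forall k, {mpoly int[k]}.

HB.instance Definition _ := Choice.on mpolys.

Section MpolysRing.
Implicit Types f g : mpolys.

Let mpolys0 : mpolys := fun=> 0.
Let mpolys1 : mpolys := fun=> 1.
Let mpolysN f : mpolys := fun k => - f k.
Let mpolysD f g : mpolys := fun k => f k + g k.
Let mpolysM f g : mpolys := fun k => f k * g k.

Let addA : associative mpolysD.
Proof. by move=> f g h; apply: functional_extensionality_dep => k; apply: addrA. Qed.
Let addC : commutative mpolysD.
Proof. by move=> f g; apply: functional_extensionality_dep => k; apply: addrC. Qed.
Let add0 : left_id mpolys0 mpolysD.
Proof. by move=> f; apply: functional_extensionality_dep => k; apply: add0r. Qed.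
Let addN : left_inverse mpolys0 mpolysN mpolysD.
Proof. by move=> f; apply: functional_extensionality_dep => k; apply: addNr. Qed.
Let mulA : associative mpolysM.
Proof. by move=> f g h; apply: functional_extensionality_dep => k; apply: mulrA. Qed.
Let mulC : commutative mpolysM.
Proof. by move=> f g; apply: functional_extensionality_dep => k; apply: mulrC. Qed.
Let mul1 : left_id mpolys1 mpolysM.
Proof. by move=> f; apply: functional_extensionality_dep => k; apply: mul1r. Qed.
Let mulD : left_distributive mpolysM mpolysD.
Proof. by move=> f g h; apply: functional_extensionality_dep => k; apply: mulrDl. Qed.
Let nz1 : mpolys1 != mpolys0.
Proof. by apply/eqP=> /(congr1 (@^~ 0%N)) /eqP; rewrite oner_eq0. Qed.

HB.instance Definition _ := GRing.isZmodule.Build mpolys addA addC add0 addN.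
HB.instance Definition _ :=
  GRing.Zmodule_isComNzRing.Build mpolys mulA mulC mul1 mulD nz1.
End MpolysRing.

Definition is_symfun (f : mpolys) : Prop :=
  [/\ forall k, f k \is symmetric,
      forall k, mrestr k (f k.+1) = f k
    & exists d, forall k, (msize (f k) <= d)%N].

Definition symfun_pred : {pred mpolys} := fun f => `[< is_symfun f >].

Lemma symfun_pred_closed : subring_closed symfun_pred.
Proof.
split.
- apply/asboolP; split=> [k|k|]; first exact: rpred1.
  + exact: mrestr1.
  + by exists 1%N => k; rewrite msize1.
- move=> f g /asboolP[f1 f2 [df f3]] /asboolP[g1 g2 [dg g3]].
  apply/asboolP; split=> [k|k|]; first exact: rpredB (f1 k) (g1 k).
  + by rewrite mrestrB f2 g2.
  + exists (maxn df dg) => k; apply: leq_trans (msizeD_le _ _) _.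
    by rewrite msizeN geq_max !leq_max f3 g3 orbT.
- move=> f g /asboolP[f1 f2 [df f3]] /asboolP[g1 g2 [dg g3]].
  apply/asboolP; split=> [k|k|]; first exact: rpredM (f1 k) (g1 k).
  + by rewrite mrestrM f2 g2.
  + exists (df + dg).+1 => k; apply: leq_trans (msizeM_le _ _) _.
    by rewrite ltnS leq_add.
Qed.

HB.instance Definition _ :=
  GRing.isSubringClosed.Build mpolys symfun_pred symfun_pred_closed.

Record symfun := Symfun { symf_at : mpolys; _ : symf_at \in symfun_pred }.
Arguments symf_at : simpl never.

HB.instance Definition _ := [isSub for symf_at].
HB.instance Definition _ := [Choice of symfun by <:].
HB.instance Definition _ := [SubChoice_isSubComNzRing of symfun by <:].

(* h_r(x_1, .., x_k) *)
Definition mcomplete r k : {mpoly int[k]} :=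
  \sum_(m : 'X_{1..k < r.+1} | mdeg m == r) 'X_[m].

Lemma mcoeff_mcomplete r k m : (mcomplete r k)@_m = (mdeg m == r)%:R.
Proof.
rewrite /mcomplete linear_sum /=; under eq_bigr => i _ do rewrite mcoeffX.
have [mr|mr] := eqVneq (mdeg m) r; last first.
  by apply: big1 => i /eqP ir; case: eqP => // im; rewrite -im ir eqxx in mr.
have lt_m : (mdeg m < r.+1)%N by rewrite mr.
rewrite (bigD1 (BMultinom lt_m)) /= ?mr // eqxx big1 ?addr0 // => i.
by case/andP=> _ ne; case: eqP => // im; case/eqP: ne; apply/val_inj.
Qed.

Lemma mcomplete_symfun r : mcomplete r \in symfun_pred.
Proof.
apply/asboolP; split=> [k|k|].
- by apply/issymP=> s; apply/mpolyP=> m; rewrite mcoeff_sym !mcoeff_mcomplete mdeg_mperm.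
- apply/mpolyP=> m; rewrite mcoeff_mrestr !mcoeff_mcomplete !mdegE big_ord_recr /=.
  rewrite mnmwiden_ordmax addn0; congr ((_ == _)%:R).
  by apply: eq_bigr => i _; rewrite mnmwiden_widen.
exists r.+1 => k; rewrite msizeE; apply/bigmax_leqP_seq => m + _.
by rewrite mcoeff_msupp mcoeff_mcomplete; have [->|] := eqVneq (mdeg m) r.
Qed.

Definition complete_sym r : symfun := Symfun (mcomplete_symfun r).

Definition is_partition (s : seq nat) : bool := sorted geq s && (0%N \notin s).

Record intpart := IntPart { parts :> seq nat; _ : is_partition parts }.
HB.instance Definition _ := [isSub for parts].
HB.instance Definition _ := [Choice of intpart by <:].

Definition empty_part : intpart := @IntPart [::] isT.

(* det(h_{a_i + j - i}), where h_k = 0 for k < 0 *)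
Definition schur_det (R : comNzRingType) (h : nat -> R) (a : intpart) : R :=
  \det (\matrix_(i < size a, j < size a)
    if (i <= nth 0%N a i + j)%N then h (nth 0%N a i + j - i)%N else 0).

Definition schur_fun (a : intpart) : symfun := schur_det complete_sym a.

(* Sequences (c_1, c_2, ..) are functions on nat; their value at 0 is   *)
(* ignored, the constant term of the generating series being 1.         *)
Definition with1 (R : comNzRingType) (c : nat -> R) (i : nat) : R :=
  if i is 0 then 1 else c i.

Fixpoint hdiff_seq (R : comNzRingType) (c d : nat -> R) (n : nat) : seq R :=
  if n is k.+1 then
    let s := hdiff_seq c d k in
    rcons s ((-1) ^+ k * with1 d k
             - \sum_(1 <= i < k.+1) (-1) ^+ i * c i * s`_(k - i))
  else [::].

(* The coefficient of t^k in                                            *)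
(* (1 - d_1 t + d_2 t^2 - ..) / (1 - c_1 t + c_2 t^2 - ..); see hdiffE. *)
Definition hdiff (R : comNzRingType) (c d : nat -> R) (k : nat) : R :=
  (hdiff_seq c d k.+1)`_k.

Lemma hdiffE (R : comNzRingType) (c d : nat -> R) k :
  \sum_(0 <= i < k.+1) (-1) ^+ i * with1 c i * hdiff c d (k - i)
    = (-1) ^+ k * with1 d k.
Proof.
have sz n : size (hdiff_seq c d n) = n by elim: n => //= n IH; rewrite size_rcons IH.
have nthE n i : (i < n)%N -> (hdiff_seq c d n)`_i = hdiff c d i.
  elim: n => // n IH; rewrite ltnS leq_eqVlt => /orP[/eqP -> //|lt_in].
  by rewrite /= nth_rcons sz lt_in IH.
have hk : hdiff c d k = (-1) ^+ k * with1 d k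
    - \sum_(1 <= i < k.+1) (-1) ^+ i * c i * (hdiff_seq c d k)`_(k - i).
  by rewrite /hdiff /= nth_rcons sz ltnn eqxx.
rewrite big_ltn //= expr0 !mul1r subn0 hk -addrA addrC -[RHS]add0r.
congr (_ + _); rewrite addrC; apply/eqP; rewrite subr_eq0; apply/eqP.
apply: eq_big_nat => -[//|i] /= lt_ik.
by rewrite nthE // subnSK // leq_subr.
Qed.

(* s_a(c - d) *)
Definition schur_diff (R : comNzRingType) (c d : nat -> R) (a : intpart) : R :=
  schur_det (hdiff c d) a.

(* F_w; on the right x_i is set to 0 for i > k. *)
Definition stanley n (w : 'S_n) : symfun :=
  xget 0 [set F | forall k m, (k <= m)%N ->
                    symf_at F k = mrestr k (schubert (pshift m w))].

(* e_r(x_1, .., x_a) for a <= N *)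
Definition pesym N a r : {mpoly int[N]} :=
  \sum_(h : {set 'I_N} | (#|h| == r) && [forall i in h, (i < a)%N])
    \prod_(i in h) 'X_i.

(* The index a : 'I_N.-1 of an exponent vector stands for a + 1. *)
Definition usch_index N (l : nat) (I : {ffun 'I_N.-1 -> 'I_N}) : bool :=
  [forall a, (I a <= a.+1)%N] && (\sum_a I a == l :> nat)%N.

Definition is_usch_coef N (w : 'S_N)
    (A : {ffun {ffun 'I_N.-1 -> 'I_N} -> int}) : Prop :=
  (forall I, ~~ usch_index (plength w) I -> A I = 0) /\
  schubert w = \sum_(I | usch_index (plength w) I)
                 A I *: \prod_(a < N.-1) pesym N a.+1 (I a).

(* The unique coefficients A_I in                                       *)
(* S_w(X) = sum_I A_I prod_a e_{I_a}(x_1, .., x_a).                     *)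
Definition usch_coef N (w : 'S_N) : {ffun {ffun 'I_N.-1 -> 'I_N} -> int} :=
  xget 0 [set A | is_usch_coef w A].

(* S_w(c), where [c j i] is c_i(j) *)
Definition usch (R : comNzRingType) (c : nat -> nat -> R) N (w : 'S_N) : R :=
  \sum_(I | usch_index (plength w) I)
    (usch_coef w I)%:~R * \prod_(a < N.-1) c a.+1 (I a).

(* S_w(c;d) *)
Definition double_usch (R : comNzRingType) (c d : nat -> nat -> R) N (w : 'S_N) : R :=
  \sum_(p : 'S_N * 'S_N | (pcomp p.1 p.2 == w) &&
                           (plength p.1 + plength p.2 == plength w)%N)
    (-1) ^+ plength p.1 * usch d p.1^-1%g * usch c p.2.

Module UniversalRing.
Import monalg.

(* Integer polynomials in independent variables indexed by pairs:       *)
(* inl (j, i) is c_i(j) and inr (j, i) is d_i(j).                       *)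
Definition cd_ring : comNzRingType :=
  {malg int[{cmonom (nat * nat + nat * nat)%type}]}.

Definition cd_seq (inj : nat * nat -> nat * nat + nat * nat) (j i : nat) : cd_ring :=
  if i == 0%N then 1 else if (i <= j)%N then << ucm (inj (j, i)) >> else 0.

(* [cvar j i] is c_i(j), [dvar j i] is d_i(j). *)
Definition cvar := cd_seq inl.
Definition dvar := cd_seq inr.
End UniversalRing.
Export UniversalRing.

(* Tensor powers of an abelian group over the integers: the quotient of *)
(* the free abelian group on V^N by multilinearity.                     *)

Section TensorPower.
Variables (N : nat) (V : zmodType).

Definition tens_upd (x : {ffun 'I_N -> V}) (i : 'I_N) (v : V) : {ffun 'I_N -> V} :=
  [ffun j => if j == i then v else x j].

Inductive tens_rel : {freeg {ffun 'I_N -> V} / int} -> Prop :=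
| tens_rel0 : tens_rel 0
| tens_relB a b : tens_rel a -> tens_rel b -> tens_rel (a - b)
| tens_rel_add x i v v' :
    tens_rel (<< tens_upd x i (v + v') >>
              - (<< tens_upd x i v >> + << tens_upd x i v' >>)).

Definition tens_pred : {pred {freeg {ffun 'I_N -> V} / int}} :=
  fun a => `[< tens_rel a >].

Lemma tens_pred_closed : zmod_closed tens_pred.
Proof.
split; first exact/asboolP/tens_rel0.
by move=> a b /asboolP ra /asboolP rb; apply/asboolP/tens_relB.
Qed.

HB.instance Definition _ :=
  GRing.isZmodClosed.Build {freeg {ffun 'I_N -> V} / int} tens_pred tens_pred_closed.

Definition tpower : zmodType := Quotient.quot tens_pred.

(* x_1 (x) .. (x) x_N *)
Definition tens (x : 'I_N -> V) : tpower :=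
  (\pi_(Quotient.quot tens_pred) << [ffun i => x i] >>)%qT.
End TensorPower.

(* lambda^i, for 1 <= i <= N *)
Definition part_at N (la : N.-tuple intpart) (i : nat) : intpart :=
  nth empty_part la i.-1.

Definition quiver_term n m (la : (n.*2.-1).-tuple intpart) : cd_ring :=
  (\prod_(1 <= i < n)
     schur_diff (dvar (i + 1 + m)) (dvar (i + m)) (part_at la i))
  * schur_diff (cvar (n + m)) (dvar (n + m)) (part_at la n)
  * (\prod_(n.+1 <= i < n.*2)
       schur_diff (cvar (n.*2 - i + m)) (cvar (n.*2 - i + 1 + m)) (part_at la i)).

Definition is_quiver_coef n (w : 'S_n.+1)
    (q : {fsfun (n.*2.-1).-tuple intpart -> int with 0}) : Prop :=
  (forall la : (n.*2.-1).-tuple intpart,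
     (\sum_(p <- la) sumn (parts p))%N <> plength w -> q la = 0) /\
  forall m, double_usch cvar dvar (pshift m w)
            = \sum_(la <- finsupp q) (q la)%:~R * quiver_term m la.

(* la |-> c^(n)_{w,la}, the unique finitely supported family with the   *)
(* above property.                                                      *)
Definition quiver_coef n (w : 'S_n.+1) :
    {fsfun (n.*2.-1).-tuple intpart -> int with 0} :=
  xget [fsfun] [set q | is_quiver_coef w q].

(* P^(n)_w *)
Definition quiver_poly n (w : 'S_n.+1) : tpower n.*2.-1 symfun :=
  \sum_(la <- finsupp (quiver_coef w))
    tens (fun i => schur_fun (tnth la i)) *~ quiver_coef w la.

(* u_1 .. u_r = w as a reduced factorization *)
Definition is_reduced_fact n r (w : 'S_n) (u : {ffun 'I_r -> 'S_n}) : bool :=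
  (\big[@pcomp n/1%g]_(i < r) u i == w) && (\sum_i plength (u i) == plength w)%N.

(* Main.v *)
Require Import Defs.
From HB Require Import structures.
From mathcomp Require Import all_boot all_order all_fingroup all_algebra.
From mathcomp Require Import finmap boolp classical_sets.
From mathcomp Require monalg.
From mathcomp Require Import freeg mpoly.
From mathcomp Require Import ring zify.

Set Implicit Arguments.
Unset Strict Implicit.
Unset Printing Implicit Defensive.

Import Defs GRing.Theory.

Local Open Scope ring_scope.

(* In the nilCoxeter algebra, with generators u_k and basis S_(n+1), let      *)
(* E(c) be the image of prod_i (1 + x_i u_(n-1)) .. (1 + x_i u_0) when the    *)
(* elementary symmetric polynomials of the x_i are specialized to a sequence  *)
(* c; these elements commute with one another, E is multiplicative in the     *)
(* series 1 + c_1 t + .., and the coefficient of w in E is F_w.               *)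
(* The universal Schubert polynomials have a generating function              *)
(* L_(n-1)(c(n)) .. L_0(c(1)), where L_k(c) = E_(k+1)(c) E_k(c)^(-1) and E_k  *)
(* is E for S_(k+1).  Multiplying by the analogous product for d and          *)
(* regrouping, S_w(c;d) becomes the coefficient of w in a product of 2n - 1   *)
(* elements E_k of quotients of consecutive series, that is, the right-hand   *)
(* side of the theorem with F_u evaluated at the differences that occur in    *)
(* the quiver formula; since this holds for every 1^m x w, it produces quiver *)
(* coefficients.  For large m the variables can be specialized so that these  *)
(* 2n - 1 differences are generic up to any given degree, and therefore any   *)
(* quiver coefficients give the same element of the tensor power.             *)

(** * Noncommutative symmetric polynomials in nilCoxeter generators *)

(** Write E_k(c) for [ncstan u M k c] and L_k(c) for [nclin u M k c]. The bridge between the two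
    sides is that, although E_k(c) has high degree in c, the quotient L_k(c) = E_(k+1)(c)
    E_k(c)^(-1) is linear in c, with the elements [nchook u k r] as coefficients ([ncprod_nclin],
    [ncstan_mul_var]).

    Hence L_(n-1)(c(n)) .. L_0(c(1)) is multilinear in the c(k), as a universal Schubert polynomial
    is. For c(k) = e(x_1, .., x_k) it obeys the same divided difference relations as the
    Fomin-Kirillov product built from the Yang-Baxter equation, so its coefficients are the Schubert
    polynomials ([usch_gen_sch_gen]). Products of elementary symmetric polynomials are linearly
    independent ([pesym_prod_free]), and so its coefficients for general c are the universal
    Schubert polynomials ([uschE]).

    The anti-automorphism w -> (-1)^l(w) w^(-1) inverts E_k(d). It turns S_w(c;d) into the
    coefficient of w in a product of 2n factors E_k E_(k+1)^(-1) or E_(k+1) E_k^(-1). Pairing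
    neighbours by multiplicativity ([ncstan_mul]) leaves 2n - 1 elements E_k of quotients of
    consecutive series ([usch_gen_telescope]). The coefficient of w in a product is a sum over
    reduced factorizations, and E_k being supported on S_(k+1) yields the subgroup conditions. The
    coefficients of E_n are the Stanley functions ([stanleyE]).

    Each Stanley function is an integer combination of Schur determinants, uniformly in the ring
    ([nc_stan_schur_span]), which produces quiver coefficients ([quiver_coef_exists]). Conversely,
    any quiver coefficients are tested on a specialization that is generic up to degree l(w) and
    read in the tensor power through the additive map [poly_tens] ([quiver_coef_tens]). This covers
    whichever family [quiver_coef] selects. *)

Section NilCoxeterRelations.
Variable B : nzRingType.

Definition nil_coxeter (u : nat -> B) : Prop :=
  [/\ forall k, u k * u k = 0,
      forall j k, (j.+1 < k)%N -> u j * u k = u k * u j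
    & forall k, u k * u k.+1 * u k = u k.+1 * u k * u k.+1].

Fixpoint ncelem_rec (u : nat -> B) (k i : nat) : B :=
  match k, i with
  | _, 0 => 1
  | 0, _.+1 => 0
  | k'.+1, i'.+1 => ncelem_rec u k' i + u k' * ncelem_rec u k' i'
  end.

(* The coefficient of x^i in (1 + x u_(k-1)) .. (1 + x u_0). *)
Definition ncelem u k i := locked (ncelem_rec u k i).

Definition ncshift (u : nat -> B) (k : nat) (f : B) : B :=
  ncelem u k.+1 1 * f - f * ncelem u k 1.

(** The coefficient of c_r in E_(k+1)(c) E_k(c)^(-1). Under the nilCoxeter relations the first
    values are 1, u_k and, for k > 0, u_(k-1) u_k - u_k u_(k-1). [locked] keeps the iteration from
    unfolding under simplification. *)
Definition nchook (u : nat -> B) (k r : nat) : B :=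
  locked (iter r (ncshift u k) 1).

Lemma ncelemS u k i : ncelem u k.+1 i.+1 = ncelem u k i.+1 + u k * ncelem u k i.
Proof. by rewrite /ncelem -!lock. Qed.

Lemma ncelem0 u k : ncelem u k 0 = 1. Proof. by rewrite /ncelem -lock; case: k. Qed.

Lemma ncelem0S u i : ncelem u 0 i.+1 = 0. Proof. by rewrite /ncelem -lock. Qed.

Lemma ncelem1S u k : ncelem u k.+1 1 = ncelem u k 1 + u k.
Proof. by rewrite ncelemS ncelem0 mulr1. Qed.

Lemma ncelem_comm_gen (u : nat -> B) k n i :
  (forall j, (j < k)%N -> u j * u n = u n * u j) ->
  ncelem u k i * u n = u n * ncelem u k i.
Proof.
elim: k i => [|k IH] [|i] uC; rewrite ?ncelem0 ?ncelem0S ?mul1r ?mulr1 ?mul0r ?mulr0 //.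
have uC' j : (j < k)%N -> u j * u n = u n * u j by move=> jk; apply: uC; rewrite ltnW.
by rewrite ncelemS mulrDl mulrDr IH // -mulrA IH // !mulrA uC.
Qed.

Section Relations.
Variable u : nat -> B.
Hypothesis uP : nil_coxeter u.

(** Peel off the top generator. It commutes with everything built from the generators at least two
    below it, so by induction the commutator reduces to terms in the two highest generators. These
    cancel by the quadratic and braid relations. *)
Lemma ncelem1_comm k i : ncelem u k 1 * ncelem u k i = ncelem u k i * ncelem u k 1.
Proof.
have [uu uC uB] := uP.
elim: k i => [|k IH] [|i]; rewrite ?ncelem0 ?ncelem0S ?mul1r ?mulr1 ?mul0r //.
(* Two levels are unfolded, since the braid relation involves both [u k] and [u k.+1]. *)
case: k IH => [|k] IH.
  rewrite ncelem1S !ncelemS ncelem0S add0r; case: i => [|i].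
    by rewrite ncelem0 mulr1 ncelem0S add0r.
  by rewrite !ncelem0S !mulr0 addr0 mul0r mulr0.
have cE j : ncelem u k j * u k.+1 = u k.+1 * ncelem u k j.
  by apply: ncelem_comm_gen => l lk; apply: uC.
rewrite ncelem1S [ncelem u k.+2 _]ncelemS; set a := ncelem u k.+1.
have IHa j : a 1%N * a j = a j * a 1%N := IH j.
rewrite !mulrDl !mulrDr (IHa i.+1).
have -> : u k.+1 * (u k.+1 * a i) = 0 by rewrite mulrA uu mul0r.
have -> : a 1%N * (u k.+1 * a i) = u k.+1 * a i * a 1%N + (u k * u k.+1 - u k.+1 * u k) * a i.
  rewrite -[in RHS]mulrA -(IHa i) !mulrA -mulrDl; congr (_ * _).
  rewrite /a ncelem1S mulrDl mulrDr cE.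
  by rewrite [RHS]addrACA subrr addr0.
rewrite addr0 -!addrA; congr (_ + _).
rewrite [RHS]addrCA; congr (_ + _).
have -> : a i.+1 * u k.+1 = u k.+1 * ncelem u k i.+1 + u k * u k.+1 * ncelem u k i.
  by rewrite /a ncelemS mulrDl cE -mulrA cE !mulrA.
have -> : u k.+1 * a i.+1 = u k.+1 * ncelem u k i.+1 + u k.+1 * u k * ncelem u k i.
  by rewrite /a ncelemS mulrDr !mulrA.
rewrite addrC -!addrA; congr (_ + _); rewrite mulrBl /a.
case: i => [|i].
  by rewrite !ncelem0 !mulr1 uu addr0 addrCA subrr addr0.
rewrite ncelemS !mulrDr.
(* Here the braid relation enters. *)
have -> : u k * u k.+1 * (u k * ncelem u k i) = u k.+1 * (u k * ncelem u k i) * u k.+1.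
  by rewrite -!mulrA cE !mulrA uB.
have -> : u k.+1 * u k * (u k * ncelem u k i) = 0.
  by rewrite -mulrA [u k * (_ * _)]mulrA uu mul0r mulr0.
rewrite [in RHS]mulrDl -[u k.+1 * ncelem u k i.+1 * u k.+1]mulrA [ncelem u k i.+1 * u k.+1]cE.
have -> : u k.+1 * (u k.+1 * ncelem u k i.+1) = 0 by rewrite mulrA uu mul0r.
by rewrite add0r addr0 [LHS]addrC addrNK.
Qed.

Lemma nchook0 k : nchook u k 0 = 1. Proof. by rewrite /nchook -lock. Qed.

Lemma nchookS k r : nchook u k r.+1 = ncelem u k.+1 1 * nchook u k r - nchook u k r * ncelem u k 1.
Proof. by rewrite /nchook -!lock. Qed.

Lemma nchook1 k : nchook u k 1 = u k.
Proof. by rewrite nchookS nchook0 mul1r mulr1 ncelem1S addrAC subrr add0r. Qed.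

(** For r = 0 this is the recursion of [ncelem]. Applying [ncshift] preserves it, because
    [ncelem u k.+1 1] and [ncelem u k 1] commute with the elements of their own levels. *)
Lemma ncelem_nchook k r i :
  ncelem u k.+1 i.+1 * nchook u k r
    = nchook u k r * ncelem u k i.+1 + nchook u k r.+1 * ncelem u k i.
Proof.
elim: r i => [|r IH] i; first by rewrite nchook1 nchook0 mulr1 mul1r ncelemS.
have cb j : ncelem u k j * ncelem u k 1 = ncelem u k 1 * ncelem u k j by rewrite ncelem1_comm.
set Z := nchook u k; set a := ncelem u k.+1; set b := ncelem u k in cb *.
have IHr j : a j.+1 * Z r = Z r * b j.+1 + Z r.+1 * b j := IH j.
have aZ q : a 1%N * Z q = Z q.+1 + Z q * b 1%N by rewrite /Z nchookS subrK.
have -> : a i.+1 * Z r.+1 = a 1%N * (a i.+1 * Z r) - a i.+1 * Z r * b 1%N.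
  by rewrite {1}/Z nchookS mulrBr !mulrA /a (ncelem1_comm k.+1).
rewrite !IHr mulrDr [a 1%N * (Z r * _)]mulrA [a 1%N * (Z r.+1 * _)]mulrA !aZ !mulrDl -!mulrA !cb.
by rewrite opprD addrACA !addrA !addrK.
Qed.

End Relations.

End NilCoxeterRelations.

Section Morphisms.
Variables (B B' : nzRingType) (f : {rmorphism B -> B'}).

Lemma rmorph_ncelem (u : nat -> B) k i : f (ncelem u k i) = ncelem (f \o u) k i.
Proof.
elim: k i => [|k IH] [|i]; rewrite ?ncelem0 ?ncelem0S ?rmorph1 ?rmorph0 //.
by rewrite !ncelemS rmorphD rmorphM !IH.
Qed.

Lemma rmorph_nchook (u : nat -> B) k r : f (nchook u k r) = nchook (f \o u) k r.
Proof.
elim: r => [|r IH]; first by rewrite !nchook0 rmorph1.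
by rewrite !nchookS rmorphB !rmorphM IH !rmorph_ncelem.
Qed.
End Morphisms.

Section Ext.
Variable B : nzRingType.
Implicit Types u v : nat -> B.

Lemma eq_ncelem u v k i :
  (forall j, (j < k)%N -> u j = v j) -> ncelem u k i = ncelem v k i.
Proof.
elim: k i => [|k IH] [|i] uv; rewrite ?ncelem0 //.
by rewrite !ncelemS !IH ?uv // => j jk; apply: uv; rewrite ltnW.
Qed.

Lemma eq_nchook u v k r :
  (forall j, (j <= k)%N -> u j = v j) -> nchook u k r = nchook v k r.
Proof.
move=> uv; elim: r => [|r IH]; first by rewrite !nchook0.
rewrite !nchookS IH (@eq_ncelem u v k.+1) // (@eq_ncelem u v k) // => j jk.
by apply: uv; rewrite ltnW.
Qed.

Lemma ncelem_shift u m k i :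
  (forall j, (j < m)%N -> u j = 0) ->
  ncelem u (m + k) i = ncelem (fun j => u (m + j)%N) k i.
Proof.
move=> u0; elim: k i => [|k IH] i.
  rewrite addn0; elim: m u0 i => [|m IHm] u0 [|i]; rewrite ?ncelem0 //.
  by rewrite ncelemS IHm ?u0 ?mul0r ?addr0 ?ncelem0S // => j jm; apply: u0; rewrite ltnW.
by rewrite addnS; case: i => [|i]; rewrite ?ncelem0 // !ncelemS !IH.
Qed.

Lemma nchook_shift u m k r :
  (forall j, (j < m)%N -> u j = 0) ->
  nchook u (m + k) r = nchook (fun j => u (m + j)%N) k r.
Proof.
move=> u0; elim: r => [|r IH]; first by rewrite !nchook0.
by rewrite !nchookS IH -addnS !ncelem_shift.
Qed.

Lemma nchook_trivial u k r : u k = 0 -> (0 < r)%N -> nchook u k r = 0.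
Proof.
move=> uk0; case: r => // r _; elim: r => [|r IH]; first by rewrite nchook1.
by rewrite nchookS IH mulr0 mul0r subr0.
Qed.
End Ext.

(** * The Stanley elements E_k and their linear quotients L_k *)

Section StanleyElements.
Variables (R : comNzRingType) (B : algType R) (u : nat -> B) (M : nat).
Implicit Types (c d : nat -> R) (x : R).

Definition seq_mul c d (k : nat) : R := \sum_(i < k.+1) c i * d (k - i)%N.

(** Multiplication of the generating series by 1 + x t; it adjoins the variable x to a sequence of
    elementary symmetric polynomials. *)
Definition seq_mul_var c x (k : nat) : R :=
  c k + (if k is k'.+1 then x * c k' else 0).

(** The bound [M] is taken past the last nonzero hook; this is the later hypothesis [hook0]. *)
Definition nclin k c : B := \sum_(r < M) c r *: nchook u k r.

Fixpoint ncstan_rec k c : B :=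
  if k is k'.+1 then nclin k' c * ncstan_rec k' c else 1.

(* For c the elementary symmetric polynomials of x_1, .., x_m this is the     *)
(* product of the m commuting elements (1 + x_i u_(k-1)) .. (1 + x_i u_0);    *)
(* its coefficients are the Stanley symmetric functions of S_(k+1).           *)
Definition ncstan k c := locked (ncstan_rec k c).

Lemma ncstan0 c : ncstan 0 c = 1. Proof. by rewrite /ncstan -lock. Qed.

Lemma ncstanS k c : ncstan k.+1 c = nclin k c * ncstan k c.
Proof. by rewrite /ncstan -!lock. Qed.

Fixpoint ncprod_rec k x : B :=
  if k is k'.+1 then (1 + x *: u k') * ncprod_rec k' x else 1.
Definition ncprod k x := locked (ncprod_rec k x).

Lemma ncprod0 x : ncprod 0 x = 1. Proof. by rewrite /ncprod -lock. Qed.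

Lemma ncprodS k x : ncprod k.+1 x = (1 + x *: u k) * ncprod k x.
Proof. by rewrite /ncprod -!lock. Qed.

Lemma ncelem_gt k i : (k < i)%N -> ncelem u k i = 0.
Proof.
elim: k i => [|k IH] [|i] // ki; first by rewrite ncelem0S.
by rewrite ncelemS !IH ?mulr0 ?addr0 // ltnW.
Qed.

Lemma ncprodE k x : ncprod k x = \sum_(i < k.+1) x ^+ i *: ncelem u k i.
Proof.
elim: k => [|k IH].
  by rewrite ncprod0 big_ord_recl big_ord0 ncelem0 expr0 scale1r addr0.
rewrite ncprodS IH mulrDl mul1r [X in X + _]big_ord_recl [RHS]big_ord_recl !ncelem0 -addrA.
congr (_ + _); under [in RHS]eq_bigr => i _ do rewrite ncelemS scalerDr.
rewrite big_split /=; congr (_ + _).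
  by rewrite [RHS]big_ord_recr /= ncelem_gt // scaler0 addr0.
rewrite mulr_sumr; apply: eq_bigr => i _; rewrite exprS.
by rewrite -scalerAl -scalerAr scalerA.
Qed.

Lemma seq_mulE c d K q : (q < K)%N ->
  seq_mul c d q = \sum_(r < K) \sum_(s < K | q == (r + s)%N :> nat) c s * d r.
Proof.
move=> qK; rewrite (exchange_big_dep xpredT) //=.
rewrite /seq_mul (big_ord_widen _ (fun i => c i * d (q - i)%N) qK) big_mkcond.
apply: eq_bigr => s _; rewrite ltnS; case: leqP => [sq|qs].
  have lt_r : (q - s < K)%N by apply: leq_ltn_trans (leq_subr _ _) qK.
  rewrite (big_pred1 (Ordinal lt_r)) // => r; rewrite inE -val_eqE /=.
  by apply/eqP/eqP => [->|->]; rewrite ?addnK ?subnK.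
by rewrite big_pred0 // => r; apply: ltn_eqF; apply: ltn_addl.
Qed.

Hypothesis uP : nil_coxeter u.

Lemma ncprod_comm k x : ncelem u k 1 * ncprod k x = ncprod k x * ncelem u k 1.
Proof.
rewrite ncprodE mulr_sumr mulr_suml; apply: eq_bigr => i _.
by rewrite -scalerAr -scalerAl ncelem1_comm.
Qed.

(** [ncelem_nchook] summed against the powers of x: passing [ncprod] across a hook lowers its level
    by one and adds x times the next hook. *)
Lemma ncprod_nchook k x r :
  ncprod k.+1 x * nchook u k r = (nchook u k r + x *: nchook u k r.+1) * ncprod k x.
Proof.
rewrite ncprodE big_ord_recl ncelem0 expr0 scale1r mulrDl mul1r mulr_suml.
under eq_bigr => i _ do rewrite -scalerAl ncelem_nchook // scalerDr.
rewrite big_split /= addrA mulrDl; congr (_ + _).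
  rewrite big_ord_recr /= ncelem_gt // mulr0 scaler0 addr0.
  rewrite ncprodE big_ord_recl ncelem0 expr0 scale1r mulrDr mulr1; congr (_ + _).
  by rewrite mulr_sumr; apply: eq_bigr => i _; rewrite scalerAr.
rewrite ncprodE mulr_sumr; apply: eq_bigr => i _.
by rewrite -scalerAl -scalerAr scalerA exprS.
Qed.

Hypothesis hook0 : forall k r, (M <= r)%N -> nchook u k r = 0.

Lemma hook_sum_widen k c K : (M <= K)%N ->
  \sum_(r < K) c r *: nchook u k r = nclin k c.
Proof.
move=> MK; rewrite -(subnKC MK) big_split_ord /= [X in _ + X]big1 ?addr0 // => i _.
by rewrite hook0 ?scaler0 // leq_addr.
Qed.

Lemma ncprod_nclin k x c :
  ncprod k.+1 x * nclin k c = nclin k (seq_mul_var c x) * ncprod k x.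
Proof.
rewrite [in LHS]/nclin mulr_sumr; under eq_bigr => r _ do rewrite -scalerAr ncprod_nchook scalerAl.
rewrite -mulr_suml; congr (_ * _).
under eq_bigr => r _ do rewrite scalerDr scalerA [c r * x]mulrC.
rewrite big_split /= -(@hook_sum_widen k (seq_mul_var c x) M.+1) //.
under [in RHS]eq_bigr => r _ do rewrite scalerDl.
rewrite big_split /= !hook_sum_widen //; congr (_ + _).
by rewrite [RHS]big_ord_recl /= scale0r add0r.
Qed.

(** [ncprod] is pushed through the linear factors one at a time. For elementary symmetric sequences
    this is the product formula for E_k. *)
Lemma ncstan_mul_var k c x : ncprod k x * ncstan k c = ncstan k (seq_mul_var c x).
Proof.
elim: k => [|k IH]; first by rewrite ncprod0 !ncstan0 mulr1.
by rewrite !ncstanS mulrA ncprod_nclin -mulrA IH.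
Qed.

Section Commuting.
Variable c : nat -> R.
Hypothesis cC : forall k, ncelem u k 1 * ncstan k c = ncstan k c * ncelem u k 1.

(** The analogue of [ncprod_nchook] for a whole sequence c. Commutation with [ncelem _ _ 1] at both
    levels lets the recursion of [nchook] pass through E. *)
Lemma ncstan_nchook k r :
  ncstan k.+1 c * nchook u k r = (\sum_(s < M) c s *: nchook u k (r + s)) * ncstan k c.
Proof.
elim: r => [|r IH]; first by rewrite nchook0 mulr1 ncstanS.
rewrite nchookS mulrBr mulrA -cC -[ncelem _ _ _ * _ * _]mulrA [ncstan _ _ * (_ * ncelem _ _ _)]mulrA !IH.
rewrite -[_ * ncstan k c * _]mulrA -cC !mulrA -mulrBl; congr (_ * _).
rewrite mulr_sumr mulr_suml -sumrB; apply: eq_bigr => s _.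
by rewrite -scalerAr -scalerAl -scalerBr addSn nchookS.
Qed.

Lemma nclin_mul_ncstan k d :
  nclin k (seq_mul c d) * ncstan k c = ncstan k.+1 c * nclin k d.
Proof.
rewrite [in RHS]/nclin mulr_sumr.
under [RHS]eq_bigr => r _ do rewrite -scalerAr ncstan_nchook scalerAl.
rewrite -mulr_suml; congr (_ * _).
transitivity (\sum_(r < M) \sum_(s < M) \sum_(q < M | q == (r + s)%N :> nat)
                 (c s * d r) *: nchook u k q).
  rewrite /nclin; under eq_bigr => q _ do rewrite (@seq_mulE c d M) // scaler_suml.
  rewrite exchange_big; apply: eq_bigr => r _ /=.
  under eq_bigr => q _ do rewrite scaler_suml.
  by rewrite (exchange_big_dep xpredT).
apply: eq_bigr => r _; rewrite scaler_sumr; apply: eq_bigr => s _.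
rewrite scalerA [d r * _]mulrC; case: (ltnP (r + s)%N M) => [lt_rs|le_rs].
  by rewrite (big_pred1 (Ordinal lt_rs)).
by rewrite hook0 // scaler0 big_pred0 // => q; apply: ltn_eqF; apply: leq_trans le_rs.
Qed.
End Commuting.

(** Level by level, [nclin_mul_ncstan] trades L_k(cd) E_k(c) for E_(k+1)(c) L_k(d). *)
Lemma ncstan_mul c d : (forall k, ncelem u k 1 * ncstan k c = ncstan k c * ncelem u k 1) ->
  forall k, ncstan k (seq_mul c d) = ncstan k c * ncstan k d.
Proof.
move=> cC; elim=> [|k IH]; first by rewrite !ncstan0 mulr1.
by rewrite [LHS]ncstanS IH mulrA nclin_mul_ncstan // -mulrA -ncstanS.
Qed.

Section AntiAutomorphism.
Variable om : {linear B -> B}.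
Hypotheses (om1 : om 1 = 1) (omM : forall f g, om (f * g) = om g * om f)
  (omu : forall k, om (u k) = - u k).

Definition stanley_good c : Prop := forall k,
  [/\ ncelem u k 1 * ncstan k c = ncstan k c * ncelem u k 1,
      om (ncstan k c) * ncstan k c = 1 & ncstan k c * om (ncstan k c) = 1].

Lemma gen_inv x k : (1 - x *: u k) * (1 + x *: u k) = 1 /\ (1 + x *: u k) * (1 - x *: u k) = 1.
Proof.
have xx : (x *: u k) * (x *: u k) = 0.
  by rewrite -scalerAl -scalerAr; have [-> _ _] := uP; rewrite !scaler0.
split; first by rewrite mulrBl mul1r mulrDr mulr1 xx addr0 addrK.
by rewrite mulrDl mul1r mulrBr mulr1 xx subr0 subrK.
Qed.

Lemma ncprod_anti k x : om (ncprod k x) * ncprod k x = 1 /\ ncprod k x * om (ncprod k x) = 1.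
Proof.
elim: k => [|k [IH1 IH2]]; first by rewrite ncprod0 om1 mulr1.
have [g1 g2] := gen_inv x k.
have omE : om (1 + x *: u k) = 1 - x *: u k by rewrite linearD linearZ /= om1 omu scalerN.
rewrite ncprodS omM omE; split.
  by rewrite -mulrA [_ * (_ * ncprod k x)]mulrA g1 mul1r.
by rewrite -mulrA [ncprod k x * (_ * _)]mulrA IH2 mul1r.
Qed.

Lemma stanley_good_var c x : stanley_good c -> stanley_good (seq_mul_var c x).
Proof.
move=> cg k; have [cC c1 c2] := cg k; have [p1 p2] := ncprod_anti k x.
rewrite -ncstan_mul_var omM; split.
- by rewrite mulrA ncprod_comm -!mulrA cC.
- by rewrite -mulrA [om (ncprod k x) * _]mulrA p1 mul1r.
- by rewrite -mulrA [ncstan k c * (_ * _)]mulrA c2 mul1r.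
Qed.
End AntiAutomorphism.
End StanleyElements.

(** * Lengths of permutations and the nilCoxeter algebra *)

Section Length.
Variable n : nat.
Implicit Types u v w : 'S_n.

(** Each inversion is counted in both orders. In this symmetric form the set of a composition is a
    symmetric difference ([disorder_pcomp]). *)
Definition disorder w : {set 'I_n * 'I_n} :=
  [set p : 'I_n * 'I_n | (p.1 < p.2)%N != (w p.1 < w p.2)%N].

Lemma card_disorder w : #|disorder w| = (plength w).*2.
Proof.
pose I := [set p : 'I_n * 'I_n | (p.1 < p.2)%N && (w p.2 < w p.1)%N].
pose sw (p : 'I_n * 'I_n) := (p.2, p.1).
have swK : involutive sw by case.
have -> : disorder w = I :|: (sw @: I).
  apply/setP => -[a b]; rewrite !inE (can_imset_pre _ swK) !inE /=.
  have := @perm_inj _ w a b.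
  case: (ltngtP (val a) (val b)) => [ab|ab|/val_inj ->]; last by rewrite !ltnn.
  - case: (ltngtP (w a) (w b)) => // /val_inj E /(_ E) eab.
    by move: ab; rewrite eab ltnn.
  - by case: (ltngtP (w a) (w b)).
rewrite cardsU card_imset; last exact: inv_inj.
rewrite [X in (_ - #|pred_of_set X|)%N](_ : _ = finset.set0).
  by rewrite cards0 subn0 addnn.
apply/setP => -[a b]; rewrite (can_imset_pre _ swK) !inE /=.
by apply/negP => /andP[/andP[ab _] /andP[ba _]]; lia.
Qed.

Definition perm_pair v (p : 'I_n * 'I_n) := (v p.1, v p.2).

Lemma card_preim_disorder u v : #|perm_pair v @^-1: disorder u| = (plength u).*2.
Proof.
rewrite -card_disorder on_card_preimset //.
exists (perm_pair v^-1%g) => -[a b] _; rewrite /perm_pair /= ?permK ?permKV //.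
Qed.

Lemma disorder_pcomp u v :
  disorder (pcomp u v) =
    (disorder v :\: perm_pair v @^-1: disorder u)
      :|: (perm_pair v @^-1: disorder u :\: disorder v).
Proof.
apply/setP => -[a b]; rewrite !inE /= !pcompE.
by do 3!case: (_ < _)%N.
Qed.

(** Cardinality of the symmetric difference in [disorder_pcomp]; lengths add exactly when the two
    sets are disjoint. *)
Lemma plength_pcomp u v :
  ((plength (pcomp u v)).*2 + (#|disorder v :&: perm_pair v @^-1: disorder u|).*2
    = (plength u + plength v).*2)%N.
Proof.
rewrite -card_disorder disorder_pcomp cardsU.
rewrite [X in (_ - #|pred_of_set X|)%N](_ : _ = finset.set0); last first.
  by apply/setP => p; rewrite !inE; case: (_ != _); case: (_ != _).
rewrite cards0 subn0 !cardsD card_preim_disorder card_disorder finset.setIC.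
have := subset_leq_card (finset.subsetIl (perm_pair v @^-1: disorder u) (disorder v)).
have := subset_leq_card (finset.subsetIr (perm_pair v @^-1: disorder u) (disorder v)).
rewrite card_preim_disorder card_disorder; move: #|_ :&: _| => x.
by rewrite -!addnn; lia.
Qed.

Lemma plength_pcomp_le u v : (plength (pcomp u v) <= plength u + plength v)%N.
Proof. by have := plength_pcomp u v; lia. Qed.

Definition lenadd u v : bool := (plength u + plength v == plength (pcomp u v))%N.

Lemma lenadd_disorder u v :
  lenadd u v -> disorder v \subset disorder (pcomp u v).
Proof.
move=> /eqP uv; have := plength_pcomp u v; rewrite -uv => E.
have /cards0_eq D0 : #|disorder v :&: perm_pair v @^-1: disorder u| = 0%N by lia.
rewrite disorder_pcomp; apply/fintype.subsetP => p pv.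
rewrite inE; apply/orP; left; rewrite inE pv andbT; apply/negP => pu.
by have := finset.in_set0 p; rewrite -D0 inE pv pu.
Qed.

Lemma pcompA u v w : pcomp u (pcomp v w) = pcomp (pcomp u v) w.
Proof. by rewrite /pcomp mulgA. Qed.

Lemma pcomp1g u : pcomp 1%g u = u. Proof. by rewrite /pcomp mulg1. Qed.
Lemma pcompg1 u : pcomp u 1%g = u. Proof. by rewrite /pcomp mul1g. Qed.

Lemma plength1 : plength (1%g : 'S_n) = 0%N.
Proof. by apply/eqP; rewrite cards_eq0; apply/eqP/setP => -[a b]; rewrite !inE !perm1 /=; lia. Qed.

Lemma plengthV u : plength u^-1%g = plength u.
Proof.
have := plength_pcomp u^-1%g u.
rewrite [pcomp _ _](_ : _ = 1%g) ?plength1; last by rewrite /pcomp mulgV.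
have -> : perm_pair u @^-1: disorder u^-1%g = disorder u.
  by apply/setP => -[a b]; rewrite !inE /= !permK eq_sym.
rewrite finset.setIid card_disorder; lia.
Qed.

(** Both sides say that the three lengths sum to that of the triple product, because length is
    subadditive. *)
Lemma lenaddA u v w :
  lenadd u v && lenadd (pcomp u v) w = lenadd v w && lenadd u (pcomp v w).
Proof.
rewrite /lenadd -pcompA.
have := plength_pcomp_le u v; have := plength_pcomp_le v w.
have := plength_pcomp_le u (pcomp v w); have := plength_pcomp_le (pcomp u v) w.
by rewrite -pcompA; lia.
Qed.

Lemma lenaddV u v : lenadd v^-1%g u^-1%g = lenadd u v.
Proof. by rewrite /lenadd !plengthV addnC /pcomp -invMg plengthV. Qed.

(** The map w carries the elements below b onto those below w b, so the two have the same rank. *)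
Lemma perm_fix_mono w (b : 'I_n) :
  (forall a : 'I_n, (a < b)%N -> (w a < w b)%N) ->
  (forall a : 'I_n, (b < a)%N -> (w b < w a)%N) -> w b = b.
Proof.
move=> lo hi; apply/val_inj => /=.
have cardlt (k : 'I_n) : #|[set x : 'I_n | (x < k)%N]| = k.
  rewrite cardsE -sum1_card (eq_bigl (fun x : 'I_n => (x < k)%N)) //.
  by rewrite -(big_ord_widen _ (fun=> 1%N)) ?sum1_card ?card_ord // ltnW.
rewrite -[LHS]cardlt -[RHS]cardlt.
rewrite -(on_card_preimset (f := w)); last first.
  by exists (w^-1%g) => x _; rewrite ?permK ?permKV.
apply: eq_card => a; rewrite !inE.
case: (ltngtP (val a) (val b)) => [/lo -> //|/hi wba|/val_inj ->]; last by rewrite ltnn.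
by apply/negbTE; rewrite -leqNgt ltnW.
Qed.

Lemma disorder_fix w (k : nat) (b : 'I_n) :
  (forall c d : 'I_n, (k <= d)%N -> (c < d)%N -> (w c < w d)%N) -> (k <= b)%N -> w b = b.
Proof.
move=> H kb; apply: perm_fix_mono => a ab; first exact: H.
by apply: H => //; apply: leq_trans kb (ltnW ab).
Qed.

End Length.

Arguments lenadd {n} u v.

(* Formal combinations of permutations, with u * v equal to the composition   *)
(* of u and v if the lengths add up and to 0 otherwise.                       *)
Definition nilcox (R : comNzRingType) (n : nat) : Type := {ffun 'S_n -> R^o}.

Identity Coercion nilcox_finfun : nilcox >-> finfun_of.

HB.instance Definition _ (R : comNzRingType) (n : nat) :=
  GRing.Lmodule.copy (nilcox R n) {ffun 'S_n -> R^o}.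

Section NilCoxeterAlgebra.
Variables (R : comNzRingType) (n : nat).
Implicit Types f g h : nilcox R n.

Definition nc_one : nilcox R n := [ffun w => (w == 1%g)%:R].

Definition nc_mul f g : nilcox R n :=
  [ffun w => \sum_(u : 'S_n) \sum_(v : 'S_n)
     if lenadd u v && (pcomp u v == w) then f u * g v else 0].

Fact nc_mulA : associative nc_mul.
Proof.
move=> f g h; apply/ffunP => w; rewrite !ffunE.
transitivity (\sum_(u : 'S_n) \sum_(v : 'S_n) \sum_(x : 'S_n)
   if [&& lenadd v x, lenadd u (pcomp v x) & pcomp u (pcomp v x) == w]
   then f u * (g v * h x) else 0).
  apply: eq_bigr => u _.
  transitivity (\sum_(y : 'S_n) \sum_(v : 'S_n) \sum_(x : 'S_n)
     if [&& lenadd v x, pcomp v x == y, lenadd u y & pcomp u y == w]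
     then f u * (g v * h x) else 0).
    apply: eq_bigr => y _; rewrite ffunE.
    case: ifP => uy; last first.
      by rewrite big1 // => v _; rewrite big1 // => x _; rewrite !andbF.
    rewrite mulr_sumr; apply: eq_bigr => v _; rewrite mulr_sumr; apply: eq_bigr => x _.
    by rewrite !andbT; case: ifP; rewrite ?mulr0.
  rewrite exchange_big; apply: eq_bigr => v _; rewrite exchange_big; apply: eq_bigr => x _ /=.
  rewrite (bigD1 (pcomp v x)) //= eqxx /= big1 ?addr0 // => y /negbTE.
  by rewrite eq_sym => ->; rewrite andbF.
transitivity (\sum_(u : 'S_n) \sum_(v : 'S_n) \sum_(x : 'S_n)
   if [&& lenadd u v, lenadd (pcomp u v) x & pcomp (pcomp u v) x == w]
   then f u * g v * h x else 0).
  apply: eq_bigr => u _; apply: eq_bigr => v _; apply: eq_bigr => x _.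
  by rewrite mulrA pcompA !andbA lenaddA.
transitivity (\sum_(x : 'S_n) \sum_(u : 'S_n) \sum_(v : 'S_n)
   if [&& lenadd u v, lenadd (pcomp u v) x & pcomp (pcomp u v) x == w]
   then f u * g v * h x else 0).
  rewrite [RHS]exchange_big; apply: eq_bigr => u _; exact: exchange_big.
rewrite [RHS]exchange_big; apply: eq_bigr => x _ /=.
transitivity (\sum_(y : 'S_n) \sum_(u : 'S_n) \sum_(v : 'S_n)
   if [&& lenadd u v, pcomp u v == y, lenadd y x & pcomp y x == w]
   then f u * g v * h x else 0); last first.
  apply: eq_bigr => y _; rewrite ffunE.
  case: ifP => yx; last first.
    by rewrite big1 // => u _; rewrite big1 // => v _; rewrite !andbF.
  rewrite mulr_suml; apply: eq_bigr => u _; rewrite mulr_suml; apply: eq_bigr => v _.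
  by rewrite !andbT; case: ifP; rewrite ?mul0r.
rewrite [RHS]exchange_big; apply: eq_bigr => u _; rewrite exchange_big; apply: eq_bigr => v _ /=.
rewrite (bigD1 (pcomp u v)) //= eqxx /= big1 ?addr0 // => y yuv.
by rewrite [pcomp u v == y]eq_sym (negbTE yuv) andbF.
Qed.

Lemma lenadd1g (u : 'S_n) : lenadd 1%g u.
Proof. by rewrite /lenadd plength1 pcomp1g. Qed.

Lemma lenaddg1 (u : 'S_n) : lenadd u 1%g.
Proof. by rewrite /lenadd plength1 pcompg1 addn0. Qed.

Fact nc_mul1l : left_id nc_one nc_mul.
Proof.
move=> f; apply/ffunP => w; rewrite ffunE (bigD1 1%g) //= [X in _ + X]big1 ?addr0; last first.
  by move=> u /negbTE u1; rewrite big1 // => v _; rewrite ffunE u1 mul0r if_same.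
rewrite (bigD1 w) //= lenadd1g pcomp1g eqxx ffunE eqxx mul1r big1 ?addr0 // => v /negbTE vw.
by rewrite pcomp1g vw andbF.
Qed.

Fact nc_mul1r : right_id nc_one nc_mul.
Proof.
move=> f; apply/ffunP => w; rewrite ffunE (bigD1 w) //= [X in _ + X]big1 ?addr0; last first.
  move=> u /negbTE uw; rewrite big1 // => v _; rewrite ffunE.
  by case: (v =P 1%g) => [->|]; rewrite ?pcompg1 ?uw ?andbF // mulr0 if_same.
rewrite (bigD1 1%g) //= lenaddg1 pcompg1 eqxx ffunE eqxx mulr1 big1 ?addr0 // => v /negbTE v1.
by rewrite ffunE v1 mulr0 if_same.
Qed.

Fact nc_mulDl : left_distributive nc_mul +%R.
Proof.
move=> f g h; apply/ffunP => w; rewrite !ffunE -big_split; apply: eq_bigr => u _ /=.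
rewrite -big_split; apply: eq_bigr => v _ /=.
by rewrite ffunE mulrDl; case: ifP; rewrite ?addr0.
Qed.

Fact nc_mulDr : right_distributive nc_mul +%R.
Proof.
move=> f g h; apply/ffunP => w; rewrite !ffunE -big_split; apply: eq_bigr => u _ /=.
rewrite -big_split; apply: eq_bigr => v _ /=.
by rewrite ffunE mulrDr; case: ifP; rewrite ?addr0.
Qed.

Fact nc_one_neq0 : nc_one != 0.
Proof.
by apply/eqP => /ffunP /(_ 1%g) /eqP; rewrite !ffunE eqxx oner_eq0.
Qed.

HB.instance Definition _ := GRing.Zmodule_isNzRing.Build (nilcox R n)
  nc_mulA nc_mul1l nc_mul1r nc_mulDl nc_mulDr nc_one_neq0.

Lemma nc_mulE f g w : (f * g) w = \sum_(u : 'S_n) \sum_(v : 'S_n)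
  if lenadd u v && (pcomp u v == w) then f u * g v else 0.
Proof. by rewrite ffunE. Qed.

Lemma nc_oneE w : (1 : nilcox R n) w = (w == 1%g)%:R.
Proof. by rewrite ffunE. Qed.

Lemma nc_addE f g w : (f + g) w = f w + g w. Proof. by rewrite ffunE. Qed.

Lemma nc_oppE f w : (- f) w = - f w. Proof. by rewrite ffunE. Qed.

Lemma nc_zeroE w : (0 : nilcox R n) w = 0. Proof. by rewrite ffunE. Qed.

Lemma nc_scaleE (a : R) f w : (a *: f) w = a * f w. Proof. by rewrite ffunE. Qed.

Lemma nc_sumE (I : Type) (r : seq I) (P : pred I) (F : I -> nilcox R n) w :
  (\sum_(i <- r | P i) F i) w = \sum_(i <- r | P i) F i w.
Proof.
by apply: (big_morph (fun f : nilcox R n => f w)) => [f g|]; rewrite ?nc_addE ?nc_zeroE.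
Qed.


Fact nc_scalerAl (a : R) f g : a *: (f * g) = a *: f * g.
Proof.
apply/ffunP => w; rewrite nc_scaleE !nc_mulE mulr_sumr; apply: eq_bigr => u _.
rewrite mulr_sumr; apply: eq_bigr => v _.
by case: ifP => _; rewrite ?mulr0 // nc_scaleE mulrA.
Qed.

HB.instance Definition _ :=
  GRing.Lmodule_isLalgebra.Build R (nilcox R n) nc_scalerAl.

Fact nc_scalerAr (a : R) f g : a *: (f * g) = f * (a *: g).
Proof.
apply/ffunP => w; rewrite nc_scaleE !nc_mulE mulr_sumr; apply: eq_bigr => u _.
rewrite mulr_sumr; apply: eq_bigr => v _.
by case: ifP => _; rewrite ?mulr0 // nc_scaleE mulrCA.
Qed.

HB.instance Definition _ :=
  GRing.Lalgebra_isAlgebra.Build R (nilcox R n) nc_scalerAr.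

Definition nc_perm (u : 'S_n) : nilcox R n := [ffun w => (w == u)%:R].

Lemma nc_permE u w : nc_perm u w = (w == u)%:R. Proof. by rewrite ffunE. Qed.

Lemma nc_perm_mul u v :
  nc_perm u * nc_perm v = if lenadd u v then nc_perm (pcomp u v) else 0.
Proof.
apply/ffunP => w; rewrite nc_mulE (bigD1 u) //= [X in _ + X]big1 ?addr0; last first.
  by move=> x /negbTE xu; rewrite big1 // => y _; rewrite nc_permE xu mul0r if_same.
rewrite (bigD1 v) //= [X in _ + X]big1 ?addr0; last first.
  by move=> x /negbTE xu; rewrite [nc_perm v x]nc_permE xu mulr0 if_same.
rewrite !nc_permE !eqxx mulr1; case: (lenadd u v); rewrite ?nc_permE ?nc_zeroE //= eq_sym.
by case: (_ == _).
Qed.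

Lemma nc_perm1 : nc_perm 1%g = 1.
Proof. by apply/ffunP => w; rewrite [RHS]nc_oneE nc_permE. Qed.

Lemma nc_expand f : f = \sum_u f u *: nc_perm u.
Proof.
apply/ffunP => w; rewrite nc_sumE (bigD1 w) //= nc_scaleE nc_permE eqxx mulr1.
by rewrite big1 ?addr0 // => u /negbTE uw; rewrite nc_scaleE nc_permE eq_sym uw mulr0.
Qed.

(** The anti-automorphism with u_k -> - u_k. It inverts products of factors 1 + x u_k, and it
    carries the sign and the inverse permutation in the definition of [double_usch]. *)
Definition nc_anti f : nilcox R n := [ffun w => (-1) ^+ plength w * f w^-1%g].

Fact nc_anti_linear : linear nc_anti.
Proof.
move=> a f g; apply/ffunP => w.
by rewrite nc_addE nc_scaleE !ffunE mulrDr mulrCA.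
Qed.
HB.instance Definition _ := GRing.isLinear.Build R (nilcox R n) (nilcox R n) _ nc_anti nc_anti_linear.

Lemma nc_anti1 : nc_anti 1 = 1.
Proof.
apply/ffunP => w; rewrite ffunE !nc_oneE invg_eq1.
by case: eqP => [->|]; rewrite ?mulr0 // plength1 mul1r.
Qed.

Lemma nc_antiM f g : nc_anti (f * g) = nc_anti g * nc_anti f.
Proof.
apply/ffunP => w; rewrite ffunE !nc_mulE mulr_sumr.
rewrite [RHS](reindex_inj invg_inj) exchange_big [RHS](reindex_inj invg_inj).
apply: eq_bigr => x _; rewrite mulr_sumr; apply: eq_bigr => y _ /=.
rewrite lenaddV; have -> : pcomp y^-1%g x^-1%g = (pcomp x y)^-1%g by rewrite /pcomp invMg.
rewrite [_ == w](inv_eq invgK) /=.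
case: ifP => [/andP[/eqP red /eqP xyw]|]; last by rewrite mulr0.
rewrite ![nc_anti _ _]ffunE !invgK !plengthV -[w]invgK -xyw plengthV -red exprD.
by rewrite [(-1) ^+ plength x * _]mulrC [f x * _]mulrC mulrACA.
Qed.
End NilCoxeterAlgebra.

Section SumInjection.

Lemma sum_injection (V : nmodType) (I J : finType) (h : I -> J) (F : J -> V) :
  injective h -> (forall j, (forall i, j != h i) -> F j = 0) ->
  \sum_j F j = \sum_i F (h i).
Proof.
move=> h_inj F0; rewrite (bigID (mem (h @: I))) /= [X in _ + X]big1 ?addr0.
  by rewrite big_imset //= => i j _ _; apply: h_inj.
move=> j jI; apply: F0 => i; apply: contra jI => /eqP ->; exact: imset_f.
Qed.
End SumInjection.

Section Adjacent.
Variable n : nat.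
Implicit Types u v w : 'S_n.

Section Transposition.
Variables i j : 'I_n.
Hypothesis ij : j = i.+1 :> nat.

Lemma disorder_tperm : disorder (tperm i j) = [set (i, j); (j, i)].
Proof.
have neq (x y : 'I_n) : x <> y -> (x != y :> nat) by move/eqP.
apply/setP => -[a b]; rewrite !inE /= !xpair_eqE -!val_eqE /=.
case: (tpermP i j a) => [->|->|/neq ai /neq aj];
  case: (tpermP i j b) => [->|->|/neq bi /neq bj]; lia.
Qed.

Lemma neq_adjacent : i != j.
Proof. by rewrite -val_eqE /= ij; lia. Qed.

Lemma plength_tperm : plength (tperm i j) = 1%N.
Proof.
have := card_disorder (tperm i j); rewrite disorder_tperm cards2 xpair_eqE.
by rewrite (negbTE neq_adjacent) /=; lia.
Qed.

Lemma disorder_tperm_cap w :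
  #|disorder (tperm i j) :&: perm_pair (tperm i j) @^-1: disorder w|
    = ((w j < w i)%N : nat).*2.
Proof.
have wij : w i != w j :> nat by rewrite val_eqE (inj_eq perm_inj) neq_adjacent.
rewrite disorder_tperm; set P := perm_pair _ @^-1: _.
have Pij : ((i, j) \in P) = (w j < w i)%N.
  by rewrite !inE /= tpermL tpermR; lia.
have Pji : ((j, i) \in P) = (w j < w i)%N.
  by rewrite !inE /= tpermL tpermR; lia.
rewrite finset.setIUl cardsU.
have I1 p : #|[set p] :&: P| = (p \in P).
  rewrite finset.setIC; case: (boolP (p \in P)) => pP.
    by rewrite (finset.setIidPr _) ?cards1 // finset.sub1set.
  apply/eqP; rewrite cards_eq0; apply/eqP/setP => q; rewrite !inE.
  by apply/negP => /andP[qP /eqP qp]; move: pP; rewrite -qp !inE qP.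
rewrite !I1 Pij Pji addnn [X in (_ - #|pred_of_set X|)%N](_ : _ = finset.set0) ?cards0 ?subn0 //.
apply/setP => q; rewrite !inE; apply/negP => /andP[/andP[/eqP -> _] /andP[/eqP [E _] _]].
by have := neq_adjacent; rewrite E eqxx.
Qed.

Lemma lenadd_tperm w : lenadd w (tperm i j) = (w i < w j)%N.
Proof.
have := plength_pcomp w (tperm i j); rewrite disorder_tperm_cap /lenadd plength_tperm.
have : w i != w j :> nat by rewrite val_eqE (inj_eq perm_inj) neq_adjacent.
by case: (ltngtP (w i) (w j)) => //= _ _; lia.
Qed.

Lemma pcomp_tpermK w : pcomp (pcomp w (tperm i j)) (tperm i j) = w.
Proof. by apply/permP => x; rewrite !pcompE tpermK. Qed.

Lemma plength_descent w : (w j < w i)%N -> plength w = (plength (pcomp w (tperm i j))).+1.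
Proof.
move=> ji; have : lenadd (pcomp w (tperm i j)) (tperm i j).
  by rewrite lenadd_tperm !pcompE tpermL tpermR.
by rewrite /lenadd pcomp_tpermK plength_tperm addn1 => /eqP.
Qed.

Lemma plength_ascent w : (w i < w j)%N -> plength (pcomp w (tperm i j)) = (plength w).+1.
Proof. by rewrite -lenadd_tperm => /eqP <-; rewrite plength_tperm addn1. Qed.
End Transposition.

Lemma mono_perm1 w : (forall a b : 'I_n, (a < b)%N -> (w a < w b)%N) -> w = 1%g.
Proof.
move=> H; apply/permP => b; rewrite perm1.
by apply: perm_fix_mono => a; apply: H.
Qed.

Lemma adjacent_mono (r : rel nat) (f : 'I_n -> nat) :
  transitive r -> (forall i j : 'I_n, j = i.+1 :> nat -> r (f i) (f j)) ->
  forall a b : 'I_n, (a < b)%N -> r (f a) (f b).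
Proof.
move=> rT H a b ab; have [d db] : exists d, (b = a + d.+1 :> nat)%N by exists (b - a.+1)%N; lia.
elim: d b db ab => [|d IH] b db ab; first by apply: H; rewrite db addn1.
have ltb : (b.-1 < n)%N by have := ltn_ord b; lia.
apply: (rT (f (Ordinal ltb))); first by apply: IH => /=; lia.
by apply: H => /=; lia.
Qed.

Lemma exists_descent w : w != 1%g -> exists i j : 'I_n, j = i.+1 :> nat /\ (w j < w i)%N.
Proof.
move=> w1; apply: contrapT => H; case/eqP: w1; apply: mono_perm1.
apply: (adjacent_mono (r := ltn)); first exact: ltn_trans.
move=> i j ij; rewrite /= ltnNge leq_eqVlt; apply/negP => /orP[]; last by move=> ?; apply: H; exists i, j.
by rewrite val_eqE (inj_eq perm_inj) eq_sym (negbTE (neq_adjacent ij)).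
Qed.

Lemma exists_ascent w : w != plongest n -> exists i j : 'I_n, j = i.+1 :> nat /\ (w i < w j)%N.
Proof.
move=> w0; apply: contrapT => H; case/eqP: w0.
have D (a b : 'I_n) : (a < b)%N -> (w b < w a)%N.
  apply: (adjacent_mono (r := gtn) (f := fun x => w x)).
    by move=> x y z /= xy yz; apply: ltn_trans yz xy.
  move=> i j ij; rewrite /= ltnNge leq_eqVlt; apply/negP => /orP[]; last by move=> ?; apply: H; exists i, j.
  by rewrite val_eqE (inj_eq perm_inj) (negbTE (neq_adjacent ij)).
have /permP E : pcomp (plongest n) w = 1%g.
  apply: mono_perm1 => a b /D; rewrite !pcompE !permE /=.
  by have := ltn_ord (w a); have := ltn_ord (w b); lia.
apply/permP => x; rewrite permE -[LHS]rev_ordK; congr rev_ord.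
by have := E x; rewrite pcompE permE perm1.
Qed.
End Adjacent.

Section Generators.
Variables (R : comNzRingType) (n : nat).
Implicit Types (f g : nilcox R n) (u v w : 'S_n).

Definition adj_perm (k : nat) : 'S_n :=
  match insub k, insub k.+1 with
  | Some i, Some j => tperm i j
  | _, _ => 1%g
  end.

(** The value 0 outside the range makes the nilCoxeter relations hold for all natural indices. *)
Definition nc_gen (k : nat) : nilcox R n :=
  if (k.+1 < n)%N then nc_perm R (adj_perm k) else 0.

Lemma adj_permE (i j : 'I_n) : j = i.+1 :> nat -> adj_perm i = tperm i j.
Proof.
move=> ij; rewrite /adj_perm -ij !(insubT (fun k => (k < n)%N) (ltn_ord _)).
by congr tperm; apply/val_inj.
Qed.

Lemma nc_gen_ge k : (n <= k.+1)%N -> nc_gen k = 0.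
Proof. by rewrite /nc_gen ltnNge => ->. Qed.

Variant adjacent_spec k : Prop :=
  AdjacentSpec (i j : 'I_n) of i = k :> nat & j = k.+1 :> nat & adj_perm k = tperm i j.

Lemma adjacentP k : (k.+1 < n)%N -> adjacent_spec k.
Proof.
move=> kn; have ij : Ordinal kn = (Ordinal (ltnW kn)).+1 :> nat by [].
by apply: (AdjacentSpec (i := Ordinal (ltnW kn)) (j := Ordinal kn)) => //; rewrite -(adj_permE ij).
Qed.

Lemma nc_genE (i j : 'I_n) : j = i.+1 :> nat -> nc_gen i = nc_perm R (tperm i j).
Proof. by move=> ij; rewrite /nc_gen -ij ltn_ord (adj_permE ij). Qed.

Lemma nc_mul_gen f (i j : 'I_n) w : j = i.+1 :> nat ->
  (f * nc_gen i) w = if (w j < w i)%N then f (pcomp w (tperm i j)) else 0.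
Proof.
move=> ij; rewrite (nc_genE ij) nc_mulE exchange_big /= (bigD1 (tperm i j)) //=.
rewrite [X in _ + X]big1 ?addr0; last first.
  by move=> v /negbTE vs; rewrite big1 // => u _; rewrite nc_permE vs mulr0 if_same.
have wE u : (pcomp u (tperm i j) == w) = (u == pcomp w (tperm i j)).
  by apply/eqP/eqP => [<-|->]; rewrite pcomp_tpermK.
rewrite (bigD1 (pcomp w (tperm i j))) //= [X in _ + X]big1 ?addr0; last first.
  by move=> u /negbTE uw; rewrite wE uw andbF.
rewrite wE eqxx andbT (lenadd_tperm ij) !pcompE tpermL tpermR nc_permE eqxx mulr1 //.
Qed.

Lemma nil_coxeter_gen : nil_coxeter nc_gen.
Proof.
split.
- move=> k; have [kn|nk] := ltnP k.+1 n; last by rewrite nc_gen_ge // mulr0.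
  have [i j ik jk E] := adjacentP kn.
  have ij : j = i.+1 :> nat by rewrite jk ik.
  rewrite -ik (nc_genE ij) nc_perm_mul (lenadd_tperm ij) tpermL tpermR ij.
  by rewrite ltnNge leqnSn.
- move=> p q pq; have [qn|nq] := ltnP q.+1 n; last first.
    by rewrite [nc_gen q]nc_gen_ge // mulr0 mul0r.
  have pn : (p.+1 < n)%N by lia.
  have [i j ik jk E] := adjacentP pn; have [i' j' ik' jk' E'] := adjacentP qn.
  rewrite /nc_gen qn pn E E' !nc_perm_mul.
  have C : pcomp (tperm i j) (tperm i' j') = pcomp (tperm i' j') (tperm i j).
    rewrite /pcomp conjgC tpermJ; congr (_ * tperm _ _)%g;
      by rewrite tpermD // -val_eqE /=; lia.
  by rewrite /lenadd C addnC.
- move=> k; have [kn|nk] := ltnP k.+2 n; last first.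
    by rewrite [nc_gen k.+1]nc_gen_ge // mulr0 !mul0r.
  have [i j ik jk E] := adjacentP (ltnW kn); have [i' j' ik' jk' E'] := adjacentP kn.
  rewrite /nc_gen kn (ltnW kn) E E' -!mulrA !nc_perm_mul.
  have ij : j = i.+1 :> nat by rewrite jk ik.
  have jE : i' = j by apply/val_inj; rewrite /= ik' jk.
  have jj : j' = j.+1 :> nat by rewrite jk jk'.
  have ne1 : i != j' by rewrite -val_eqE /=; lia.
  have ne2 : i != j by rewrite -val_eqE /=; lia.
  have ne3 : j != j' by rewrite -val_eqE /=; lia.
  have l1 : lenadd (tperm j j') (tperm i j).
    by rewrite (lenadd_tperm ij) tpermL tpermD 1?eq_sym // 1?eq_sym //; lia.
  have l2 : lenadd (tperm i j) (tperm j j').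
    by rewrite (lenadd_tperm jj) tpermR tpermD // 1?eq_sym //; lia.
  rewrite jE l1 l2 !nc_perm_mul.
  have B : pcomp (tperm i j) (pcomp (tperm j j') (tperm i j)) = pcomp (tperm j j') (pcomp (tperm i j) (tperm j j')).
    have := tpermJ j j' (tperm i j); have := tpermJ i j (tperm j j').
    rewrite tpermR tpermL !tpermD // 1?eq_sym // => E1 E2.
    transitivity (tperm i j'); rewrite /pcomp -mulgA.
      by rewrite -[X in (X * _)%g]tpermV -conjgE.
    by rewrite -[X in _ = (X * _)%g]tpermV -conjgE.
  rewrite /lenadd B -(eqP l1) -(eqP l2) (plength_tperm ij) (plength_tperm jj) //.
Qed.
End Generators.

Section BaseChange.
Variables (R R' : comNzRingType) (phi : {rmorphism R -> R'}) (n : nat).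
Implicit Types f g : nilcox R n.

Definition nc_map f : nilcox R' n := [ffun w => phi (f w)].

Lemma nc_mapE f w : nc_map f w = phi (f w). Proof. by rewrite ffunE. Qed.

Fact nc_map_zmod : zmod_morphism nc_map.
Proof.
by move=> f g; apply/ffunP => w; rewrite nc_addE nc_oppE !nc_mapE nc_addE nc_oppE rmorphB.
Qed.

Fact nc_map_monoid : monoid_morphism nc_map.
Proof.
split; first by apply/ffunP => w; rewrite nc_mapE !nc_oneE rmorph_nat.
move=> f g; apply/ffunP => w; rewrite nc_mapE !nc_mulE rmorph_sum; apply: eq_bigr => u _.
rewrite rmorph_sum; apply: eq_bigr => v _.
by rewrite !nc_mapE; case: ifP; rewrite ?rmorphM ?rmorph0.
Qed.

HB.instance Definition _ := GRing.isZmodMorphism.Build _ _ nc_map nc_map_zmod.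
HB.instance Definition _ := GRing.isMonoidMorphism.Build _ _ nc_map nc_map_monoid.

Lemma nc_mapZ a f : nc_map (a *: f) = phi a *: nc_map f.
Proof. by apply/ffunP => w; rewrite nc_scaleE !nc_mapE nc_scaleE rmorphM. Qed.

Lemma nc_map_gen k : nc_map (nc_gen R n k) = nc_gen R' n k.
Proof.
rewrite /nc_gen; case: ifP => _; last by rewrite rmorph0.
by apply/ffunP => w; rewrite nc_mapE !nc_permE rmorph_nat.
Qed.

Lemma nc_map_anti f : nc_map (nc_anti f) = nc_anti (nc_map f).
Proof. by apply/ffunP => w; rewrite !ffunE rmorphM rmorph_sign. Qed.

Lemma nc_map_inj : injective phi -> injective nc_map.
Proof. by move=> phiI f g /ffunP fg; apply/ffunP => w; apply: phiI; rewrite -!nc_mapE fg. Qed.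
End BaseChange.

(** * Restriction to the parabolic subgroups S_k *)

Section Parabolic.
Variables (R : comNzRingType) (n k : nat).
Implicit Types (f g : nilcox R n) (u v w : 'S_n).

Lemma in_symP w : reflect (forall j : 'I_n, (k <= j)%N -> w j = j) (in_sym k w).
Proof.
apply: (iffP forallP) => H j; first by move=> kj; have := H j; rewrite kj => /eqP.
by apply/implyP => kj; rewrite H.
Qed.

Lemma in_sym1 : in_sym k (1%g : 'S_n).
Proof. by apply/in_symP => j _; rewrite perm1. Qed.

(** By [lenadd_disorder], an inversion of v involving a point at or beyond k would be an inversion
    of the product. This is what makes [nc_restr] multiplicative. *)
Lemma lenadd_in_sym u v :
  lenadd u v -> in_sym k (pcomp u v) = in_sym k u && in_sym k v.
Proof.
move=> uv; apply/in_symP/andP => [uvk|[/in_symP uk /in_symP vk] j kj]; last first.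
  by rewrite pcompE vk // uk.
have vk (d : 'I_n) : (k <= d)%N -> v d = d.
  apply: disorder_fix => c e ke ce; rewrite ltnNge; apply/negP => vec.
  have: (c, e) \in disorder v by rewrite inE /= ce ltnNge vec.
  move=> /(fintype.subsetP (lenadd_disorder uv)); rewrite inE /= ce (uvk e) //.
  case: (leqP k (pcomp u v c)) => [kc|ck]; last by rewrite (leq_trans ck ke).
  by have /perm_inj -> := uvk _ kc; rewrite ce.
split; apply/in_symP => // j kj; by rewrite -{1}(vk j kj) -pcompE uvk.
Qed.

Definition nc_restr f : nilcox R n := [ffun w => if in_sym k w then f w else 0].

Lemma nc_restrE f w : nc_restr f w = if in_sym k w then f w else 0.
Proof. by rewrite ffunE. Qed.

Fact nc_restr_zmod : zmod_morphism nc_restr.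
Proof.
move=> f g; apply/ffunP => w; rewrite nc_addE nc_oppE !nc_restrE nc_addE nc_oppE.
by case: ifP; rewrite ?subr0.
Qed.

Fact nc_restr_monoid : monoid_morphism nc_restr.
Proof.
split; first by apply/ffunP => w; rewrite nc_restrE !nc_oneE; case: eqP => [->|]; rewrite ?in_sym1 ?if_same.
move=> f g; apply/ffunP => w; rewrite nc_restrE !nc_mulE.
case: ifP => wk; last first.
  rewrite big1 // => u _; rewrite big1 // => v _; case: ifP => // /andP[uv /eqP uvw].
  move: wk; rewrite -uvw lenadd_in_sym // => /negbT; rewrite negb_and => /orP[] /negbTE E;
  by rewrite !nc_restrE E ?mul0r ?mulr0.
apply: eq_bigr => u _; apply: eq_bigr => v _; case: ifP => // /andP[uv /eqP uvw].
by move: wk; rewrite -uvw lenadd_in_sym // !nc_restrE => /andP[-> ->].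
Qed.

HB.instance Definition _ := GRing.isZmodMorphism.Build _ _ nc_restr nc_restr_zmod.
HB.instance Definition _ := GRing.isMonoidMorphism.Build _ _ nc_restr nc_restr_monoid.

Lemma nc_restrZ a f : nc_restr (a *: f) = a *: nc_restr f.
Proof. by apply/ffunP => w; rewrite nc_scaleE !nc_restrE nc_scaleE; case: ifP; rewrite ?mulr0. Qed.

Lemma in_sym_tperm (i j : 'I_n) : j = i.+1 :> nat -> in_sym k (tperm i j) = (j < k)%N.
Proof.
move=> ij; apply/in_symP/idP => [H|jk x kx]; last first.
  by rewrite tpermD // -val_eqE /=; lia.
rewrite ltnNge; apply/negP => /H; rewrite tpermR => E; move: ij; rewrite -E; lia.
Qed.

Lemma nc_restr_gen j : nc_restr (nc_gen R n j) = if (j.+1 < k)%N then nc_gen R n j else 0.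
Proof.
have [jn|nj] := ltnP j.+1 n; last by rewrite !nc_gen_ge // rmorph0 if_same.
have [i i' ij ij' _] := adjacentP jn.
have ii : i' = i.+1 :> nat by rewrite ij ij'.
rewrite -ij (nc_genE R ii); apply/ffunP => w; rewrite nc_restrE nc_permE.
rewrite ij -ij' -(in_sym_tperm ii); case: (w =P tperm i i') => [->|/eqP/negbTE E].
  by case: ifP => _; rewrite ?nc_zeroE // nc_permE eqxx.
by rewrite if_same; case: ifP => _; rewrite ?nc_zeroE // nc_permE E.
Qed.
End Parabolic.

(** * Removing the prefix 1^m *)

Section Shift.
Variables (m n : nat).
Implicit Types (u v w : 'S_n).

Lemma pshift_l w i : pshift m w (lshift n i) = lshift n i.
Proof. by rewrite permE /pshift_fun (unsplitK (inl _ i)). Qed.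

Lemma pshift_r w j : pshift m w (rshift m j) = rshift m (w j).
Proof. by rewrite permE /pshift_fun (unsplitK (inr _ j)). Qed.

Lemma pshift_inj : injective (@pshift m n).
Proof.
move=> u v /permP uv; apply/permP => j; apply: (@rshift_inj m n).
by rewrite -!pshift_r uv.
Qed.

Lemma pshift1 : pshift m (1%g : 'S_n) = 1%g.
Proof.
by apply/permP => i; case: (split_ordP i) => a ->; rewrite ?pshift_l ?pshift_r !perm1.
Qed.

Lemma pshift_pcomp u v : pshift m (pcomp u v) = pcomp (pshift m u) (pshift m v).
Proof.
apply/permP => i; case: (split_ordP i) => a ->; rewrite pcompE ?pshift_l ?pshift_r //.
by rewrite pcompE.
Qed.

Lemma plength_pshift w : plength (pshift m w) = plength w.
Proof.
have rI : injective (fun p : 'I_n * 'I_n => (rshift m p.1, rshift m p.2)).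
  by case=> a b [c d] [/addnI/val_inj -> /addnI/val_inj ->].
rewrite -[RHS](card_imset _ rI); apply: eq_card => -[a b].
apply/idP/imsetP => [|[[c d]]]; rewrite !inE /=; last first.
  by case/andP=> cd wcd [-> ->]; rewrite !pshift_r /= !ltn_add2l cd.
case: (split_ordP a) => c ->; case: (split_ordP b) => d ->; rewrite ?pshift_l ?pshift_r /=.
- by case/andP; lia.
- by case/andP; have := ltn_ord c; lia.
- by case/andP; have := ltn_ord d; lia.
by rewrite !ltn_add2l => cd; exists (c, d) => //; rewrite inE.
Qed.

Lemma lenadd_pshift u v : lenadd (pshift m u) (pshift m v) = lenadd u v.
Proof. by rewrite /lenadd -pshift_pcomp !plength_pshift. Qed.

Lemma pshift_surj (x : 'S_(m + n)) :
  (forall i : 'I_m, x (lshift n i) = lshift n i) -> exists w, x = pshift m w.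
Proof.
move=> xl; pose f (j : 'I_n) := if fintype.split (x (rshift m j)) is inr k then k else j.
have fE j : x (rshift m j) = rshift m (f j).
  rewrite /f; case: (split_ordP (x (rshift m j))) => k // xj.
  by have := xl k; rewrite -xj => /perm_inj; rewrite xj => /eqP; rewrite eq_lrshift.
have f_inj : injective f.
  by move=> i j fij; apply: (@rshift_inj m n); apply: (@perm_inj _ x); rewrite !fE fij.
exists (perm f_inj); apply/permP => i; case: (split_ordP i) => a ->.
  by rewrite xl pshift_l.
by rewrite pshift_r permE fE.
Qed.

(** No inversion of 1^m x w involves the first m points, hence none of y does, so y and then x fix
    these points. This is what makes [nc_unshift] multiplicative. *)
Lemma lenadd_pshift_surj (x y : 'S_(m + n)) w :
  lenadd x y -> pcomp x y = pshift m w -> exists u v, x = pshift m u /\ y = pshift m v.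
Proof.
move=> xy xyw.
have yl (i : 'I_m) : y (lshift n i) = lshift n i.
  apply: perm_fix_mono => a; rewrite /= => ai; rewrite ltnNge; apply/negP => yai.
    have: (a, lshift n i) \in disorder y by rewrite inE /= ai ltnNge yai.
    move/(fintype.subsetP (lenadd_disorder xy)); rewrite xyw inE /= pshift_l ai.
    case: (split_ordP a) ai => b -> /=; first by rewrite pshift_l /= => ->.
    by have := ltn_ord i; lia.
  have: (lshift n i, a) \in disorder y by rewrite inE /= ai ltnNge yai.
  move/(fintype.subsetP (lenadd_disorder xy)); rewrite xyw inE /= pshift_l ai.
  case: (split_ordP a) ai => b -> /=; first by rewrite pshift_l /= => ->.
  by rewrite pshift_r /=; have := ltn_ord i; lia.
have xl (i : 'I_m) : x (lshift n i) = lshift n i.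
  by rewrite -{1}(yl i) -pcompE xyw pshift_l.
by have [u xu] := pshift_surj xl; have [v yv] := pshift_surj yl; exists u, v.
Qed.

Variable R : comNzRingType.
Implicit Types f g : nilcox R (m + n).

Definition nc_unshift f : nilcox R n := [ffun w => f (pshift m w)].

Lemma nc_unshiftE f w : nc_unshift f w = f (pshift m w). Proof. by rewrite ffunE. Qed.

Fact nc_unshift_zmod : zmod_morphism nc_unshift.
Proof. by move=> f g; apply/ffunP => w; rewrite nc_addE nc_oppE !nc_unshiftE nc_addE nc_oppE. Qed.

Fact nc_unshift_monoid : monoid_morphism nc_unshift.
Proof.
split.
  by apply/ffunP => w; rewrite nc_unshiftE !nc_oneE -pshift1 (inj_eq pshift_inj).
move=> f g; apply/ffunP => w; rewrite nc_unshiftE !nc_mulE.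
have out (x y : 'S_(m + n)) : lenadd x y && (pcomp x y == pshift m w) ->
    exists u v, x = pshift m u /\ y = pshift m v.
  by case/andP=> xy /eqP xyw; apply: (lenadd_pshift_surj xy xyw).
rewrite (sum_injection pshift_inj); last first.
  move=> x nx; rewrite big1 // => y _; case: ifP => // /out [u [v [xu _]]].
  by have := nx u; rewrite xu eqxx.
apply: eq_bigr => u _; rewrite (sum_injection pshift_inj); last first.
  move=> y ny; case: ifP => // /out [u' [v [_ yv]]].
  by have := ny v; rewrite yv eqxx.
apply: eq_bigr => v _.
by rewrite !nc_unshiftE lenadd_pshift -pshift_pcomp (inj_eq pshift_inj).
Qed.

HB.instance Definition _ := GRing.isZmodMorphism.Build _ _ nc_unshift nc_unshift_zmod.
HB.instance Definition _ := GRing.isMonoidMorphism.Build _ _ nc_unshift nc_unshift_monoid.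

Lemma nc_unshiftZ a f : nc_unshift (a *: f) = a *: nc_unshift f.
Proof. by apply/ffunP => w; rewrite nc_scaleE !nc_unshiftE nc_scaleE. Qed.

Lemma nc_unshift_anti f : nc_unshift (nc_anti f) = nc_anti (nc_unshift f).
Proof.
apply/ffunP => w; rewrite nc_unshiftE !ffunE plength_pshift; congr (_ * f _).
apply: (mulgI (pshift m w)); rewrite mulgV -[RHS]/(pcomp _ _) -pshift_pcomp.
by rewrite /pcomp mulgV pshift1.
Qed.

Lemma pshift_tperm (i j : 'I_n) : pshift m (tperm i j) = tperm (rshift m i) (rshift m j).
Proof.
apply/permP => x; case: (split_ordP x) => a ->.
  by rewrite pshift_l tpermD // eq_rlshift.
rewrite pshift_r; case: (tpermP i j a) => [->|->|/eqP ai /eqP aj]; rewrite ?tpermL ?tpermR //.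
by rewrite tpermD // (inj_eq (@rshift_inj _ _)) eq_sym.
Qed.

Lemma nc_unshift_gen k :
  nc_unshift (nc_gen R (m + n) k) = if (k < m)%N then 0 else nc_gen R n (k - m).
Proof.
have [kn|nk] := ltnP k.+1 (m + n); last first.
  by rewrite nc_gen_ge // rmorph0; case: ltnP => // mk; rewrite nc_gen_ge //; lia.
have [i j ik jk _] := adjacentP kn.
have ij : j = i.+1 :> nat by rewrite ik jk.
rewrite -{1}ik (nc_genE R ij); case: (leqP m k) => [mk|km]; last first.
  apply/ffunP => w; rewrite nc_unshiftE nc_permE nc_zeroE.
  case: eqP => // /permP wE; have := wE i; rewrite tpermL.
  case: (split_ordP i) (ik) => [a ia|b ->] /=; last by lia.
  by move=> _; rewrite ia pshift_l -ia => /(congr1 val) /=; rewrite ij; lia.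
case: (split_ordP i) (ik) (ij) => a -> /= aE; first by have := ltn_ord a; lia.
case: (split_ordP j) (jk) => b -> /= bE; first by have := ltn_ord b; lia.
move=> ab; have ba : b = a.+1 :> nat by lia.
rewrite -aE addKn (nc_genE R ba); apply/ffunP => w.
by rewrite nc_unshiftE !nc_permE -pshift_tperm (inj_eq pshift_inj).
Qed.
End Shift.

(** * The grading by length *)

Section Homogeneous.
Variables (R : comNzRingType) (n : nat).
Implicit Types (f g : nilcox R n) (u v w : 'S_n) (d : nat).

Definition nc_homog d f : Prop := forall w, plength w <> d -> f w = 0.

Lemma nc_homog0 d : nc_homog d 0. Proof. by move=> w _; rewrite nc_zeroE. Qed.

Lemma nc_homog1 : nc_homog 0 1.
Proof. by move=> w; rewrite nc_oneE; case: eqP => // ->; rewrite plength1. Qed.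

Lemma nc_homogD d f g : nc_homog d f -> nc_homog d g -> nc_homog d (f + g).
Proof. by move=> fd gd w wd; rewrite nc_addE fd // gd // addr0. Qed.

Lemma nc_homogB d f g : nc_homog d f -> nc_homog d g -> nc_homog d (f - g).
Proof. by move=> fd gd w wd; rewrite nc_addE nc_oppE fd // gd // subr0. Qed.

Lemma nc_homogM d e f g : nc_homog d f -> nc_homog e g -> nc_homog (d + e) (f * g).
Proof.
move=> fd ge w wde; rewrite nc_mulE big1 // => u _; rewrite big1 // => v _.
case: ifP => // /andP[/eqP uv /eqP uvw]; rewrite -uvw in wde.
have [ud|/eqP ud] := eqVneq (plength u) d; last by rewrite fd ?mul0r.
by rewrite ge ?mulr0 // => ve; apply: wde; rewrite -uv ud ve.
Qed.

Lemma nc_homog_gen k : nc_homog 1 (nc_gen R n k).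
Proof.
have [kn|nk] := ltnP k.+1 n; last by rewrite nc_gen_ge //; apply: nc_homog0.
have [i j ik jk _] := adjacentP kn; have ij : j = i.+1 :> nat by rewrite ik jk.
rewrite -ik (nc_genE R ij) => w; rewrite nc_permE; case: eqP => // ->.
by rewrite plength_tperm.
Qed.

Lemma nc_homog_elem k i : nc_homog i (ncelem (nc_gen R n) k i).
Proof.
elim: k i => [|k IH] [|i]; rewrite ?ncelem0 ?ncelem0S; [exact: nc_homog1|exact: nc_homog0|exact: nc_homog1|].
by rewrite ncelemS; apply: nc_homogD => //; rewrite -add1n; apply: nc_homogM => //; apply: nc_homog_gen.
Qed.

Lemma nc_homog_hook k r : nc_homog r (nchook (nc_gen R n) k r).
Proof.
elim: r => [|r IH]; first by rewrite nchook0; exact: nc_homog1.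
rewrite nchookS; apply: nc_homogB; first by rewrite -add1n; apply: nc_homogM => //; apply: nc_homog_elem.
by rewrite -addn1; apply: nc_homogM => //; apply: nc_homog_elem.
Qed.

Lemma plength_max w : (plength w < (n * n).+1)%N.
Proof. by rewrite ltnS (leq_trans (max_card _)) // card_prod card_ord. Qed.

Lemma hook_gen_vanish k r : ((n * n).+1 <= r)%N -> nchook (nc_gen R n) k r = 0.
Proof.
move=> nr; apply/ffunP => w; rewrite nc_zeroE nc_homog_hook // => wr.
by have := plength_max w; rewrite wr ltnNge nr.
Qed.
End Homogeneous.

Notation nc_hook R n := (nchook (nc_gen R n)).
Notation nc_lin R n := (nclin (nc_gen R n) (n * n).+1).
Notation nc_stan R n := (ncstan (nc_gen R n) (n * n).+1).

Section AbstractMorphism.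
Variables (R R' : comNzRingType) (B : algType R) (B' : algType R').
Variables (phi : R -> R') (f : {rmorphism B -> B'}).
Hypothesis fZ : forall a b, f (a *: b) = phi a *: f b.
Variables (u : nat -> B) (M : nat).

Lemma rmorph_nclin c k : f (nclin u M k c) = nclin (f \o u) M k (phi \o c).
Proof. by rewrite rmorph_sum; apply: eq_bigr => r _; rewrite fZ rmorph_nchook. Qed.

Lemma rmorph_ncstan c k : f (ncstan u M k c) = ncstan (f \o u) M k (phi \o c).
Proof.
elim: k => [|k IH]; first by rewrite !ncstan0 rmorph1.
by rewrite !ncstanS rmorphM IH rmorph_nclin.
Qed.
End AbstractMorphism.

Section ExtStan.
Variables (R : comNzRingType) (B : algType R) (M : nat).

Lemma eq_nclin (u u' : nat -> B) k c c' :
  (forall j, (j <= k)%N -> u j = u' j) -> (forall r, (r < M)%N -> c r = c' r) ->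
  nclin u M k c = nclin u' M k c'.
Proof.
move=> uu cc; apply: eq_bigr => r _; rewrite cc //; congr (_ *: _); exact: eq_nchook.
Qed.

Lemma eq_ncstan (u u' : nat -> B) k c c' :
  (forall j, (j < k)%N -> u j = u' j) -> (forall r, (r < M)%N -> c r = c' r) ->
  ncstan u M k c = ncstan u' M k c'.
Proof.
move=> + cc; elim: k => [|k IH] uu; first by rewrite !ncstan0.
by rewrite !ncstanS (@eq_nclin u u' k c c') // IH // => j jk; apply: uu; rewrite ltnW.
Qed.
End ExtStan.

(** * Elementary symmetric polynomials and general sequences *)

Section ElementarySymmetric.
Variable N : nat.

Lemma pesym_full r : pesym N N r = mesym N int r.
Proof.
apply: eq_bigl => h; rewrite (_ : [forall i in h, _] = true) ?andbT //.
by apply/forallP => i; rewrite ltn_ord implybT.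
Qed.

Lemma pesym_zero a : pesym N a 0 = 1.
Proof.
rewrite /pesym (big_pred1 finset.set0) ?big_set0 // => h.
rewrite cards_eq0; apply/andP/eqP => [[/eqP]//|->]; split=> //.
by apply/forallP => i; rewrite finset.in_set0.
Qed.

Lemma pesym0 r : pesym N 0 r = (r == 0%N)%:R.
Proof.
case: r => [|r]; first by rewrite pesym_zero.
rewrite /pesym big_pred0 // => h; apply/negP => /andP[/eqP hr /forallP h0].
have /card_gt0P [i ih] : (0 < #|h|)%N by rewrite hr.
by have := h0 i; rewrite ih ltn0.
Qed.

Lemma pesymS (a : 'I_N) : pesym N a.+1 = seq_mul_var (pesym N a) 'X_a.
Proof.
apply: funext => r; rewrite /seq_mul_var; case: r => [|r].
  by rewrite !pesym_zero addr0.
rewrite /pesym (bigID (fun h : {set 'I_N} => a \in h)) /= addrC; congr (_ + _).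
  apply: eq_bigl => h; rewrite -andbA; congr (_ && _).
  apply/andP/forallP => [[/forallP ha ah] i|ha].
    apply/implyP => ih; have := ha i; rewrite ih ltnS leq_eqVlt => /orP[/eqP/val_inj ia|//].
    by rewrite -ia ih in ah.
  split; last by apply/negP => ah; have := ha a; rewrite ah ltnn.
  by apply/forallP => i; apply/implyP => ih; have := ha i; rewrite ih => /ltnW.
rewrite mulr_sumr (reindex_onto (fun h => a |: h) (fun h => h :\ a)) /=; last first.
  by move=> h /andP[_ ah]; rewrite finset.setD1K.
apply: eq_big => h; last first.
  move=> /andP[_ /eqP ha]; rewrite big_setU1 //.
  by rewrite -ha finset.setD11.
rewrite setU11 andbT.
apply/andP/andP => [[/andP[/eqP hr /forallP hs] /eqP ha]|[/eqP hr /forallP hs]].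
  have ah : a \notin h by rewrite -ha finset.setD11.
  split; first by move: hr; rewrite cardsU1 ah add1n => -[->].
  apply/forallP => i; apply/implyP => ih; have := hs i.
  rewrite inE ih orbT /= ltnS leq_eqVlt => /orP[/eqP/val_inj ia|//].
  by rewrite -ia ih in ah.
have ah : a \notin h by apply/negP => ah; have := hs a; rewrite ah ltnn.
split; last by rewrite finset.setU1K.
rewrite cardsU1 ah hr add1n eqxx /=; apply/forallP => i; apply/implyP.
rewrite !inE => /orP[/eqP ->|ih]; first exact: ltnSn.
by have := hs i; rewrite ih => /ltnW.
Qed.
End ElementarySymmetric.

Section GoodSequences.
Variable n : nat.
Implicit Types R : comNzRingType.

Definition nc_good R (c : nat -> R) : Prop := forall k,
  let G := nc_stan R n k c in
  [/\ ncelem (nc_gen R n) k 1 * G = G * ncelem (nc_gen R n) k 1,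
      nc_anti G * G = 1 & G * nc_anti G = 1].

Lemma nc_anti_gen R k : nc_anti (nc_gen R n k) = - nc_gen R n k.
Proof.
have [kn|nk] := ltnP k.+1 n; last by rewrite nc_gen_ge // oppr0 linear0.
have [i j ik jk _] := adjacentP kn; have ij : j = i.+1 :> nat by rewrite ik jk.
rewrite -ik (nc_genE R ij); apply/ffunP => w; rewrite ffunE nc_oppE !nc_permE.
rewrite (can2_eq invgK invgK) tpermV; case: eqP => [->|_]; last by rewrite mulr0 oppr0.
by rewrite plength_tperm // mulr1.
Qed.

(** Variables are adjoined one at a time, starting from the trivial sequence, where E_k = 1. *)
Lemma nc_good_pesym N a : (a <= N)%N -> nc_good (pesym N a).
Proof.
elim: a => [|a IH] aN.
  have lin1 k : nc_lin {mpoly int[N]} n k (pesym N 0) = 1.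
    rewrite /nclin big_ord_recl pesym0 scale1r nchook0 big1 ?addr0 // => i _.
    by rewrite pesym0 scale0r.
  have stan1 k : nc_stan {mpoly int[N]} n k (pesym N 0) = 1.
    by elim: k => [|k IH]; rewrite ?ncstan0 // ncstanS lin1 IH mulr1.
  by move=> k; rewrite /= stan1 nc_anti1 !mulr1 mul1r.
have -> : pesym N a.+1 = seq_mul_var (pesym N a) 'X_(Ordinal aN) := pesymS (Ordinal aN).
apply: (@stanley_good_var _ _ _ _ _ _ (@nc_anti _ n)); last exact: IH (ltnW aN).
- exact: nil_coxeter_gen.
- exact: hook_gen_vanish.
- exact: nc_anti1.
- exact: nc_antiM.
- exact: nc_anti_gen.
Qed.

Lemma nc_map_stan R R' (phi : {rmorphism R -> R'}) k c :
  nc_map phi (nc_stan R n k c) = nc_stan R' n k (phi \o c).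
Proof.
rewrite (rmorph_ncstan (@nc_mapZ _ _ phi n)); apply: eq_ncstan => // j _.
exact: nc_map_gen.
Qed.

Lemma nc_map_elem R R' (phi : {rmorphism R -> R'}) k i :
  nc_map phi (ncelem (nc_gen R n) k i) = ncelem (nc_gen R' n) k i.
Proof. by rewrite rmorph_ncelem; apply: eq_ncelem => j _; rewrite /= nc_map_gen. Qed.

Lemma nc_map_hook R R' (phi : {rmorphism R -> R'}) k i :
  nc_map phi (nc_hook R n k i) = nc_hook R' n k i.
Proof. by rewrite rmorph_nchook; apply: eq_nchook => j _; rewrite /= nc_map_gen. Qed.

Lemma nc_map_lin R R' (phi : {rmorphism R -> R'}) k c :
  nc_map phi (nc_lin R n k c) = nc_lin R' n k (phi \o c).
Proof.
rewrite (rmorph_nclin (@nc_mapZ _ _ phi n)); apply: eq_nclin => // j _.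
exact: nc_map_gen.
Qed.

Lemma nc_good_map_inj R R' (phi : {rmorphism R -> R'}) c :
  injective phi -> nc_good (phi \o c) -> nc_good c.
Proof.
move=> phiI cg k; have [c1 c2 c3] := cg k; have mapI := @nc_map_inj _ _ phi n phiI.
by split; apply: mapI; rewrite !rmorphM /= ?nc_map_elem ?nc_map_anti nc_map_stan // rmorph1.
Qed.

Lemma nc_good_map R R' (phi : {rmorphism R -> R'}) c :
  nc_good c -> nc_good (phi \o c).
Proof.
move=> cg k; have [c1 c2 c3] := cg k.
rewrite /= -nc_map_stan -(nc_map_elem phi) -nc_map_anti.
by rewrite -!(rmorphM (@nc_map _ _ phi n)) c1 c2 c3 rmorph1.
Qed.

(* The identities hold at the elementary symmetric polynomials, which are     *)
(* algebraically independent.                                                 *)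
Lemma nc_goodP (R : comNzRingType) (c : nat -> R) : c 0%N = 1 -> nc_good c.
Proof.
move=> c0; pose M := (n * n).+1.
(* Only the entries with r < M enter [nc_stan], so finitely many indeterminates give a universal
   sequence. *)
pose cu r : {mpoly int[M]} :=
  if r is r'.+1 then (if insub r' is Some i then 'X_(i : 'I_M) else 0) else 1.
have cug : nc_good cu.
  pose phi : {mpoly int[M]} -> {mpoly int[M]} := comp_mpoly [tuple mesym M int i.+1 | i < M].
  apply: (@nc_good_map_inj _ _ phi); first exact: msym_fundamental_un.
  rewrite (_ : _ \o _ = pesym M M); first exact: nc_good_pesym.
  apply: funext => -[|r] /=; first by rewrite pesym_zero rmorph1.
  rewrite pesym_full; case: insubP => [i _ <-|].
    by rewrite /phi comp_mpolyXU -tnth_nth tnth_mktuple.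
  by rewrite -ltnNge ltnS => Mr; rewrite rmorph0 mesym_geqnE.
pose psi : {mpoly int[M]} -> R := mmap intr (fun i => c i.+1).
move=> k; have := nc_good_map psi cug k.
suff E : nc_stan R n k (psi \o cu) = nc_stan R n k c by rewrite E.
apply: eq_ncstan => // -[|r] rM; rewrite /= /psi; first by rewrite rmorph1 c0.
rewrite insubT; first exact: ltnW.
by move=> rM'; rewrite mmapX mmap1U.
Qed.
End GoodSequences.

(** * Schubert polynomials *)

Section YangBaxter.
Variables (R : comNzRingType) (B : algType R) (u : nat -> B).
Hypothesis uP : nil_coxeter u.
Implicit Types (a b x t : R) (y : nat -> R).

Definition ybfac k t : B := 1 + t *: u k.

(** On expansion, products of equal neighbours vanish, and the cubic terms agree by the braid
    relation, both having the coefficient a (a + b) b. *)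
Lemma yang_baxter k a b :
  ybfac k a * ybfac k.+1 (a + b) * ybfac k b
    = ybfac k.+1 b * ybfac k (a + b) * ybfac k.+1 a.
Proof.
have [uu _ uB] := uP.
have exp3 (X Y Z : B) : X * Z = 0 ->
    (1 + X) * (1 + Y) * (1 + Z) = 1 + (Y + (X + Z)) + (X * Y + Y * Z) + X * Y * Z.
  have E : (1 + X) * (1 + Y) = 1 + X + Y + X * Y.
    by rewrite mulrDl mul1r mulrDr mulr1 -!addrA; congr (_ + _); rewrite addrCA.
  move=> XZ; rewrite E mulrDr mulr1 !mulrDl mul1r XZ addr0 !addrA.
  congr (_ + _ + _); rewrite addrAC; congr (_ + _ + _).
  by rewrite addrAC.
rewrite !exp3; try by rewrite -scalerAl -scalerAr uu !scaler0.
rewrite -!scalerDl -!scalerAl -!scalerAr -!scalerAl !scalerA uB.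
rewrite [b + a]addrC [(a + b) *: u k.+1 + _]addrC.
rewrite [_ *: (u k * u k.+1) + _]addrC [a * (a + b)]mulrC [b * (a + b)]mulrC.
by rewrite [a * b]mulrC.
Qed.

Lemma ybfac_comm k n t x : (k.+1 < n)%N -> ybfac k t * ybfac n x = ybfac n x * ybfac k t.
Proof.
move=> kn; have [_ uC _] := uP.
rewrite /ybfac !mulrDl !mulrDr !mul1r !mulr1 -!scalerAl -!scalerAr !scalerA uC //.
by rewrite [t * x]mulrC -!addrA; congr (_ + _); rewrite addrCA.
Qed.

Fixpoint ybrow y (i l : nat) x : B :=
  if l is l'.+1 then ybfac (i + l') (x - y l') * ybrow y i l' x else 1.

Lemma ybrow_comm_hi y i l x n t : (i + l < n)%N ->
  ybrow y i l x * ybfac n t = ybfac n t * ybrow y i l x.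
Proof.
elim: l => [|l IH] iln /=; first by rewrite mul1r mulr1.
rewrite -mulrA IH; last by lia.
by rewrite !mulrA ybfac_comm //; lia.
Qed.

Lemma ybrow_comm_lo y i l x n t : (n.+1 < i)%N ->
  ybrow y i l x * ybfac n t = ybfac n t * ybrow y i l x.
Proof.
move=> ni; elim: l => [|l IH] /=; first by rewrite mul1r mulr1.
by rewrite -mulrA IH !mulrA [in RHS]ybfac_comm //; lia.
Qed.

(** The correcting factor moves through the two rows column by column; each use of the Yang-Baxter
    equation raises its index by one. *)
Lemma ybrow_swap y i l x x' :
  ybrow y i l x * ybrow y i.+1 l x' * ybfac i (x' - x)
    = ybfac (i + l) (x' - x) * (ybrow y i l x' * ybrow y i.+1 l x).
Proof.
elim: l => [|l IH] /=; first by rewrite addn0 !mulr1 !mul1r.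
set h := ybfac (i + l); set h' := ybfac (i.+1 + l); set h'' := ybfac (i + l.+1).
have hh : h' = h'' by rewrite /h' /h'' addSnnS.
have C z z' : ybrow y i l z * h' z' = h' z' * ybrow y i l z.
  by apply: ybrow_comm_hi; rewrite addSn.
have Y : h (x - y l) * h' (x' - y l) * h (x' - x) = h' (x' - x) * h (x' - y l) * h' (x - y l).
  have := yang_baxter (i + l) (x - y l) (x' - x); rewrite -addSn -/h -/h'.
  by rewrite [x - y l + _]addrC addrA subrK.
rewrite -!mulrA [ybrow y i l x * (h' _ * _)]mulrA C -!mulrA [ybrow y i l x * (_ * _)]mulrA IH.
rewrite -hh [ybrow y i l x' * (h' _ * _)]mulrA C !mulrA.
by congr (_ * _ * _).
Qed.

(** The Fomin-Kirillov product for double Schubert polynomials. All rows have length n: with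
    [nc_gen] the factors outside the staircase are 1. *)
Definition ybprod y n (x : nat -> R) : B := \prod_(0 <= i < n) ybrow y i n (x i).

(** The factor that [ybrow_swap] leaves on the left has index p + n, where u vanishes, and the rows
    from p + 2 on commute with [ybfac p]. Read on coefficients, this is the divided difference
    relation. *)
Lemma ybprod_swap y n p (x x' : nat -> R) : (p.+1 < n)%N -> u (p + n)%N = 0 ->
  x' p = x p.+1 -> x' p.+1 = x p -> (forall i, i != p -> i != p.+1 -> x' i = x i) ->
  ybprod y n x' = ybprod y n x * ybfac p (x p.+1 - x p).
Proof.
move=> pn up0 xp xp1 xE.
rewrite /ybprod !(@big_cat_nat _ _ _ p 0 n) //=; try lia.
rewrite !(@big_cat_nat _ _ _ p.+2 p n) //=; try lia.
have two (F : nat -> B) : \prod_(p <= i < p.+2) F i = F p * F p.+1.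
  by rewrite big_ltn // big_nat1.
rewrite !two.
rewrite -!mulrA; congr (_ * _).
  by apply: eq_big_nat => i /andP[_ ip]; rewrite xE //; lia.
have -> : \prod_(p.+2 <= i < n) ybrow y i n (x' i) = \prod_(p.+2 <= i < n) ybrow y i n (x i).
  by apply: eq_big_nat => i /andP[ip _]; rewrite xE //; lia.
have -> : (\prod_(p.+2 <= i < n) ybrow y i n (x i)) * ybfac p (x p.+1 - x p)
    = ybfac p (x p.+1 - x p) * \prod_(p.+2 <= i < n) ybrow y i n (x i).
  rewrite !big_seq; apply: (big_ind (fun z => z * ybfac p (x p.+1 - x p) = ybfac p (x p.+1 - x p) * z)).
  - by rewrite mul1r mulr1.
  - by move=> z z' zC z'C; rewrite -mulrA z'C !mulrA zC.
  - by move=> i; rewrite mem_index_iota => /andP[pi _]; apply: ybrow_comm_lo.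
have := ybrow_swap y p n (x p) (x p.+1).
rewrite {1}[ybfac (p + n) _]/ybfac up0 scaler0 addr0 mul1r xp xp1 !mulrA => ->.
by [].
Qed.
End YangBaxter.

(** * Top-degree components and the longest element *)

Section Top.
Variables (R : comNzRingType) (n : nat).
Implicit Types (f g : nilcox R n) (d e : nat).

Definition nc_le d f : Prop := forall w, (d < plength w)%N -> f w = 0.
Definition nc_top d f : nilcox R n := [ffun w => if plength w == d then f w else 0].

Lemma nc_topE d f w : nc_top d f w = if plength w == d then f w else 0.
Proof. by rewrite ffunE. Qed.

Lemma nc_homog_le d e f : nc_homog d f -> (d <= e)%N -> nc_le e f.
Proof. by move=> fd de w ew; apply: fd; lia. Qed.

Lemma nc_top_homog d f : nc_homog d f -> nc_top d f = f.
Proof. by move=> fd; apply/ffunP => w; rewrite nc_topE; case: eqP => // /fd ->. Qed.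

Lemma nc_leM d e f g : nc_le d f -> nc_le e g -> nc_le (d + e) (f * g).
Proof.
move=> fd ge w wde; rewrite nc_mulE big1 // => u _; rewrite big1 // => v _.
case: ifP => // /andP[/eqP uv /eqP uvw]; rewrite -uvw -uv in wde.
have [ud|ud] := leqP (plength u) d; last by rewrite fd ?mul0r.
by rewrite ge ?mulr0 //; lia.
Qed.

Lemma nc_topM d e f g : nc_le d f -> nc_le e g ->
  nc_top (d + e) (f * g) = nc_top d f * nc_top e g.
Proof.
move=> fd ge; apply/ffunP => w; rewrite nc_topE !nc_mulE; case: eqP => wde; last first.
  rewrite big1 // => u _; rewrite big1 // => v _.
  case: ifP => // /andP[/eqP uv /eqP uvw]; rewrite -uvw -uv in wde.
  rewrite !nc_topE; case: eqP => [ud|]; rewrite ?mul0r //.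
  by case: eqP => [ve|]; rewrite ?mulr0 //; case: wde; rewrite ud ve.
apply: eq_bigr => u _; apply: eq_bigr => v _; case: ifP => // /andP[/eqP uv /eqP uvw].
rewrite -uvw -uv in wde; rewrite !nc_topE.
case: (ltngtP (plength u) d) => [ud|ud|ud]; first by rewrite mul0r ge ?mulr0 //; lia.
  by rewrite mul0r fd ?mul0r.
by rewrite (_ : plength v == e) //; lia.
Qed.

Lemma nc_top_prod (I : Type) (r : seq I) (d : I -> nat) (F : I -> nilcox R n) :
  (forall i, nc_le (d i) (F i)) ->
  nc_le (\sum_(i <- r) d i) (\prod_(i <- r) F i) /\
  nc_top (\sum_(i <- r) d i) (\prod_(i <- r) F i) = \prod_(i <- r) nc_top (d i) (F i).
Proof.
move=> Fd; elim: r => [|i r [IH1 IH2]].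
  rewrite !big_nil; split; first by apply: (nc_homog_le (@nc_homog1 R n)).
  by rewrite nc_top_homog //; apply: nc_homog1.
by rewrite !big_cons; split; [apply: nc_leM|rewrite nc_topM // IH2].
Qed.

Lemma plength_eq0 (w : 'S_n) : plength w = 0%N -> w = 1%g.
Proof.
move=> w0; apply/eqP; apply: contrapT => /negP /exists_descent [i [j [ij ji]]].
by have := plength_descent ij ji; rewrite w0.
Qed.

Lemma nc_mul_coef1 f g : (f * g) 1%g = f 1%g * g 1%g.
Proof.
rewrite nc_mulE (bigD1 1%g) //= [X in _ + X]big1 ?addr0 => [|u u1].
  rewrite (bigD1 1%g) //= [X in _ + X]big1 ?addr0 => [|v v1].
    by rewrite lenadd1g pcomp1g eqxx.
  by rewrite pcomp1g (negbTE v1) andbF.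
rewrite big1 // => v _; case: ifP => // /andP[/eqP uv /eqP uv1].
by case/eqP: u1; apply: plength_eq0; move: uv; rewrite uv1 plength1; lia.
Qed.
End Top.

Section Staircase.
Variable n : nat.
Implicit Types (R : comNzRingType).

Definition in_stair (i j : nat) : bool := ((i + j).+1 < n)%N.

(** Outside the range [ybfac] is 1, hence so is its top component. *)
Definition stair_gen R k : nilcox R n := if (k.+1 < n)%N then nc_gen R n k else 1.

Fixpoint stair_row R (i l : nat) : nilcox R n :=
  if l is l'.+1 then stair_gen R (i + l') * stair_row R i l' else 1.

Definition stair_word R : nilcox R n := \prod_(0 <= i < n) stair_row R i n.

Lemma ybfac_top R k (t : R) :
  nc_le (k.+1 < n)%N (ybfac (nc_gen R n) k t) /\
  nc_top (k.+1 < n)%N (ybfac (nc_gen R n) k t)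
    = (if (k.+1 < n)%N then t else 1) *: stair_gen R k.
Proof.
rewrite /ybfac /stair_gen; case: ltnP => [kn|nk] /=; last first.
  rewrite nc_gen_ge // scaler0 addr0 scale1r; split; first exact: (nc_homog_le (@nc_homog1 R n)).
  by apply: nc_top_homog; apply: nc_homog1.
split=> [w w1|].
  rewrite nc_addE nc_scaleE nc_homog1 ?nc_homog_gen ?mulr0 ?addr0 //; lia.
apply/ffunP => w; rewrite nc_topE nc_addE; case: eqP => w1.
  by rewrite nc_homog1 ?add0r // w1.
by rewrite nc_scaleE nc_homog_gen ?mulr0.
Qed.

Lemma ybrow_top R y i l (x : R) :
  nc_le (\sum_(0 <= j < l) in_stair i j) (ybrow (nc_gen R n) y i l x) /\
  nc_top (\sum_(0 <= j < l) in_stair i j) (ybrow (nc_gen R n) y i l x)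
    = (\prod_(0 <= j < l | in_stair i j) (x - y j)) *: stair_row R i l.
Proof.
elim: l => [|l [IH1 IH2]] /=.
  rewrite !big_geq // scale1r; split; first exact: (nc_homog_le (@nc_homog1 R n)).
  by apply: nc_top_homog; apply: nc_homog1.
have [T1 T2] := ybfac_top (i + l) (x - y l).
rewrite big_nat_recr //= addnC; split; first exact: nc_leM.
rewrite nc_topM // IH2 T2 -scalerAl -scalerAr scalerA; congr (_ *: _).
by rewrite big_mkcond [in RHS]big_mkcond /= [RHS]big_nat_recr //= mulrC.
Qed.

Lemma plength_plongest :
  plength (plongest n) = (\sum_(0 <= i < n) \sum_(0 <= j < n) in_stair i j)%N.
Proof.
transitivity (\sum_(a < n) \sum_(b < n) (a < b)%N)%N.
  rewrite /plength -sum1_card big_mkcond pair_big /=; apply: eq_bigr => -[a b] _.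
  by rewrite inE !permE /=; have := ltn_ord a; have := ltn_ord b; case: ifP; lia.
rewrite big_mkord; apply: eq_bigr => a _; rewrite big_mkord (reindex_inj rev_ord_inj) /=.
apply: eq_bigr => b _; rewrite /in_stair.
by have := ltn_ord a; have := ltn_ord b; lia.
Qed.

Lemma ybprod_top R (x y : nat -> R) :
  (ybprod (nc_gen R n) y n x) (plongest n)
    = (\prod_(0 <= i < n) \prod_(0 <= j < n | in_stair i j) (x i - y j))
      * (stair_word R) (plongest n).
Proof.
have H i : nc_le (\sum_(0 <= j < n) in_stair i j) (ybrow (nc_gen R n) y i n (x i)).
  by have [] := ybrow_top y i n (x i).
have [_] := nc_top_prod (index_iota 0 n) H.
rewrite -plength_plongest => /ffunP /(_ (plongest n)); rewrite nc_topE eqxx => ->.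
under eq_bigr => i _ do rewrite (ybrow_top y i n (x i)).2.
by rewrite scaler_prod nc_scaleE.
Qed.

Lemma stair_word_basis R : stair_word R = 0 \/ exists v, stair_word R = nc_perm R v.
Proof.
pose P (f : nilcox R n) := f = 0 \/ exists v, f = nc_perm R v.
have P1 : P 1 by right; exists 1%g; rewrite nc_perm1.
have PM f g : P f -> P g -> P (f * g).
  move=> [->|[u ->]]; first by rewrite mul0r; left.
  move=> [->|[v ->]]; first by rewrite mulr0; left.
  by rewrite nc_perm_mul; case: ifP => _; [right; exists (pcomp u v)|left].
apply: (big_ind P) => // i _.
suff rowP l : P (stair_row R i l) by [].
elim: l => [|l IH] //=.
apply: PM => //; rewrite /stair_gen /nc_gen; case: ifP => // ->; right.
by exists (adj_perm n (i + l)).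
Qed.

Lemma nc_map_stair R R' (phi : {rmorphism R -> R'}) :
  nc_map phi (stair_word R) = stair_word R'.
Proof.
rewrite rmorph_prod; apply: eq_bigr => i _ /=.
suff rowE l : nc_map phi (stair_row R i l) = stair_row R' i l by [].
elim: l => [|l IH] /=; first by rewrite rmorph1.
by rewrite rmorphM /= IH /stair_gen; case: ifP => _; rewrite ?rmorph1 // nc_map_gen.
Qed.

Lemma nc_map_ybprod R R' (phi : {rmorphism R -> R'}) (x y : nat -> R) N :
  nc_map phi (ybprod (nc_gen R n) y N x) = ybprod (nc_gen R' n) (phi \o y) N (phi \o x).
Proof.
rewrite rmorph_prod; apply: eq_bigr => i _ /=.
suff rowE l : nc_map phi (ybrow (nc_gen R n) y i l (x i))
    = ybrow (nc_gen R' n) (phi \o y) i l ((phi \o x) i) by [].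
elim: l => [|l IH] /=; first by rewrite rmorph1.
by rewrite rmorphM /= IH rmorphD rmorph1 /= nc_mapZ nc_map_gen rmorphB.
Qed.

Lemma ybprod_coef1 R (x y : nat -> R) N : (ybprod (nc_gen R n) y N x) 1%g = 1.
Proof.
apply: (big_ind (fun f : nilcox R n => f 1%g = 1)) => [|f g f1 g1|i _].
- by rewrite nc_oneE eqxx.
- by rewrite nc_mul_coef1 f1 g1 mulr1.
suff row1 l : (ybrow (nc_gen R n) y i l (x i)) 1%g = 1 by [].
elim: l => [|l IH] /=; first by rewrite nc_oneE eqxx.
by rewrite nc_mul_coef1 IH nc_addE nc_oneE eqxx nc_scaleE nc_homog_gen ?mulr0 ?addr0 ?mulr1 // plength1.
Qed.

Lemma ybprod_ascent R (x x' y : nat -> R) (i j : 'I_n) (w : 'S_n) :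
  j = i.+1 :> nat -> (w i < w j)%N ->
  x' i = x j -> x' j = x i -> (forall k : nat, k != i -> k != j -> x' k = x k) ->
  (x i - x j) * (ybprod (nc_gen R n) y n x) w
    = (ybprod (nc_gen R n) y n x) (pcomp w (tperm i j))
      - (ybprod (nc_gen R n) y n x') (pcomp w (tperm i j)).
Proof.
move=> ij wij xi xj xE.
rewrite (@ybprod_swap _ _ _ (nil_coxeter_gen R n) y n i x x') -?ij //; last first.
  by rewrite nc_gen_ge //; lia.
rewrite mulrDr mulr1 nc_addE opprD addrA subrr add0r -scalerAr nc_scaleE (nc_mul_gen _ _ ij).
by rewrite !pcompE tpermL tpermR wij pcomp_tpermK // -mulNr opprB.
Qed.

End Staircase.

Section Variables_.
Variables (S : comNzRingType) (n : nat).

Definition mvar (k : nat) : {mpoly S[n]} := if insub k is Some i then 'X_(i : 'I_n) else 0.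

Lemma mvarE (i : 'I_n) : mvar i = 'X_i.
Proof. by rewrite /mvar valK. Qed.

Lemma mvar_ge k : (n <= k)%N -> mvar k = 0.
Proof. by move=> nk; rewrite /mvar insubF // ltnNge nk. Qed.

Lemma msym_mvar (i j : 'I_n) (k : nat) : msym (tperm i j) (mvar k) =
  if k == i :> nat then mvar j else if k == j :> nat then mvar i else mvar k.
Proof.
have [kn|nk] := ltnP k n; last first.
  rewrite mvar_ge // msym0; case: eqP => [E|_]; first by have := ltn_ord i; lia.
  by case: eqP => [E|_ //]; have := ltn_ord j; lia.
have -> : k = Ordinal kn by [].
rewrite !val_eqE !mvarE msymX.
have -> : [multinom U_(Ordinal kn)%MM ((tperm i j)^-1%g i0) | i0 < n] = U_(tperm i j (Ordinal kn))%MM.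
  by apply/mnmP => l; rewrite !mnmE tpermV (can2_eq (tpermK i j) (tpermK i j)).
by case: tpermP => [->|->|/eqP/negbTE -> /eqP/negbTE ->]; rewrite ?eqxx //; case: eqP => [->|].
Qed.
End Variables_.

(** * Generating functions of Schubert polynomials *)

Section SchubertFamilies.
Variable n : nat.

Definition sch_gen (R : comNzRingType) : nilcox {mpoly R[n]} n :=
  ybprod (nc_gen _ n) (fun=> 0) n (mvar R n).

Definition dsch_gen : nilcox {mpoly {mpoly int[n]}[n]} n :=
  ybprod (nc_gen _ n) (fun j => (mvar int n j)%:MP) n (mvar {mpoly int[n]} n).

Lemma ybprod_divdiff (R : comNzRingType) (y : nat -> {mpoly R[n]}) (i j : 'I_n) (w : 'S_n) :
  (forall s k, msym s (y k) = y k) -> j = i.+1 :> nat -> (w i < w j)%N ->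
  is_divdiff i j (ybprod (nc_gen {mpoly R[n]} n) y n (mvar R n) (pcomp w (tperm i j)))
    (ybprod (nc_gen {mpoly R[n]} n) y n (mvar R n) w).
Proof.
move=> ysym ij wij; rewrite /is_divdiff -!mvarE.
have ne := neq_adjacent ij.
have -> : msym (tperm i j) (ybprod (nc_gen {mpoly R[n]} n) y n (mvar R n) (pcomp w (tperm i j)))
    = ybprod (nc_gen {mpoly R[n]} n) y n (msym (tperm i j) \o mvar R n) (pcomp w (tperm i j)).
  rewrite -(nc_mapE (msym (tperm i j))) nc_map_ybprod; congr ((ybprod _ _ _ _ : nilcox _ n) _).
  by apply: funext => k /=; rewrite ysym.
apply: ybprod_ascent => // [||k ki kj] /=; rewrite msym_mvar ?eqxx //.
  by rewrite eq_sym val_eqE (negbTE ne).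
by rewrite (negbTE ki) (negbTE kj).
Qed.

Lemma descent_ind (P : 'S_n -> Prop) :
  P (plongest n) ->
  (forall (w : 'S_n) (i j : 'I_n), j = i.+1 :> nat -> (w i < w j)%N ->
     P (pcomp w (tperm i j)) -> P w) ->
  forall w, P w.
Proof.
move=> P0 PS w; have [m] := ubnP (n * n - plength w); elim: m w => // m IH w.
rewrite ltnS => wm; have [-> //|w0] := eqVneq w (plongest n).
have [i [j [ij wij]]] := exists_ascent w0; apply: (PS w i j) => //; apply: IH.
have := plength_ascent ij wij; have := plength_max (pcomp w (tperm i j)); lia.
Qed.

Lemma mpolyXB_neq0 (R : idomainType) (i j : 'I_n) : i != j -> 'X_i - 'X_j != 0 :> {mpoly R[n]}.
Proof.
move=> ij; rewrite subr_eq0; apply: contra ij => /eqP /(congr1 (mcoeff U_(i))) /eqP.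
rewrite !mcoeffX eqxx; have [E _|_] := eqVneq U_(j)%MM U_(i)%MM; last by rewrite oner_eq0.
have /mnmP /(_ i) := E.
by rewrite !mnmE eqxx eq_sym; case: eqP.
Qed.

(** If the coefficient at the longest element were 0, divided differences would make every
    coefficient 0, but that of the identity is 1. *)
Lemma sch_gen_descent (R : idomainType) (y : nat -> {mpoly R[n]}) :
  (forall s k, msym s (y k) = y k) ->
  (ybprod (nc_gen {mpoly R[n]} n) y n (mvar R n)) (plongest n) <> 0.
Proof.
set D := ybprod _ _ _ _ => ysym D0.
suff /(_ 1%g) : forall w, D w = 0 by rewrite ybprod_coef1 => /eqP; rewrite oner_eq0.
apply: descent_ind => // w i j ij wij Dws.
have := ybprod_divdiff ysym ij wij; rewrite -/D /is_divdiff Dws msym0 subr0 => /eqP.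
by rewrite mulf_eq0 (negbTE (mpolyXB_neq0 _ (neq_adjacent ij))) => /eqP.
Qed.

(** A product of generators is 0 or a basis element, so over the integers the coefficient is 0 or 1,
    and [sch_gen_descent] excludes 0. *)
Lemma stair_word_longest (R : comNzRingType) : stair_word n R (plongest n) = 1.
Proof.
rewrite -(nc_map_stair n (intr : {rmorphism int -> R})) nc_mapE.
suff -> : stair_word n int (plongest n) = 1 by rewrite rmorph1.
have W01 : stair_word n int (plongest n) = 0 \/ stair_word n int (plongest n) = 1.
  have [->|[v ->]] := stair_word_basis n int; first by left; rewrite nc_zeroE.
  by rewrite nc_permE; case: eqP; [right|left].
case: W01 => // W0; case: (@sch_gen_descent int (fun=> 0)) => [s k|]; first by rewrite msym0.
rewrite ybprod_top -(nc_map_stair n (@mpolyC n int : {rmorphism int -> {mpoly int[n]}})) nc_mapE.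
by rewrite W0 rmorph0 mulr0.
Qed.

Lemma ybprod_longest (R : comNzRingType) (x y : nat -> R) :
  (ybprod (nc_gen R n) y n x) (plongest n)
    = \prod_(0 <= i < n) \prod_(0 <= j < n | in_stair n i j) (x i - y j).
Proof. by rewrite ybprod_top stair_word_longest mulr1. Qed.

Lemma dsch_gen_double : is_double_schubert [ffun w => dsch_gen w].
Proof.
split=> [|w i j ij wij]; rewrite !ffunE.
  rewrite ybprod_longest big_mkord; apply: eq_bigr => i _; rewrite big_mkord.
  apply: eq_big => [j|j _]; last by rewrite !mvarE.
  by rewrite /in_stair addSn addnS.
apply: ybprod_divdiff => //; first by move=> s k; rewrite -[_%:MP]mulr1 mul_mpolyC msymZ msym1.
rewrite ltnNge leq_eqVlt; apply/negP => /orP[|/(plength_descent ij)]; last by lia.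
by rewrite val_eqE (inj_eq perm_inj) eq_sym (negbTE (neq_adjacent ij)).
Qed.

(** Starting from the longest element, divided differences determine the family, since x_i - x_j can
    be cancelled. *)
Lemma double_schubertE w : double_schubert w = dsch_gen w.
Proof.
have [D0 DS] := dsch_gen_double.
have [S0 SS] : is_double_schubert (xget 0 [set S | is_double_schubert S] :
    {ffun 'S_n -> {mpoly {mpoly int[n]}[n]}}).
  by apply: (xgetPex 0 (P := [set S | is_double_schubert S])); exists [ffun w => dsch_gen w];
    exact: dsch_gen_double.
rewrite /double_schubert; set S := xget _ _ in S0 SS *.
suff : S w = [ffun w => dsch_gen w] w by rewrite ffunE.
move: w; apply: descent_ind => [|w i j ij wij E]; first by rewrite S0 D0.
have len := plength_ascent ij wij.
have := SS w i j ij len; rewrite /is_divdiff E -(DS w i j ij len).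
by move/mulfI; apply; apply: mpolyXB_neq0 (neq_adjacent ij).
Qed.

Lemma schubertE w : schubert w = sch_gen int w.
Proof.
rewrite /schubert double_schubertE.
rewrite -(nc_mapE (map_mpoly (meval (fun=> 0)) : {rmorphism _ -> _})) nc_map_ybprod.
congr ((ybprod _ _ _ _ : nilcox _ _) _); apply: funext => k /=.
  by rewrite map_mpolyC /mvar /=; case: insub => [i|]; rewrite ?mevalXU ?meval0 ?mpolyC0.
by rewrite /mvar; case: (insub k : option 'I_n) => [i|]; rewrite ?rmorph0 // map_mpolyX.
Qed.
End SchubertFamilies.

(** * The generating function of universal Schubert polynomials *)

Section HookProduct.
Variables (R : comNzRingType) (n : nat).

(* Evaluates to the generating function of the universal Schubert             *)
(* polynomials; c k stands for (c_0(k), c_1(k), ..).                          *)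
Fixpoint usch_gen (c : nat -> nat -> R) (K : nat) : nilcox R n :=
  if K is k.+1 then nc_lin R n k (c K) * usch_gen c k else 1.

Lemma nclin_comm_gen k c q : (k.+1 < q)%N ->
  nc_lin R n k c * nc_gen R n q = nc_gen R n q * nc_lin R n k c.
Proof.
move=> kq; have [_ uC _] := nil_coxeter_gen R n.
have ecomm l i : (l < q)%N -> ncelem (nc_gen R n) l i * nc_gen R n q = nc_gen R n q * ncelem (nc_gen R n) l i.
  by move=> lq; apply: ncelem_comm_gen => j jl; apply: uC; lia.
have hcomm r : nc_hook R n k r * nc_gen R n q = nc_gen R n q * nc_hook R n k r.
  elim: r => [|r IH]; first by rewrite nchook0 mul1r mulr1.
  rewrite nchookS mulrBl mulrBr -mulrA IH mulrA ecomm // -!mulrA ecomm ?[in LHS]mulrA ?IH ?mulrA //; lia.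
rewrite mulr_suml mulr_sumr; apply: eq_bigr => r _.
by rewrite -scalerAl hcomm scalerAr.
Qed.

Lemma ncstan_comm_gen k c q : (k < q)%N ->
  nc_stan R n k c * nc_gen R n q = nc_gen R n q * nc_stan R n k c.
Proof.
elim: k => [|k IH] kq; first by rewrite ncstan0 mul1r mulr1.
by rewrite ncstanS -mulrA IH ?mulrA ?nclin_comm_gen //; lia.
Qed.

Lemma usch_gen_comm_gen k c q : (k < q)%N ->
  usch_gen c k * nc_gen R n q = nc_gen R n q * usch_gen c k.
Proof.
elim: k => [|k IH] kq /=; first by rewrite mul1r mulr1.
by rewrite -mulrA IH ?mulrA ?nclin_comm_gen //; lia.
Qed.

Definition nc_lin_up k (c : nat -> R) : nilcox R n :=
  \sum_(r < (n * n).+1) c r *: nc_hook R n k r.+1.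

Lemma nc_lin_var k (c : nat -> R) x :
  nc_lin R n k (seq_mul_var c x) = nc_lin R n k c + x *: nc_lin_up k c.
Proof.
have vanish := @hook_gen_vanish R n.
rewrite -(hook_sum_widen vanish k (seq_mul_var c x) (leqnSn _)).
rewrite -(hook_sum_widen vanish k c (leqnSn _)).
under eq_bigr => r _ do rewrite scalerDl.
rewrite big_split /=; congr (_ + _).
rewrite big_ord_recl /= scale0r add0r scaler_sumr.
by apply: eq_bigr => r _; rewrite scalerA.
Qed.

(** For k > 0 the first factor of [usch_gen c k] is L_(k-1)(e), and L_k(e) L_(k-1)(e) E_(k-1)(e) =
    E_(k+1)(e). So [ncstan_nchook] at r = 1 gives the identity with an extra E_(k-1)(e), which is
    invertible, commutes with u_k and cancels. *)
Lemma nc_lin_usch_gen k c e : c k = e -> e 0%N = 1 ->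
  nc_lin R n k e * usch_gen c k * nc_gen R n k = nc_lin_up k e * usch_gen c k.
Proof.
move=> ck e0; have uP := nil_coxeter_gen R n; have vanish := @hook_gen_vanish R n.
have good := nc_goodP n e0.
have cC l : ncelem (nc_gen R n) l 1 * nc_stan R n l e = nc_stan R n l e * ncelem (nc_gen R n) l 1.
  by have [] := good l.
have K1 : nc_lin R n k e * nc_stan R n k e * nc_gen R n k = nc_lin_up k e * nc_stan R n k e.
  by have := ncstan_nchook (M := (n * n).+1) cC k 1; rewrite nchook1 ncstanS => ->.
case: k ck K1 => [|k] ck K1; first by rewrite /= ?mulr1 in K1 *; rewrite ncstan0 !mulr1 in K1.
have [_ _ Ginv] := good k.
rewrite ncstanS in K1.
have K2 : nc_lin R n k.+1 e * nc_lin R n k e * nc_gen R n k.+1 = nc_lin_up k.+1 e * nc_lin R n k e.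
  rewrite -[LHS]mulr1 -[RHS]mulr1 -Ginv !mulrA; congr (_ * _).
  by rewrite -!mulrA -ncstan_comm_gen // !mulrA; move: K1; rewrite !mulrA.
rewrite /= ck -!mulrA usch_gen_comm_gen // ![_ * (_ * usch_gen c k)]mulrA.
by rewrite !mulrA K2.
Qed.

Lemma nc_lin_up_gen k c e : c k = e -> e 0%N = 1 ->
  nc_lin_up k e * usch_gen c k * nc_gen R n k = 0.
Proof.
move=> ck e0; rewrite -(nc_lin_usch_gen ck e0) -[X in X = _]mulrA.
by have [-> _ _] := nil_coxeter_gen R n; rewrite mulr0.
Qed.

(** L_k(e (1 + x t)) is affine in x, and [nc_lin_up_gen] kills the term on the right in which x
    occurs a second time. This is the divided difference relation for exchanging x and x'. *)
Lemma nc_lin_var_sub k c e x x' : c k = e -> e 0%N = 1 ->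
  nc_lin R n k (seq_mul_var e x) * usch_gen c k - nc_lin R n k (seq_mul_var e x') * usch_gen c k
    = (x - x') *: (nc_lin R n k (seq_mul_var e x) * usch_gen c k * nc_gen R n k).
Proof.
move=> ck e0; rewrite !nc_lin_var mulrDl [(_ + x' *: _) * _]mulrDl opprD addrACA subrr add0r.
rewrite -!scalerAl -scalerBl; congr (_ *: _).
by rewrite mulrDl -!scalerAl nc_lin_up_gen // scaler0 addr0 nc_lin_usch_gen.
Qed.

Lemma usch_gen_coef1 c K : (forall k, c k 0%N = 1) -> usch_gen c K 1%g = 1.
Proof.
move=> c0; elim: K => [|k IH] /=; first by rewrite nc_oneE eqxx.
rewrite nc_mul_coef1 IH mulr1 /nclin big_ord_recl nchook0 nc_addE nc_scaleE nc_oneE eqxx c0 mul1r.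
rewrite nc_sumE big1 ?addr0 // => r _.
by rewrite nc_scaleE nc_homog_hook ?mulr0 // plength1.
Qed.
Fixpoint top_hooks (K : nat) : nilcox R n :=
  if K is k.+1 then nc_hook R n k K * top_hooks k else 1.

Lemma usch_gen_top c m K : (forall k r, (k < r)%N -> (k <= m)%N -> c k r = 0) -> (K <= m)%N ->
  nc_le (\sum_(0 <= k < K) k.+1) (usch_gen c K) /\
  nc_top (\sum_(0 <= k < K) k.+1) (usch_gen c K)
    = (\prod_(0 <= k < K) c k.+1 k.+1) *: top_hooks K.
Proof.
move=> c0; elim: K => [|K IH] Km /=.
  rewrite !big_geq // scale1r; split; first exact: (nc_homog_le (@nc_homog1 _ _)).
  by apply: nc_top_homog; apply: nc_homog1.
have H1 : nc_le K.+1 (nc_lin R n K (c K.+1)).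
  move=> w kw; rewrite nc_sumE big1 // => r _; rewrite nc_scaleE.
  have [rk|kr] := leqP r K.+1; last by rewrite c0 ?mul0r.
  by rewrite nc_homog_hook ?mulr0 //; lia.
have H2 : nc_top K.+1 (nc_lin R n K (c K.+1)) = c K.+1 K.+1 *: nc_hook R n K K.+1.
  apply/ffunP => w; rewrite nc_topE nc_scaleE.
  case: eqP => wk; last by rewrite nc_homog_hook ?mulr0.
  have kb : (K.+1 < (n * n).+1)%N by rewrite -wk plength_max.
  rewrite nc_sumE (bigD1 (Ordinal kb)) //= nc_scaleE big1 ?addr0 // => r rk.
  rewrite nc_scaleE nc_homog_hook ?mulr0 // wk => E; case/eqP: rk; exact/val_inj.
have [I1 I2] := IH (ltnW Km).
rewrite big_nat_recr //= addnC; split; first exact: nc_leM.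
by rewrite nc_topM // H2 I2 -scalerAl -scalerAr scalerA big_nat_recr //= mulrC.
Qed.

End HookProduct.

Lemma nc_map_top_hooks (R R' : comNzRingType) (phi : {rmorphism R -> R'}) n K :
  nc_map phi (top_hooks R n K) = top_hooks R' n K.
Proof. by elim: K => [|k IH] /=; rewrite ?rmorph1 // rmorphM /= IH nc_map_hook. Qed.

(** Identifies the staircase monomial x_1^n x_2^(n-1) .. x_n with the product of the monomials x_1
    .. x_k for k <= n. *)
Lemma stair_exchange (R : Type) (idx : R) (op : Monoid.com_law idx) n (F : nat -> R) :
  \big[op/idx]_(0 <= i < n.+1) \big[op/idx]_(0 <= j < n.+1 | in_stair n.+1 i j) F i
    = \big[op/idx]_(0 <= k < n) \big[op/idx]_(0 <= i < k.+1) F i.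
Proof.
have shrink i : \big[op/idx]_(0 <= j < n.+1 | in_stair n.+1 i j) F i
    = \big[op/idx]_(0 <= j < n | (i <= j)%N) F i.
  rewrite big_mkcond big_nat_recr //= {2}/in_stair ltnNge -addnS leq_addl /= Monoid.mulm1.
  rewrite [RHS]big_mkcond !big_mkord (reindex_inj rev_ord_inj) /=.
  apply: eq_bigr => j _; rewrite /in_stair.
  by congr (if _ then _ else _); have := ltn_ord j; lia.
under eq_bigr => i _ do rewrite shrink.
rewrite big_nat_recr //= [X in op _ X]big_nat_cond [X in op _ X]big_pred0 ?Monoid.mulm1 => [|j]; last by lia.
rewrite !big_mkord; under eq_bigr => i _ do rewrite big_mkord.
rewrite (exchange_big_dep xpredT) //=; apply: eq_bigr => k _.
rewrite -(big_mkord (fun i => (i <= k)%N)) [RHS](big_nat_widen _ _ n) //=.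
Qed.

Lemma plength_plongest_sum n : plength (plongest n.+1) = (\sum_(0 <= k < n) k.+1)%N.
Proof.
rewrite plength_plongest.
transitivity (\sum_(0 <= i < n.+1) \sum_(0 <= j < n.+1 | in_stair n.+1 i j) 1)%N.
  by apply: eq_bigr => i _; rewrite [RHS]big_mkcond; apply: eq_bigr => j _; case: in_stair.
rewrite (stair_exchange _ _ (fun=> 1%N)); apply: eq_bigr => k _.
by rewrite sum_nat_const_nat subn0 muln1.
Qed.

Lemma nc_map_usch_gen (R R' : comNzRingType) (phi : {rmorphism R -> R'}) n c K :
  nc_map phi (usch_gen n c K) = usch_gen n (fun k => phi \o c k) K.
Proof. by elim: K => [|k IH] /=; rewrite ?rmorph1 // rmorphM /= IH nc_map_lin. Qed.

Lemma pesym_gt N a r : (a < r)%N -> (a <= N)%N -> pesym N a r = 0.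
Proof.
elim: a r => [|a IH] [|r] // ar aN; first by rewrite pesym0.
have := congr1 (@^~ r.+1) (pesymS (Ordinal aN)); rewrite /= => ->.
by rewrite /seq_mul_var /= !IH ?mulr0 ?addr0 //; lia.
Qed.

Lemma pesym_top N a : (a <= N)%N -> pesym N a a = \prod_(0 <= i < a) mvar int N i.
Proof.
elim: a => [|a IH] aN; first by rewrite pesym_zero big_geq.
have := congr1 (@^~ a.+1) (pesymS (Ordinal aN)); rewrite /= => ->.
rewrite /seq_mul_var /= pesym_gt // 1?ltnW // add0r IH 1?ltnW // big_nat_recr //= mulrC.
by congr (_ * _); rewrite -mvarE.
Qed.

(** In the excluded case a = j, the variable x_i is among the first a variables and x_j is not. *)
Lemma msym_pesym N (i j : 'I_N) a : j = i.+1 :> nat -> a != j :> nat -> (a <= N)%N ->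
  forall r, msym (tperm i j) (pesym N a r) = pesym N a r.
Proof.
move=> ij.
have step b x x' : (b < N)%N -> mvar int N b = x -> msym (tperm i j) x = x' ->
    forall r, msym (tperm i j) (pesym N b.+1 r) =
      seq_mul_var (fun r => msym (tperm i j) (pesym N b r)) x' r.
  move=> bN bx xx r; have := congr1 (@^~ r) (pesymS (Ordinal bN)); rewrite /= => ->.
  rewrite -mvarE /= bx /seq_mul_var msymD; congr (_ + _).
  by case: r => [|r]; rewrite ?msym0 // msymM xx.
have rec b : (b < N)%N -> pesym N b.+1 = seq_mul_var (pesym N b) (mvar int N b).
  by move=> bN; have -> := pesymS (Ordinal bN); rewrite -mvarE.
elim/ltn_ind: a => -[|a] IH aj aN r; first by rewrite pesym0 rmorph_nat.
have [a_ij|a_ij] := eqVneq a j; last first.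
  have ai : a != i :> nat by apply: contra aj => /eqP ->; rewrite ij.
  rewrite (step a (mvar int N a) (mvar int N a)) // ?rec //; last first.
    by rewrite msym_mvar (negbTE ai) (negbTE a_ij).
  by congr (seq_mul_var _ _ r); apply: funext => r'; apply: IH => //; lia.
have ne : (j == i :> nat) = false by apply/negP => /eqP; rewrite ij; lia.
have mj : msym (tperm i j) (mvar int N j) = mvar int N i by rewrite msym_mvar ne eqxx.
have mi : msym (tperm i j) (mvar int N i) = mvar int N j by rewrite msym_mvar eqxx.
have iN : (i < N)%N by [].
have jN : (j < N)%N by [].
have aE : a = i.+1 by rewrite a_ij ij.
rewrite aE -ij (step j _ _ jN erefl mj) (rec j jN).
have E0 : (fun q => msym (tperm i j) (pesym N i q)) = pesym N i.
  by apply: funext => q; apply: IH; lia.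
have E1 : (fun q => msym (tperm i j) (pesym N j q)) = seq_mul_var (pesym N i) (mvar int N j).
  by apply: funext => q; have := step i _ _ iN erefl mi q; rewrite -ij E0.
rewrite E1.
rewrite ij (rec i iN) /seq_mul_var; case: r => [|[|r]]; rewrite ?addr0 ?add0r //.
  by rewrite addrAC.
by move: (mvar int N i) (mvar int N i.+1) => *; ring.
Qed.

(** Only the factor L_i sees x_i without x_j, so the exchange changes this factor alone;
    [nc_lin_var_sub] treats it together with the factors below, and those above are carried along on
    the left. *)
Lemma usch_gen_msym n (i j : 'I_n) K : j = i.+1 :> nat -> (j <= K)%N -> (K < n)%N ->
  usch_gen n (pesym n) K - nc_map (msym (tperm i j)) (usch_gen n (pesym n) K)
    = ('X_i - 'X_j) *: (usch_gen n (pesym n) K * nc_gen _ n i).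
Proof.
move=> ij; have fixed (k : nat) : k != i :> nat -> (k < n)%N -> msym (tperm i j) \o pesym n k.+1 = pesym n k.+1.
  by move=> ki kn; apply: funext => r; apply: msym_pesym => //; lia.
elim: K => [|K IH] jK Kn; first by rewrite ij in jK.
have [K_i|K_i] := eqVneq (i : nat) K; last first.
  rewrite /= rmorphM /= nc_map_lin fixed; [|lia|lia].
  by rewrite -mulrBr IH; [rewrite -scalerAr mulrA|lia|lia].
rewrite /= rmorphM /= nc_map_lin.
have low k : (k <= i)%N -> nc_map (msym (tperm i j)) (usch_gen n (pesym n) k) = usch_gen n (pesym n) k.
  elim: k => [|k IHk] ki /=; first by rewrite rmorph1.
  by rewrite rmorphM /= IHk; [rewrite nc_map_lin fixed; [|lia|have := ltn_ord i; lia]|lia].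
rewrite -K_i low; last exact: leqnn.
set V := usch_gen n (pesym n) i.
set e := pesym n i.
have -> : pesym n i.+1 = seq_mul_var e 'X_i := pesymS i.
have -> : msym (tperm i j) \o seq_mul_var e 'X_i = seq_mul_var e 'X_j.
  apply: funext => r; rewrite /= /seq_mul_var msymD msym_pesym; [|exact: ij|lia|lia].
  case: r => [|r]; rewrite ?msym0 // msymM msym_pesym; [|exact: ij|lia|lia].
  by rewrite -!mvarE msym_mvar eqxx.
have e0 : e 0%N = 1 by rewrite /e pesym_zero.
exact: nc_lin_var_sub.
Qed.

(* Both sides satisfy the same divided difference relations; the top          *)
(* coefficients are proportional by degree, and the factor is determined by   *)
(* the coefficient of the identity.                                           *)
Lemma usch_gen_sch_gen n : usch_gen n.+1 (pesym n.+1) n = sch_gen n.+1 int.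
Proof.
set N := n.+1; set U := usch_gen _ _ _; set D := sch_gen _ _.
pose z := top_hooks int N n (plongest N).
pose kappa : {mpoly int[N]} := z%:MP.
have ksym s : msym s kappa = kappa by rewrite /kappa -[_%:MP]mulr1 mul_mpolyC msymZ msym1.
have U0 : U (plongest N) = kappa * D (plongest N).
  have van k r : (k < r)%N -> (k <= n)%N -> pesym N k r = 0.
    by move=> kr kn; apply: pesym_gt => //; apply: ltnW.
  have [_ /ffunP /(_ (plongest N))] := usch_gen_top N van (leqnn n).
  rewrite nc_topE plength_plongest_sum eqxx => ->.
  rewrite nc_scaleE -(nc_map_top_hooks (@mpolyC N int : {rmorphism int -> {mpoly int[N]}})) nc_mapE.
  rewrite mulrC; congr (_ * _).
  rewrite ybprod_longest; under [RHS]eq_bigr => i _ do under eq_bigr => j _ do rewrite subr0.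
  by rewrite stair_exchange; apply: eq_big_nat => k kn; rewrite pesym_top //; lia.
have UD w : U w = kappa * D w.
  move: w; apply: descent_ind => // w i j ij wij E.
  have := ybprod_divdiff (R := int) (y := fun=> 0) (fun s k => msym0 _ s) ij wij.
  rewrite -/D /is_divdiff => DE.
  have := @usch_gen_msym N i j n ij _ (ltnSn n); rewrite -ltnS ltn_ord => /(_ isT).
  move=> /ffunP /(_ (pcomp w (tperm i j))).
  rewrite nc_addE nc_oppE nc_mapE nc_scaleE (nc_mul_gen _ _ ij) -/U.
  rewrite !pcompE tpermL tpermR wij pcomp_tpermK E.
  rewrite rmorphM /= ksym -mulrBr -DE mulrCA.
  by move/mulfI => <- //; apply: mpolyXB_neq0 (neq_adjacent ij).
apply/ffunP => w; rewrite UD.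
have := UD 1%g; rewrite usch_gen_coef1 => [|k]; last by rewrite pesym_zero.
by rewrite ybprod_coef1 mulr1 => <-; rewrite mul1r.
Qed.

(** * Linear independence of Schubert polynomials *)

Section SchubertIndependence.
Variables (R : idomainType) (n : nat).

Lemma sch_gen_sub (i j : 'I_n) : j = i.+1 :> nat ->
  sch_gen n R - nc_map (msym (tperm i j)) (sch_gen n R)
    = ('X_i - 'X_j) *: (sch_gen n R * nc_gen {mpoly R[n]} n i).
Proof.
move=> ij; have ne := neq_adjacent ij.
rewrite [X in _ - X](_ : _ = ybprod (nc_gen {mpoly R[n]} n) (fun=> 0) n (msym (tperm i j) \o mvar R n)).
  rewrite (@ybprod_swap _ _ _ (nil_coxeter_gen _ n) (fun=> 0) n i (mvar R n)) -?ij //.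
  - by rewrite /ybfac mulrDr mulr1 opprD addrA subrr add0r -scalerAr -scaleNr opprB !mvarE.
  - by rewrite nc_gen_ge //; lia.
  - by rewrite /= msym_mvar eqxx.
  - by rewrite /= msym_mvar eq_sym val_eqE (negbTE ne) eqxx.
  by move=> k ki kj; rewrite /= msym_mvar (negbTE ki) (negbTE kj).
rewrite nc_map_ybprod; congr ((ybprod _ _ _ _ : nilcox _ n)).
by apply: funext => k /=; rewrite msym0.
Qed.

(** Induction on a strict bound for the lengths in the relation. A divided difference at a descent
    of v lowers this bound, which gives t v = 0 for v != 1; the remaining term is a constant. *)
Lemma schubert_free (t : 'S_n -> R) :
  \sum_w t w *: sch_gen n R w = 0 -> forall w, t w = 0.
Proof.
suff H d : forall t : 'S_n -> R, (forall w, (d <= plength w)%N -> t w = 0) ->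
    \sum_w t w *: sch_gen n R w = 0 -> forall w, t w = 0.
  by apply: (H (n * n).+1) => w; rewrite leqNgt plength_max.
elim: d => [|d IH] {}t td tD w; first exact: td.
have tdesc v : v != 1%g -> t v = 0.
  move=> /exists_descent [i [j [ij vji]]].
  pose t' (x : 'S_n) := if (x i < x j)%N then t (pcomp x (tperm i j)) else 0.
  suff /(_ (pcomp v (tperm i j))) : forall x, t' x = 0.
    by rewrite /t' !pcompE tpermL tpermR vji pcomp_tpermK.
  apply: IH => [x dx|].
    rewrite /t'; case: ifP => // /(plength_ascent ij) xl; apply: td.
    by rewrite xl ltnS.
  have sum0 : \sum_w t w *: (sch_gen n R * nc_gen {mpoly R[n]} n i) w = 0.
    apply: (mulfI (mpolyXB_neq0 R (neq_adjacent ij))); rewrite mulr0 mulr_sumr.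
    transitivity (\sum_w t w *: (sch_gen n R w - msym (tperm i j) (sch_gen n R w))).
      apply: eq_bigr => x _; rewrite -scalerAr; congr (_ *: _).
      have /ffunP /(_ x) := sch_gen_sub ij.
      by rewrite nc_addE nc_oppE nc_mapE nc_scaleE => <-.
    under eq_bigr => x _ do rewrite scalerBr -msymZ.
    by rewrite sumrB tD -raddf_sum tD /= msym0 subrr.
  rewrite (reindex_inj (h := fun x : 'S_n => pcomp x (tperm i j))) in sum0; last first.
    by apply: (can_inj (g := fun x => pcomp x (tperm i j))) => x; rewrite pcomp_tpermK.
  rewrite -[RHS]sum0; apply: eq_bigr => x _.
  rewrite (nc_mul_gen _ _ ij) !pcompE tpermL tpermR pcomp_tpermK /t'.
  by case: ifP; rewrite ?scaler0 ?scale0r.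
have [-> //|/tdesc //] := eqVneq w 1%g.
move: tD; rewrite (bigD1 1%g) //= big1 ?addr0 => [|v /tdesc ->]; last by rewrite scale0r.
by move/(congr1 (mcoeff 0)); rewrite mcoeffZ ybprod_coef1 mcoeff1 eqxx mulr1 mcoeff0.
Qed.
End SchubertIndependence.

(** * Coefficients of the universal Schubert polynomials *)

Section UniversalSchubert.
Variable N : nat.
Notation index := {ffun 'I_N.-1 -> 'I_N}.
Implicit Types (R : comNzRingType) (I : index).

Definition hook_word R I : nilcox R N :=
  \prod_(a < N.-1) nc_hook R N (rev_ord a) (I (rev_ord a)).

Lemma nc_map_hook_word R R' (phi : {rmorphism R -> R'}) I :
  nc_map phi (hook_word R I) = hook_word R' I.
Proof. by rewrite rmorph_prod; apply: eq_bigr => a _; rewrite /= nc_map_hook. Qed.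

Lemma hook_word_homog R I : nc_homog (\sum_a I a) (hook_word R I).
Proof.
rewrite (reindex_inj rev_ord_inj) /=.
apply: (big_ind2 (fun d (f : nilcox R N) => nc_homog d f)) => [|d f e g|a _].
- exact: nc_homog1.
- exact: nc_homogM.
exact: nc_homog_hook.
Qed.

Lemma nc_lin_small R k (c : nat -> R) : (k.+1 < N)%N -> (forall r, (k.+1 < r)%N -> c r = 0) ->
  nc_lin R N k c = \sum_(r < N) c r *: nc_hook R N k r.
Proof.
move=> kN c0; have NN : (N <= (N * N).+1)%N.
  by case: N kN => // N' _; rewrite ltnW // ltnS leq_pmulr.
rewrite /nclin -[in LHS](subnKC NN) big_split_ord /= [X in _ + X]big1 ?addr0 // => r _.
by rewrite c0 ?scale0r //; lia.
Qed.

Lemma usch_gen_prod R (c : nat -> nat -> R) K :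
  usch_gen N c K = \prod_(a < K) nc_lin R N (rev_ord a) (c (rev_ord a).+1).
Proof.
elim: K => [|K IH] /=; first by rewrite big_ord0.
rewrite big_ord_recl /= subn1 /=; congr (_ * _); rewrite IH.
by apply: eq_bigr => a _ /=; rewrite /bump leq0n add1n subSS.
Qed.

Lemma usch_gen_expand R (c : nat -> nat -> R) :
  (forall k r, (k < N)%N -> (k < r)%N -> c k r = 0) ->
  usch_gen N c N.-1 = \sum_(I : index) (\prod_(a < N.-1) c a.+1 (I a)) *: hook_word R I.
Proof.
move=> c0; rewrite usch_gen_prod.
transitivity (\prod_(a < N.-1) \sum_(r < N) c (rev_ord a).+1 r *: nc_hook R N (rev_ord a) r).
  apply: eq_bigr => a _; apply: nc_lin_small; first by have := ltn_ord (rev_ord a); lia.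
  by move=> r ar; apply: c0 => //; have := ltn_ord (rev_ord a); lia.
rewrite bigA_distr_bigA /=.
have revK : involutive (fun I : index => [ffun a => I (rev_ord a)]).
  by move=> I; apply/ffunP => a; rewrite !ffunE rev_ordK.
rewrite [RHS](reindex_inj (inv_inj revK)); apply: eq_bigr => I _.
rewrite scaler_prod; congr (_ *: _).
  rewrite [RHS](reindex_inj rev_ord_inj); apply: eq_bigr => a _.
  by rewrite ffunE rev_ordK.
by apply: eq_bigr => a _; rewrite ffunE rev_ordK.
Qed.

Definition hook_coef (w : 'S_N) : {ffun index -> int} :=
  [ffun I => if usch_index (plength w) I then hook_word int I w else 0].

Lemma usch_gen_coef R (c : nat -> nat -> R) w :
  (forall k r, (k < N)%N -> (k < r)%N -> c k r = 0) ->
  usch_gen N c N.-1 w =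
    \sum_(I | usch_index (plength w) I) (hook_coef w I)%:~R * \prod_(a < N.-1) c a.+1 (I a).
Proof.
move=> c0; rewrite usch_gen_expand // nc_sumE [RHS]big_mkcond; apply: eq_bigr => I _.
rewrite nc_scaleE -(nc_map_hook_word (intr : {rmorphism int -> R})) nc_mapE ffunE.
case: ifP => [->|/negbT]; first by rewrite mulrC.
rewrite /usch_index negb_and => /orP[/forallPn[a]|/eqP Iw].
  rewrite -ltnNge => aI; rewrite (bigD1 a) //= c0 ?mul0r ?mulr0 //.
  by have := ltn_ord a; lia.
by rewrite hook_word_homog ?rmorph0 ?mulr0 ?mul0r // => wI; apply: Iw; rewrite wI.
Qed.
End UniversalSchubert.

Section Uniqueness.
Variable n : nat.
Notation N := n.+1.
Notation index := {ffun 'I_N.-1 -> 'I_N}.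

Lemma schubert_usch_gen (w : 'S_N) : schubert w = usch_gen N (pesym N) N.-1 w.
Proof. by rewrite schubertE -usch_gen_sch_gen. Qed.

Lemma pesym_vanish k r : (k < N)%N -> (k < r)%N -> pesym N k r = 0.
Proof. by move=> kN kr; apply: pesym_gt => //; apply: ltnW. Qed.

Lemma hook_coef_usch (w : 'S_N) : is_usch_coef w (hook_coef w).
Proof.
split=> [I|]; first by rewrite ffunE => /negbTE ->.
rewrite schubert_usch_gen usch_gen_coef; last exact: pesym_vanish.
by apply: eq_bigr => I _; rewrite mulrzl -[X in X *: _]intz scaler_int.
Qed.

Definition good_index : {set index} := [set I : index | [forall a, (I a <= a.+1)%N]].

Lemma card_good_index : #|good_index| = #|{: 'S_N}|.
Proof.
rewrite card_Sn cardsE.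
rewrite (eq_card (B := family (fun a : 'I_N.-1 => [pred i : 'I_N | (i <= a.+1)%N]))) => [|I].
  rewrite card_family foldrE big_map big_enum /= fact_prod.
  rewrite big_add1 /= big_nat_recl //= mul1n big_mkord; apply: eq_bigr => a _.
  rewrite -sum1_card (eq_bigl (fun i : 'I_N => (i < a.+2)%N)) //.
  by rewrite -(big_ord_widen _ (fun=> 1%N)) ?sum1_card ?card_ord // ltnS; apply: ltn_ord.
by apply/forallP/familyP => /= H a; have := H a; rewrite inE.
Qed.

Definition scale_rat : {rmorphism {mpoly int[N]} -> {mpoly rat[N]}} :=
  map_mpoly (intr : int -> rat).

Lemma schubert_rat_expand (w : 'S_N) :
  sch_gen N rat w = \sum_(I in good_index)
    hook_word rat I w *: \prod_(a < N.-1) scale_rat (pesym N a.+1 (I a)).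
Proof.
have -> : sch_gen N rat = usch_gen N (fun k => scale_rat \o pesym N k) N.-1.
  rewrite -nc_map_usch_gen (usch_gen_sch_gen n) nc_map_ybprod.
  congr ((ybprod _ _ _ _ : nilcox _ _)); apply: funext => k /=; first by rewrite rmorph0.
  by rewrite /mvar; case: (insub k : option 'I_N) => [i|]; rewrite ?rmorph0 // map_mpolyX.
rewrite usch_gen_expand => [|k r kN kr]; last by rewrite /= pesym_vanish // rmorph0.
rewrite nc_sumE [RHS]big_mkcond; apply: eq_bigr => I _ /=.
rewrite nc_scaleE -(nc_map_hook_word (@mpolyC N rat : {rmorphism rat -> {mpoly rat[N]}})) nc_mapE.
rewrite mulrC mul_mpolyC inE; case: ifP => [//|/negbT/forallPn[a]].
rewrite -ltnNge => aI; rewrite (bigD1 a) //= pesym_vanish ?rmorph0 ?mul0r ?scaler0 //.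
exact: ltn_ord a.
Qed.

(** The independent Schubert polynomials expand in these products, which are as many as the
    permutations. The square expansion matrix is thus invertible and the products are independent.
    Coefficients are rational for the rank argument. *)
Lemma pesym_prod_free (b : index -> rat) :
  \sum_(I in good_index) b I *: \prod_(a < N.-1) scale_rat (pesym N a.+1 (I a)) = 0 ->
  forall I, I \in good_index -> b I = 0.
Proof.
pose E (I : index) := \prod_(a < N.-1) scale_rat (pesym N a.+1 (I a)).
pose A : 'M[rat]_(#|{: 'S_N}|, #|good_index|) :=
  \matrix_(i, j) hook_word rat (enum_val j) (enum_val i).
have SE (w : 'S_N) : sch_gen N rat w = \sum_(I in good_index) hook_word rat I w *: E I.
  exact: schubert_rat_expand.
have A_free : row_free A.
  apply: inj_row_free => v vA.
  have v0 : forall w : 'S_N, v 0 (enum_rank w) = 0.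
    apply: schubert_free.
    transitivity (\sum_(j < #|good_index|) (v *m A) 0 j *: E (enum_val j)); last first.
      by rewrite vA big1 // => j _; rewrite mxE scale0r.
    under [RHS]eq_bigr => j _ do rewrite mxE scaler_suml.
    rewrite exchange_big /= (reindex enum_rank) /=; last exact: onW_bij (enum_rank_bij _).
    apply: eq_bigr => w _; rewrite SE scaler_sumr big_enum_val /=.
    by apply: eq_bigr => j _; rewrite mxE enum_rankK scalerA.
  by apply/rowP => i; rewrite mxE -[i]enum_valK v0.
have A_full : row_full A by rewrite /row_full (eqP A_free) card_good_index.
move=> b0 I Igood.
pose bv : 'rV[rat]_(#|good_index|) := \row_j b (enum_val j).
have /submxP[t tA] : (bv <= A)%MS by apply: submx_full.
have t0 w : t 0 (enum_rank w) = 0.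
  apply: (@schubert_free _ _ (fun w => t 0 (enum_rank w))).
  transitivity (\sum_(j < #|good_index|) (t *m A) 0 j *: E (enum_val j)); last first.
    by rewrite -tA -[RHS]b0 [RHS]big_enum_val; apply: eq_bigr => j _; rewrite mxE.
  under [RHS]eq_bigr => j _ do rewrite mxE scaler_suml.
  rewrite exchange_big /= (reindex enum_rank) /=; last exact: onW_bij (enum_rank_bij _).
  apply: eq_bigr => w' _; rewrite SE scaler_sumr big_enum_val /=.
  by apply: eq_bigr => j _; rewrite mxE enum_rankK scalerA.
have := congr1 (fun M : 'rV[rat]_(#|good_index|) => M 0 (enum_rank_in Igood I)) tA.
rewrite /bv !mxE enum_rankK_in // => ->; rewrite big1 // => i _.
by rewrite -[i]enum_valK t0 mul0r.
Qed.

Lemma usch_coefE (w : 'S_N) : usch_coef w = hook_coef w.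
Proof.
have [H1 H2] := hook_coef_usch w.
have [A1 A2] : is_usch_coef w (usch_coef w).
  by apply: (xgetPex 0 (P := [set A | is_usch_coef w A])); exists (hook_coef w); exact: hook_coef_usch.
pose d (I : index) : int := usch_coef w I - hook_coef w I.
have d0 I : ~~ usch_index (plength w) I -> d I = 0 by move=> Iw; rewrite /d A1 // H1 // subrr.
have dsum : \sum_(I in good_index) (d I)%:~R *: \prod_(a < N.-1) scale_rat (pesym N a.+1 (I a)) = 0.
  have E : \sum_(I | usch_index (plength w) I) d I *: \prod_(a < N.-1) pesym N a.+1 (I a) = 0.
    by under eq_bigr => I _ do rewrite scalerBl; rewrite sumrB -A2 -H2 subrr.
  have := congr1 scale_rat E; rewrite rmorph0 rmorph_sum => E'; rewrite -[RHS]E' {E'}.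
  rewrite [LHS]big_mkcond [RHS]big_mkcond; apply: eq_bigr => I _ /=.
  rewrite /usch_index inE; case: ifP => //= Igood; case: ifP => [_|/negbT wI].
    by rewrite map_mpolyZ rmorph_prod.
  by rewrite d0 ?scale0r // /usch_index negb_and wI orbT.
apply/ffunP => I; apply/eqP; rewrite -subr_eq0 -/(d I).
case: (boolP (I \in good_index)) => [Ig|]; last first.
  by rewrite inE => Ig; rewrite d0 // /usch_index negb_and Ig.
by rewrite -(intr_eq0 rat) (pesym_prod_free dsum).
Qed.

Lemma uschE (R : comNzRingType) (c : nat -> nat -> R) (w : 'S_N) :
  (forall k r, (k < N)%N -> (k < r)%N -> c k r = 0) ->
  usch c w = usch_gen N c N.-1 w.
Proof. by move=> c0; rewrite usch_gen_coef // /usch usch_coefE. Qed.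
End Uniqueness.

(** * Generating series and Stanley functions *)

Section Sequences.
Variable R : comNzRingType.
Implicit Types a b c d h : nat -> R.

Definition seq_one : nat -> R := fun k => (k == 0%N)%:R.
(** The substitution t -> -t in the series; with it [hdiffE] becomes an identity of plain
    products. *)
Definition alternate c : nat -> R := fun k => (-1) ^+ k * c k.

Lemma seq_mul_poly a b K k : (k < K)%N ->
  seq_mul a b k = ((\poly_(i < K) a i) * (\poly_(i < K) b i))`_k.
Proof.
move=> kK; rewrite coefM; apply: eq_bigr => i _; have ik := ltn_ord i.
have iK : (i < K)%N by lia.
have kiK : (k - i < K)%N by lia.
by rewrite !coef_poly iK kiK.
Qed.

Lemma seq_mulC a b : seq_mul a b = seq_mul b a.
Proof. by apply: funext => k; rewrite !(seq_mul_poly _ _ (ltnSn k)) mulrC. Qed.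

Lemma seq_mulA a b c : seq_mul a (seq_mul b c) = seq_mul (seq_mul a b) c.
Proof.
have E (f g e : nat -> R) k : seq_mul f (seq_mul g e) k =
    ((\poly_(i < k.+1) f i) * ((\poly_(i < k.+1) g i) * (\poly_(i < k.+1) e i)))`_k.
  rewrite coefM; apply: eq_bigr => i _; have ik := ltn_ord i.
  by rewrite coef_poly ik (@seq_mul_poly g e k.+1) //; lia.
by apply: funext => k; rewrite [in RHS]seq_mulC !E mulrA mulrC.
Qed.

Lemma seq_mul1 a : seq_mul a seq_one = a.
Proof.
apply: funext => k; rewrite /seq_mul big_ord_recr /= subnn mulr1 big1 ?add0r // => i _.
by rewrite /seq_one subn_eq0 leqNgt ltn_ord mulr0.
Qed.

Lemma seq_mul0 a b : seq_mul a b 0%N = a 0%N * b 0%N.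
Proof. by rewrite /seq_mul big_ord1. Qed.

Lemma alternateK : involutive alternate.
Proof.
move=> c; apply: funext => k; rewrite /alternate mulrA -exprD addnn -mul2n exprM.
by rewrite sqrrN expr1n expr1n mul1r.
Qed.

Lemma alternate_mul a b : alternate (seq_mul a b) = seq_mul (alternate a) (alternate b).
Proof.
apply: funext => k; rewrite /alternate /seq_mul mulr_sumr; apply: eq_bigr => i _.
have /subnKC ik : (i <= k)%N by rewrite -ltnS.
by rewrite -{1}ik exprD mulrACA.
Qed.

Lemma alternate_one : alternate seq_one = seq_one.
Proof. by apply: funext => -[|k]; rewrite /alternate /seq_one ?mul1r ?mulr0. Qed.

Lemma hdiff_mul c d :
  seq_mul (alternate (with1 c)) (hdiff c d) = alternate (with1 d).
Proof. by apply: funext => k; rewrite /seq_mul -[RHS](hdiffE c) big_mkord. Qed.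

(* If h lists the complete symmetric functions then elem_of_complete h lists  *)
(* the elementary ones.                                                       *)
Definition elem_of_complete h : nat -> R :=
  alternate (hdiff (alternate h) (fun=> 0)).

Lemma with1_id c : c 0%N = 1 -> with1 c = c.
Proof. by move=> c0; apply: funext => -[|k]. Qed.

Lemma with1_0 : with1 (fun=> 0) = seq_one.
Proof. by apply: funext => -[|k]. Qed.

Lemma complete_mul h : h 0%N = 1 ->
  seq_mul h (alternate (elem_of_complete h)) = seq_one.
Proof.
move=> h0; rewrite /elem_of_complete alternateK.
have := hdiff_mul (alternate h) (fun=> 0).
rewrite with1_0 alternate_one with1_id ?alternateK //.
by rewrite /alternate h0 mul1r.
Qed.

Lemma seq_inv_unique h a b : h 0%N = 1 -> seq_mul h a = seq_mul h b -> a = b.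
Proof.
move=> h0 E; have hE := complete_mul h0.
rewrite -[a]seq_mul1 -[b]seq_mul1 -hE [seq_mul a _]seq_mulC [seq_mul b _]seq_mulC.
by rewrite [seq_mul h _]seq_mulC -!seq_mulA E.
Qed.

Lemma elem_of_complete_unique h e : h 0%N = 1 ->
  seq_mul h (alternate e) = seq_one -> e = elem_of_complete h.
Proof.
move=> h0 he; rewrite -[e]alternateK -[RHS]alternateK; congr alternate.
by apply: (seq_inv_unique h0); rewrite he complete_mul.
Qed.

Lemma elem_of_complete0 h : h 0%N = 1 -> elem_of_complete h 0%N = 1.
Proof.
move=> h0; have := congr1 (@^~ 0%N) (complete_mul h0).
by rewrite seq_mul0 h0 mul1r /alternate mul1r.
Qed.

Lemma hdiff0 c d : hdiff c d 0%N = 1.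
Proof.
have := congr1 (@^~ 0%N) (hdiff_mul c d).
by rewrite seq_mul0 /alternate /= !mulr1 mul1r.
Qed.

Lemma seq_mul_elem_hdiff c d : c 0%N = 1 -> d 0%N = 1 ->
  c = seq_mul d (elem_of_complete (hdiff c d)).
Proof.
move=> c0 d0; have h0 := hdiff0 c d; have := hdiff_mul c d.
rewrite !with1_id // => cd.
rewrite -[LHS]alternateK -[RHS]alternateK; congr alternate; rewrite alternate_mul.
by rewrite -cd -seq_mulA complete_mul // seq_mul1.
Qed.

End Sequences.

Lemma rmorph_elem_of_complete (R R' : comNzRingType) (f : {rmorphism R -> R'}) h :
  h 0%N = 1 -> f \o elem_of_complete h = elem_of_complete (f \o h).
Proof.
move=> h0; apply: elem_of_complete_unique; first by rewrite /= h0 rmorph1.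
have := congr1 (fun s : nat -> R => f \o s) (complete_mul h0).
rewrite (_ : f \o seq_one R = seq_one R') => [<-|].
  apply: funext => k; rewrite /= /seq_mul rmorph_sum; apply: eq_bigr => i _.
  by rewrite rmorphM /= /alternate rmorphM rmorph_sign.
by apply: funext => k; rewrite /= rmorph_nat.
Qed.

Section NcStanSeries.
Variables (R : comNzRingType) (n : nat).
Implicit Types c d : nat -> R.

Lemma nc_stan_mul k c d : c 0%N = 1 ->
  nc_stan R n k (seq_mul c d) = nc_stan R n k c * nc_stan R n k d.
Proof.
move=> c0; apply: ncstan_mul; first exact: hook_gen_vanish.
by move=> l; have [] := nc_goodP n c0 l.
Qed.

(** c is the product of d and [elem_of_complete (hdiff c d)], and [nc_anti] inverts E_k(d). This is
    the origin of the differences c - d in the quiver formula. *)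
Lemma nc_stan_diff k c d : c 0%N = 1 -> d 0%N = 1 ->
  nc_anti (nc_stan R n k d) * nc_stan R n k c
    = nc_stan R n k (elem_of_complete (hdiff c d)).
Proof.
move=> c0 d0; rewrite {1}(seq_mul_elem_hdiff c0 d0) nc_stan_mul // mulrA.
by have [_ -> _] := nc_goodP n d0 k; rewrite mul1r.
Qed.

(* This makes the products of linear factors telescope.                       *)
Lemma nc_lin_stan k c : c 0%N = 1 ->
  nc_lin R n k c = nc_stan R n k.+1 c * nc_anti (nc_stan R n k c).
Proof.
by move=> c0; rewrite ncstanS -mulrA; have [_ _ ->] := nc_goodP n c0 k; rewrite mulr1.
Qed.

Lemma nc_lin_anti_stan k c : c 0%N = 1 ->
  nc_anti (nc_lin R n k c) = nc_stan R n k c * nc_anti (nc_stan R n k.+1 c).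
Proof.
move=> c0; rewrite nc_lin_stan // nc_antiM; congr (_ * _).
apply/ffunP => w; rewrite !ffunE plengthV invgK mulrA -exprD addnn -mul2n exprM.
by rewrite sqrrN expr1n expr1n mul1r.
Qed.
End NcStanSeries.

Section DoubleUniversal.
Variables (R : comNzRingType) (N : nat).
Hypothesis N0 : (0 < N)%N.
Implicit Types (c d : nat -> nat -> R) (w : 'S_N).

Definition bounded_seqs c : Prop := forall k r, (k < N)%N -> (k < r)%N -> c k r = 0.

Lemma uschE_pos c w : bounded_seqs c -> usch c w = usch_gen N c N.-1 w.
Proof. by move: N0 c w; rewrite /bounded_seqs; case: N => // n _ c w; apply: uschE. Qed.

Lemma schubert_usch_gen_pos w : schubert w = usch_gen N (pesym N) N.-1 w.
Proof. by move: N0 w; case: N => // n _ w; apply: schubert_usch_gen. Qed.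

Lemma double_uschE c d w : bounded_seqs c -> bounded_seqs d ->
  double_usch c d w = (nc_anti (usch_gen N d N.-1) * usch_gen N c N.-1) w.
Proof.
move=> cb db; rewrite /double_usch nc_mulE pair_big big_mkcond /=; apply: eq_bigr => -[u v] _ /=.
rewrite andbC /lenadd.
have -> : (plength u + plength v == plength w)%N && (pcomp u v == w)
    = (plength u + plength v == plength (pcomp u v))%N && (pcomp u v == w).
  by case: (pcomp u v =P w) => [->|_]; rewrite ?andbF.
by case: ifP => // _; rewrite !uschE_pos // ffunE.
Qed.
End DoubleUniversal.

Section Unshift.
Variables (R : comNzRingType) (m n : nat).

Lemma unshift_hook k r : nc_unshift (nc_hook R (m + n) (m + k) r) = nc_hook R n k r.
Proof.
rewrite rmorph_nchook nchook_shift /= => [|j jm]; last by rewrite nc_unshift_gen jm.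
apply: eq_nchook => j _; rewrite nc_unshift_gen; case: ltnP; first by lia.
by rewrite addKn.
Qed.

Lemma unshift_lin k (c : nat -> R) :
  nc_unshift (nc_lin R (m + n) (m + k) c) = nc_lin R n k c.
Proof.
rewrite [in LHS]/nclin rmorph_sum -(@hook_sum_widen _ _ _ _ (@hook_gen_vanish R n) k c ((m + n) * (m + n)).+1); last first.
  by rewrite ltnS leq_mul // leq_addl.
by apply: eq_bigr => r _; rewrite /= nc_unshiftZ unshift_hook.
Qed.

Lemma unshift_lin_low k (c : nat -> R) : c 0%N = 1 -> (k < m)%N ->
  nc_unshift (nc_lin R (m + n) k c) = 1.
Proof.
move=> c0 km; rewrite /nclin rmorph_sum /= big_ord_recl nc_unshiftZ c0 scale1r nchook0 rmorph1.
rewrite big1 ?addr0 // => r _; rewrite nc_unshiftZ rmorph_nchook nchook_trivial ?scaler0 //.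
by rewrite /= nc_unshift_gen km.
Qed.

(** The m lowest factors become 1 and the others drop m levels but keep their sequences; so passing
    to 1^m x w shifts the index of c by m. *)
Lemma unshift_usch_gen (c : nat -> nat -> R) K : (forall k, c k 0%N = 1) ->
  nc_unshift (usch_gen (m + n) c (m + K)) = usch_gen n (fun k => c (m + k)%N) K.
Proof.
move=> c0; elim: K => [|K IH].
  rewrite addn0 /=; suff low k : (k <= m)%N -> nc_unshift (usch_gen (m + n) c k) = 1 by apply: low.
  elim: k => [|k IHk] km /=; first by rewrite rmorph1.
  by rewrite rmorphM /= unshift_lin_low // mul1r IHk // ltnW.
by rewrite addnS /= rmorphM /= unshift_lin IH addnS.
Qed.
End Unshift.

Lemma usch_gen_const (R : comNzRingType) n (c : nat -> R) K : usch_gen n (fun=> c) K = nc_stan R n K c.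
Proof. by elim: K => [|k IH] /=; rewrite ?ncstan0 // IH ncstanS. Qed.

Lemma eq_usch_gen (R : comNzRingType) n (c c' : nat -> nat -> R) K :
  (forall k, (0 < k)%N -> (k <= K)%N -> c k = c' k) -> usch_gen n c K = usch_gen n c' K.
Proof.
elim: K => [|K IH] cc //=; rewrite cc // IH // => k k0 kK; apply: cc => //; exact: ltnW.
Qed.

Section Restriction.
Variables (k N : nat).

Definition mrestr_morph : {rmorphism {mpoly int[N]} -> {mpoly int[k]}} :=
  comp_mpoly [tuple (if insub (val i) is Some j then 'X_(j : 'I_k) else 0) | i < N].

Lemma mrestr_mvar i : (i < N)%N -> mrestr_morph (mvar int N i) = mvar int k i.
Proof.
move=> iN; rewrite (mvarE _ (Ordinal iN)) /mrestr_morph /= comp_mpolyXU -tnth_nth tnth_mktuple.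
by [].
Qed.

Lemma mrestr_pesym a r : (a <= N)%N -> mrestr_morph (pesym N a r) = pesym k (minn a k) r.
Proof.
elim: a r => [|a IH] r aN; first by rewrite min0n !pesym0 rmorph_nat.
have := congr1 (@^~ r) (pesymS (Ordinal aN)); rewrite /= => ->.
rewrite -mvarE /= /seq_mul_var rmorphD /= IH; last exact: ltnW.
have [ak|ka] := ltnP a k.
  rewrite (minn_idPl ak).
  have := congr1 (@^~ r) (pesymS (Ordinal ak)); rewrite /= => ->.
  rewrite -mvarE /= /seq_mul_var; congr (_ + _); case: r => [|r]; first by rewrite rmorph0.
  by rewrite rmorphM /= mrestr_mvar // IH ?(minn_idPr ka) ?(minn_idPl (ltnW ak)) // ltnW.
rewrite (minn_idPr (leqW ka)).
case: r => [|r]; first by rewrite rmorph0 addr0.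
by rewrite rmorphM /= mrestr_mvar // [mvar _ k a]mvar_ge // mul0r addr0.
Qed.
End Restriction.

(** * Complete and elementary symmetric polynomials *)

Section CompleteSymmetric.
Implicit Types (R : comNzRingType).

Lemma mcoeff_mwiden R n (p : {mpoly R[n]}) (m : 'X_{1..n.+1}) :
  (mwiden p)@_m =
    if m ord_max == 0%N then p@_[multinom m (widen_ord (leqnSn n) i) | i < n] else 0.
Proof.
rewrite [in LHS](mpolyE p) (big_morph _ (@mwidenD n R) (@mwiden0 n R)) linear_sum /=.
under eq_bigr => m' _ do rewrite mwidenZ mwidenX mcoeffZ mcoeffX.
have [m0|m0] := eqVneq (m ord_max) 0%N; last first.
  rewrite big1 // => m' _; case: eqP => [E|]; last by rewrite mulr0.
  by move: m0; rewrite -E mnmwiden_ordmax.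
set m1 := [multinom _ | i < n].
rewrite [in RHS](mpolyE p) linear_sum /=; apply: eq_bigr => m' _.
rewrite mcoeffZ mcoeffX; congr (_ * (nat_of_bool _)%:R); apply/eqP/eqP => [E|->].
  by apply/mnmP => i; rewrite mnmE -E mnmwiden_widen.
apply/mnmP => i; have [j ->|->] := unliftP ord_max i; last by rewrite mnmwiden_ordmax m0.
rewrite (_ : fintype.lift ord_max j = widen_ord (leqnSn n) j); last exact/val_inj/lift_max.
by rewrite mnmwiden_widen mnmE.
Qed.

Lemma mcompleteSS r n :
  mcomplete r.+1 n.+1 = mwiden (mcomplete r.+1 n) + 'X_ord_max * mcomplete r n.+1.
Proof.
apply/mpolyP => m; rewrite mcoeffD mcoeff_mwiden !mcoeff_mcomplete mulrC.
have degE (q : 'X_{1..n.+1}) : mdeg q = (\sum_(i < n) q (widen_ord (leqnSn n) i) + q ord_max)%N.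
  by rewrite mdegE big_ord_recr.
have [m0|m0] := eqVneq (m ord_max) 0%N.
  rewrite [X in _ + X]memN_msupp_eq0 ?addr0; last first.
    rewrite (perm_mem (msuppMX _ _)); apply/mapP => -[m' _ mE].
    have := congr1 (fun q : 'X_{1..n.+1} => q ord_max) mE.
    by rewrite /= m0 mnmDE mnm1E eqxx.
  by rewrite degE m0 addn0 [in RHS]mdegE; congr (_ == _)%:R; apply: eq_bigr => i _; rewrite mnmE.
have mE : m = (U_(ord_max) + (m - U_(ord_max)))%MM.
  by rewrite addmC submK //; apply/mnm_lepP => i; rewrite mnm1E; case: eqP => // <-; rewrite lt0n.
rewrite add0r [in RHS]mE mcoeffMX mcoeff_mcomplete [in LHS]mE mdegD mdeg1 add1n.
by [].
Qed.

Lemma mcomplete0 n : mcomplete 0 n = 1.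
Proof. by apply/mpolyP => m; rewrite mcoeff_mcomplete mcoeff1 mdeg_eq0. Qed.

Lemma mcomplete_n0 r : mcomplete r 0 = (r == 0%N)%:R.
Proof.
case: r => [|r]; first exact: mcomplete0.
apply/mpolyP => m; rewrite mcoeff_mcomplete mcoeff0 mdegE big_ord0 //.
Qed.

Definition seq_lin R (x : R) : nat -> R := fun k => if k is k'.+1 then (k' == 0%N)%:R * x else 1.

Lemma seq_mul_varE R (c : nat -> R) x : seq_mul_var c x = seq_mul c (seq_lin x).
Proof.
apply: funext => -[|k]; rewrite /seq_mul_var /seq_mul.
  by rewrite big_ord1 subnn mulr1 addr0.
rewrite !big_ord_recr /= subnn subSnn /= mul1r mulr1 addrC [x * _]mulrC; congr (_ + _).
rewrite -[LHS]add0r; congr (_ + _); rewrite big1 // => i _.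
have ik := ltn_ord i; rewrite (_ : k.+1 - i = (k - i.+1).+2)%N; last by lia.
by rewrite /= mul0r mulr0.
Qed.

Lemma mcomplete_mul n : seq_mul (mcomplete^~ n) (alternate (pesym n n)) = seq_one _.
Proof.
elim: n => [|n IH].
  rewrite (_ : mcomplete^~ 0%N = seq_one _); last by apply: funext => r; rewrite mcomplete_n0.
  rewrite (_ : pesym 0 0 = seq_one _); last by apply: funext => r; rewrite pesym0.
  by rewrite alternate_one seq_mul1.
have ES : pesym n.+1 n.+1 = seq_mul_var (fun r => mwiden (pesym n n r)) 'X_ord_max.
  apply: funext => -[|r]; rewrite /seq_mul_var; first by rewrite !pesym_zero rmorph1 addr0.
  by rewrite !pesym_full mesymSS mulrC.
have HS : seq_mul (mcomplete^~ n.+1) (alternate (seq_lin 'X_ord_max)) = fun r => mwiden (mcomplete r n).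
  have -> : alternate (seq_lin 'X_ord_max) = seq_lin (- 'X_ord_max : {mpoly int[n.+1]}).
    apply: funext => -[|[|r]]; rewrite /alternate /seq_lin ?mul1r ?expr1 //.
      by rewrite mulN1r.
    by rewrite !mul0r mulr0.
  rewrite -seq_mul_varE; apply: funext => -[|r]; rewrite /seq_mul_var.
    by rewrite !mcomplete0 rmorph1 addr0.
  by rewrite mcompleteSS mulNr addrK.
rewrite ES seq_mul_varE alternate_mul [seq_mul (alternate _) _]seq_mulC seq_mulA HS.
have := congr1 (fun s : nat -> {mpoly int[n]} => @mwiden _ _ \o s) IH.
rewrite (_ : @mwiden _ _ \o seq_one _ = seq_one _) => [<-|]; last first.
  by apply: funext => k; rewrite /= rmorph_nat.
apply: funext => k; rewrite /= /seq_mul rmorph_sum; apply: eq_bigr => i _.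
by rewrite rmorphM /= /alternate rmorphM rmorph_sign.
Qed.

Lemma elem_of_mcomplete n : elem_of_complete (mcomplete^~ n) = pesym n n.
Proof. by apply/esym/elem_of_complete_unique; rewrite ?mcomplete0 // mcomplete_mul. Qed.
End CompleteSymmetric.

(** * Stanley functions as coefficients of E_n *)

Section Stanley.

Definition symf_ev k (F : symfun) : {mpoly int[k]} := symf_at F k.

Fact symf_ev_zmod k : zmod_morphism (symf_ev k).
Proof. by move=> F G; rewrite /symf_ev. Qed.

Fact symf_ev_monoid k : monoid_morphism (symf_ev k).
Proof. by split. Qed.

HB.instance Definition _ k := GRing.isZmodMorphism.Build _ _ (symf_ev k) (symf_ev_zmod k).
HB.instance Definition _ k := GRing.isMonoidMorphism.Build _ _ (symf_ev k) (symf_ev_monoid k).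

Lemma symfunP (F G : symfun) : (forall k, symf_ev k F = symf_ev k G) -> F = G.
Proof. by move=> FG; apply/val_inj; apply: functional_extensionality_dep => k; apply: FG. Qed.

Lemma complete_sym0 : complete_sym 0 = 1.
Proof. by apply: symfunP => k; rewrite rmorph1; apply: mcomplete0. Qed.

(** For m >= k, setting x_i = 0 for i > k turns every e(x_1, .., x_(m+j)) into e(x_1, .., x_k), and
    the linear factors at a constant sequence multiply to E_n. *)
Lemma stanleyE n (w : 'S_n.+1) :
  stanley w = nc_stan symfun n.+1 n (elem_of_complete complete_sym) w.
Proof.
set F := nc_stan _ _ _ _ w.
have h0 := complete_sym0.
have FE k m : (k <= m)%N -> symf_at F k = mrestr k (schubert (pshift m w)).
  move=> km; rewrite -[LHS]/(symf_ev k F) /F -(nc_mapE (symf_ev k)) nc_map_stan.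
  rewrite rmorph_elem_of_complete // (_ : _ \o _ = mcomplete^~ k) // elem_of_mcomplete.
  rewrite schubert_usch_gen_pos; last by rewrite addnS.
  rewrite -[RHS]/(mrestr_morph k _ _) -(nc_mapE (mrestr_morph k _)) nc_map_usch_gen.
  have -> : (m + n.+1).-1 = (m + n)%N by rewrite addnS.
  rewrite -nc_unshiftE unshift_usch_gen; last by move=> j; rewrite /= pesym_zero rmorph1.
  rewrite -usch_gen_const; congr (fun_of_fin _ _); apply: eq_usch_gen => j j0 jn.
  apply: funext => r; rewrite /= mrestr_pesym; last by rewrite leq_add2l ltnW.
  by rewrite (minn_idPr _) // (leq_trans km) // leq_addr.
have SE : forall k m, (k <= m)%N -> symf_at (stanley w) k = mrestr k (schubert (pshift m w)).
  by apply: (xgetPex 0 (P := [set F | forall k m, (k <= m)%N ->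
    symf_at F k = mrestr k (schubert (pshift m w))])); exists F.
by apply: symfunP => k; rewrite /symf_ev (SE k k) // (FE k k).
Qed.
End Stanley.

(** * Reduced factorizations *)

Section Factorizations.
Variables (R : comNzRingType) (n : nat).

Lemma plength_big_pcomp (s : seq 'S_n) :
  (plength (\big[@pcomp n/1%g]_(u <- s) u) <= \sum_(u <- s) plength u)%N.
Proof.
elim: s => [|u s IH]; first by rewrite !big_nil plength1.
by rewrite !big_cons (leq_trans (plength_pcomp_le _ _)) // leq_add2l.
Qed.

Lemma prod_nc_perm (s : seq 'S_n) :
  \prod_(u <- s) nc_perm R u =
    if (\sum_(u <- s) plength u == plength (\big[@pcomp n/1%g]_(u <- s) u))%N
    then nc_perm R (\big[@pcomp n/1%g]_(u <- s) u) else 0.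
Proof.
elim: s => [|u s IH]; first by rewrite !big_nil plength1 eqxx nc_perm1.
rewrite !big_cons IH; have le1 := plength_big_pcomp s.
set v := \big[_/_]_(u <- s) u in le1 *; set l := (\sum_(u <- s) _)%N in le1 *.
have le2 := plength_pcomp_le u v.
have [lv|lv] := eqVneq l (plength v); first by rewrite lv nc_perm_mul /lenadd.
by rewrite mulr0; case: eqP => // E; lia.
Qed.

Lemma nc_prod_coef r (f : 'I_r -> nilcox R n) (w : 'S_n) :
  (\prod_(i < r) f i) w = \sum_(u : {ffun 'I_r -> 'S_n} | is_reduced_fact w u)
    \prod_(i < r) f i (u i).
Proof.
have -> : \prod_(i < r) f i = \prod_(i < r) (\sum_(v : 'S_n) f i v *: nc_perm R v : nilcox R n).
  by apply: eq_bigr => i _; apply: nc_expand.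
rewrite bigA_distr_bigA nc_sumE [RHS]big_mkcond; apply: eq_bigr => u _ /=.
rewrite scaler_prod nc_scaleE.
have := prod_nc_perm [seq u i | i <- index_enum 'I_r]; rewrite !big_map => ->.
rewrite /is_reduced_fact eq_sym; set v := \big[_/_]_(i <- _) u i.
have [vw|vw] := eqVneq v w; last first.
  by case: ifP => _; rewrite ?nc_zeroE ?mulr0 // nc_permE eq_sym (negbTE vw) mulr0.
rewrite vw andTb eq_sym; case: ifP => _; rewrite ?nc_zeroE ?mulr0 //.
by rewrite nc_permE eqxx mulr1.
Qed.

(** Restriction to S_(k+1) kills u_j for j >= k, hence sends L_j to 1 for those j. *)
Lemma nc_stan_restr (c : nat -> R) k K : c 0%N = 1 -> (k <= K)%N ->
  nc_restr k.+1 (nc_stan R n K c) = nc_stan R n k c.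
Proof.
move=> c0.
have lin j : nc_restr k.+1 (nc_lin R n j c) = if (j < k)%N then nc_lin R n j c else 1.
  rewrite rmorph_sum /=; under eq_bigr => r _ do rewrite nc_restrZ rmorph_nchook.
  case: ltnP => [jk|kj].
    apply: eq_bigr => r _; congr (_ *: _); apply: eq_nchook => l lj.
    by rewrite /= nc_restr_gen (_ : l.+1 < k.+1)%N // ltnS (leq_ltn_trans lj).
  rewrite big_ord_recl c0 scale1r nchook0 big1 ?addr0 // => r _.
  by rewrite nchook_trivial ?scaler0 //= nc_restr_gen ltnS ltnNge kj.
have low j : (j <= k)%N -> nc_restr k.+1 (nc_stan R n j c) = nc_stan R n j c.
  elim: j => [|j IH] jk; first by rewrite ncstan0 rmorph1.
  by rewrite ncstanS rmorphM /= lin jk IH // ltnW.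
move=> kK; rewrite -(subnKC kK); elim: (K - k)%N => [|d IH]; first by rewrite addn0 low.
by rewrite addnS ncstanS rmorphM /= lin ltnNge leq_addr mul1r IH.
Qed.

Lemma nc_stan_in_sym (c : nat -> R) k K u : c 0%N = 1 -> (k <= K)%N ->
  nc_stan R n k c u = if in_sym k.+1 u then nc_stan R n K c u else 0.
Proof. by move=> c0 kK; rewrite -(nc_stan_restr c0 kK) nc_restrE. Qed.

Lemma telescope_prod (B : nzRingType) (x y : nat -> B) K :
  \prod_(0 <= i < K.+1) (x i * y i) = x 0%N * (\prod_(0 <= i < K) (y i * x i.+1)) * y K.
Proof.
elim: K => [|K IH]; first by rewrite big_nat1 big_geq // mulr1.
by rewrite big_nat_recr // IH big_nat_recr //= !mulrA.
Qed.
End Factorizations.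

(** * Telescoping of the double generating function *)

Section Telescope.
Variables (R : comNzRingType) (n : nat) (c d : nat -> nat -> R).
Hypotheses (c0 : forall k, c k 0%N = 1) (d0 : forall k, d k 0%N = 1).
Notation N := n.+1.

(* The sequences d(1), .., d(n), c(n), .., c(1). *)
Definition chain (i : nat) : nat -> R := if (i < n)%N then d i.+1 else c (n.*2 - i)%N.

(** The levels 0, 1, .., n, .., 1, 0 of the telescoping product. *)
Definition chain_index (i : nat) : nat := minn i (n.*2 - i).

Lemma chain0 i : chain i 0%N = 1.
Proof. by rewrite /chain; case: ifP. Qed.

Definition chain_factor (i : nat) : nilcox R N :=
  if (i < n)%N then nc_anti (nc_lin R N i (d i.+1))
  else nc_lin R N (n.*2 - i.+1) (c (n.*2 - i)).

Lemma chain_factorE i : (i < n.*2)%N -> chain_factor i =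
  nc_stan R N (chain_index i) (chain i) * nc_anti (nc_stan R N (chain_index i.+1) (chain i)).
Proof.
move=> i2n; rewrite /chain_factor /chain; case: ltnP => [lin|nli].
  rewrite nc_lin_anti_stan //; congr (nc_stan _ _ _ _ * nc_anti (nc_stan _ _ _ _));
  by rewrite /chain_index; lia.
rewrite nc_lin_stan //; congr (nc_stan _ _ _ _ * nc_anti (nc_stan _ _ _ _));
by rewrite /chain_index; lia.
Qed.

Lemma usch_gen_down K : usch_gen N c K = \prod_(0 <= i < K) nc_lin R N (K - i.+1) (c (K - i)%N).
Proof.
elim: K => [|K IH] /=; first by rewrite big_geq.
by rewrite big_nat_recl // subn1 subn0 IH.
Qed.

Lemma usch_gen_anti K :
  nc_anti (usch_gen N d K) = \prod_(0 <= i < K) nc_anti (nc_lin R N i (d i.+1)).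
Proof.
elim: K => [|K IH] /=; first by rewrite big_geq // nc_anti1.
by rewrite nc_antiM IH big_nat_recr.
Qed.

(** Factor i is E E'^(-1) at [chain i], where E and E' have the levels [chain_index i] and
    [chain_index i.+1]. So the inverse in factor i meets an element of the same level at
    [chain i.+1], and [nc_stan_diff] merges the two; at both ends E_0 = 1. *)
Lemma usch_gen_telescope : (0 < n)%N ->
  nc_anti (usch_gen N d n) * usch_gen N c n =
  \prod_(0 <= i < n.*2.-1)
     nc_stan R N (chain_index i.+1) (elem_of_complete (hdiff (chain i.+1) (chain i))).
Proof.
move=> n0; transitivity (\prod_(0 <= i < n.*2) chain_factor i).
  rewrite usch_gen_anti usch_gen_down [RHS](@big_cat_nat _ _ _ n) //=; last by lia.
  congr (_ * _); first by apply: eq_big_nat => i /andP[_ i_n]; rewrite /chain_factor i_n.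
  have := @big_addn _ 1 *%R 0%N n.*2 n xpredT chain_factor; rewrite add0n => ->.
  rewrite (_ : n.*2 - n = n)%N; last by lia.
  apply: eq_big_nat => i _; rewrite /chain_factor ltnNge leq_addl /=.
  by congr (nc_lin _ _ _ (c _)); lia.
transitivity (\prod_(0 <= i < n.*2) (nc_stan R N (chain_index i) (chain i)
    * nc_anti (nc_stan R N (chain_index i.+1) (chain i)))).
  by apply: eq_big_nat => i /andP[_ i2n]; rewrite chain_factorE.
have [k kE] : exists k, n.*2 = k.+1 by exists n.*2.-1; lia.
have ci0 : chain_index 0 = 0%N by rewrite /chain_index min0n.
have cik : chain_index k.+1 = 0%N by rewrite /chain_index kE subnn minn0.
rewrite kE telescope_prod ci0 cik !ncstan0 nc_anti1 mul1r mulr1 /=.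
by apply: eq_bigr => i _; rewrite nc_stan_diff // chain0.
Qed.

Lemma usch_gen_factorizations (w : 'S_N) : (0 < n)%N ->
  (nc_anti (usch_gen N d n) * usch_gen N c n) w =
  \sum_(u : {ffun 'I_(n.*2.-1) -> 'S_N} | is_reduced_fact w u &&
          [forall i : 'I_(n.*2.-1), in_sym (minn i.+1 (n.*2 - i.+1)).+1 (u i)])
    \prod_(i < n.*2.-1)
      nc_stan R N n (elem_of_complete (hdiff (chain i.+1) (chain i))) (u i).
Proof.
move=> n0; rewrite usch_gen_telescope // big_mkord nc_prod_coef.
rewrite [RHS]big_mkcondr; apply: eq_bigr => u _.
(* A factorization with some u_i outside its subgroup contributes 0, as the corresponding E has no
   coefficient there. *)
case: ifP => [/forallP Hu|/negbT/forallPn [i Hi]].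
  apply: eq_bigr => i _; rewrite (@nc_stan_in_sym _ _ _ _ n) ?Hu //.
    by rewrite elem_of_complete0 // hdiff0.
  by rewrite /chain_index; have := ltn_ord i; lia.
rewrite (bigD1 i) //= (@nc_stan_in_sym _ _ _ _ n) ?(negbTE Hi) ?mul0r //.
  by rewrite elem_of_complete0 // hdiff0.
by rewrite /chain_index; have := ltn_ord i; lia.
Qed.
End Telescope.

(** * Expansion in Schur determinants *)

Section Rearrangement.
Variables (p : nat) (f : 'I_p -> nat) (s : 'S_p).
Hypothesis f_decr : forall i j : 'I_p, (i <= j)%N -> (f j <= f i)%N.

Lemma card_ord_lt (i : 'I_p) : (\sum_(j < p) (j < i)%N)%N = i.
Proof.
rewrite -[RHS]card_ord -sum1_card (big_ord_widen _ (fun=> 1%N) (ltnW (ltn_ord i))).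
by rewrite [RHS]big_mkcond; apply: eq_bigr => j _; case: ltnP.
Qed.

(** Compared pair by pair: a pair j < i contributes f i on the left, and f i or f j >= f i on the
    right. *)
Lemma rearrangement : (\sum_(i < p) f i * i <= \sum_(i < p) f i * s i)%N.
Proof.
have -> : (\sum_(i < p) f i * i = \sum_(i < p) \sum_(j < p) (j < i) * f i)%N.
  by apply: eq_bigr => i _; rewrite -[X in (_ * X)%N](card_ord_lt i) mulnC big_distrl.
have -> : (\sum_(i < p) f i * s i = \sum_(i < p) \sum_(j < p) (s j < s i) * f i)%N.
  apply: eq_bigr => i _; rewrite -[X in (_ * X)%N](card_ord_lt (s i)) mulnC big_distrl /=.
  by rewrite [LHS](reindex_inj (@perm_inj _ s)).
have -> : (\sum_(i < p) \sum_(j < p) (s j < s i) * f i =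
    \sum_(i < p) \sum_(j < p) (j < i) * ((s j < s i) * f i + (s i < s j) * f j))%N.
  transitivity (\sum_(i < p) \sum_(j < p) ((j < i) * ((s j < s i) * f i) + (i < j) * ((s j < s i) * f i)))%N.
    apply: eq_bigr => i _; apply: eq_bigr => j _.
    case: (ltngtP (val i) (val j)) => [_|_|/val_inj ->]; rewrite ?mul0n ?mul1n ?addn0 ?add0n //.
    by rewrite ltnn.
  under eq_bigr => i _ do rewrite big_split /=.
  rewrite big_split /= [X in (_ + X)%N]exchange_big /= -big_split /=; apply: eq_bigr => i _.
  by rewrite -big_split /=; apply: eq_bigr => j _; rewrite -mulnDr.
apply: leq_sum => i _; apply: leq_sum => j _; case: ltnP => // ji; rewrite !mul1n.
have sij : s i != s j :> nat by rewrite val_eqE (inj_eq perm_inj) -val_eqE /=; lia.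
have fij : (f i <= f j)%N by apply: f_decr; apply: ltnW.
by case: (ltngtP (s i) (s j)) sij => //= _ _; lia.
Qed.

(** The sum of squares grows by 2 sum f_i (s_i - i) + sum (s_i - i)^2. The first sum is nonnegative
    by [rearrangement], the second is positive. *)
Lemma square_increase : s != 1%g -> (forall i : 'I_p, (i <= f i + s i)%N) ->
  (\sum_(i < p) f i ^ 2 < \sum_(i < p) (f i + s i - i) ^ 2)%N.
Proof.
move=> s1 valid.
have dist (i : 'I_p) : ((f i + s i - i) ^ 2 + (f i * i).*2 + (s i * i).*2
    = f i ^ 2 + (f i * s i).*2 + (s i ^ 2 + i ^ 2))%N.
  by have := valid i; rewrite -!mulnn -!mul2n; nia.
have sum_s (F : nat -> nat) : (\sum_(i < p) F (s i) = \sum_(i < p) F i)%N.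
  by rewrite [RHS](reindex_inj (@perm_inj _ s)).
have strict : (\sum_(i < p) (s i * i).*2 < \sum_(i < p) (s i ^ 2 + i ^ 2))%N.
  have [i si] : exists i, s i != i.
    apply: contrapT => H; case/eqP: s1; apply/permP => i; rewrite perm1.
    by apply/eqP; apply: contrapT => /negP si; apply: H; exists i.
  rewrite (bigD1 i) //= [X in (_ < X)%N](bigD1 i) //= -addSn leq_add //.
    by rewrite -mul2n (ltn_leqif (nat_Cauchy _ _)) val_eqE.
  by apply: leq_sum => j _; rewrite -mul2n (nat_Cauchy _ _).
have E : (\sum_(i < p) (f i + s i - i) ^ 2 + \sum_(i < p) (f i * i).*2 + \sum_(i < p) (s i * i).*2
    = \sum_(i < p) f i ^ 2 + \sum_(i < p) (f i * s i).*2 + \sum_(i < p) (s i ^ 2 + i ^ 2))%N.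
  by rewrite -!big_split /=; apply: eq_bigr => i _; apply: dist.
have R : (\sum_(i < p) (f i * i).*2 <= \sum_(i < p) (f i * s i).*2)%N.
  have dbl (F : 'I_p -> nat) : (\sum_(i < p) (F i).*2 = (\sum_(i < p) F i).*2)%N.
    by rewrite -[RHS]muln2 big_distrl /=; apply: eq_bigr => i _; rewrite muln2.
  by rewrite !dbl leq_double rearrangement.
by lia.
Qed.

End Rearrangement.

(** Quantifying over the ring lets a single expansion serve in [cd_ring], in [symfun] and in
    polynomial rings. *)
Definition hfun : Type := forall R : comNzRingType, (nat -> R) -> R.

(* Integer combinations, uniform in the sequence h with h_0 = 1, of a family  *)
(* of homogeneous expressions in h.                                           *)
Section Span.
Variables (T : eqType) (deg : T -> nat) (val : T -> hfun).

Definition hspan (d : nat) (Phi : hfun) : Prop :=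
  exists s : seq (int * T), (forall p, p \in s -> deg p.2 = d) /\
    forall (R : comNzRingType) (h : nat -> R), h 0%N = 1 ->
      Phi R h = \sum_(p <- s) p.1%:~R * val p.2 h.

Lemma hspan_ext d (Phi Psi : hfun) :
  (forall (R : comNzRingType) (h : nat -> R), h 0%N = 1 -> Phi R h = Psi R h) ->
  hspan d Psi -> hspan d Phi.
Proof. by move=> E [s [s1 s2]]; exists s; split=> // R h h0; rewrite E // s2. Qed.

Lemma hspan0 d : hspan d (fun R h => 0).
Proof. by exists [::]; split=> // R h _; rewrite big_nil. Qed.

Lemma hspan_val t : hspan (deg t) (val t).
Proof.
exists [:: (1, t)]; split=> [p|R h _]; first by rewrite inE => /eqP ->.
by rewrite big_seq1 mul1r.
Qed.

Lemma hspanD d (Phi Psi : hfun) : hspan d Phi -> hspan d Psi ->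
  hspan d (fun R h => Phi R h + Psi R h).
Proof.
move=> [s [s1 s2]] [t [t1 t2]]; exists (s ++ t); split=> [p|R h h0].
  by rewrite mem_cat => /orP[/s1|/t1].
by rewrite big_cat s2 ?t2.
Qed.

Lemma hspanZ d (k : int) (Phi : hfun) : hspan d Phi -> hspan d (fun R h => k%:~R * Phi R h).
Proof.
move=> [s [s1 s2]]; exists [seq (k * p.1, p.2) | p <- s]; split=> [p /mapP[q /s1 qd ->] //|R h h0].
rewrite s2 // mulr_sumr big_map; apply: eq_bigr => p _ /=.
by rewrite intrM mulrA.
Qed.

Lemma hspan_sum d (I : eqType) (r : seq I) (Phi : I -> hfun) :
  (forall i, i \in r -> hspan d (Phi i)) -> hspan d (fun R h => \sum_(i <- r) Phi i R h).
Proof.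
elim: r => [|i r IH] H.
  by apply: (hspan_ext _ (hspan0 d)) => R h _; rewrite big_nil.
apply: (hspan_ext (Psi := fun R h => Phi i R h + \sum_(j <- r) Phi j R h)).
  by move=> R h _; rewrite big_cons.
by apply: hspanD; [apply: H; rewrite mem_head|apply: IH => j jr; apply: H; rewrite inE jr orbT].
Qed.
End Span.

Lemma hspan_trans (T T' : eqType) deg deg' (val : T -> hfun) (val' : T' -> hfun) d Phi :
  (forall t, deg t = d -> hspan deg' val' d (val t)) ->
  hspan deg val d Phi -> hspan deg' val' d Phi.
Proof.
move=> H [s [s1 s2]].
apply: (hspan_ext (Psi := fun R h => \sum_(p <- s) p.1%:~R * val p.2 R h)) => //.
by apply: hspan_sum => p ps; apply: hspanZ; apply: H; apply: s1.
Qed.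

Definition hmonom (mu : seq nat) : hfun := fun R h => \prod_(k <- mu) h k.
Definition hschur (la : intpart) : hfun := fun R h => schur_det h la.
Notation mono_span := (hspan sumn hmonom).
Notation schur_span := (hspan (fun la : intpart => sumn la) hschur).

Lemma mono_spanM d e (Phi Psi : hfun) : mono_span d Phi -> mono_span e Psi ->
  mono_span (d + e) (fun R h => Phi R h * Psi R h).
Proof.
move=> [s [s1 s2]] [t [t1 t2]].
exists [seq (p.1 * q.1, p.2 ++ q.2) | p <- s, q <- t]; split=> [p /allpairsP[[x y] /= [/s1 xd /t1 ye ->]]|R h h0].
  by rewrite /= sumn_cat xd ye.
rewrite s2 // t2 // big_allpairs_dep mulr_suml; apply: eq_bigr => p _.
rewrite mulr_sumr; apply: eq_bigr => q _ /=.
by rewrite /hmonom big_cat intrM mulrACA.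
Qed.

Section Straightening.

Definition sumsq (mu : seq nat) : nat := (\sum_(k <- mu) k ^ 2)%N.

Lemma sumsq_le mu : (sumsq mu <= sumn mu ^ 2)%N.
Proof.
elim: mu => [|k mu IH]; first by rewrite /sumsq big_nil.
rewrite /sumsq big_cons /= sqrnD -/(sumsq mu) -addnA leq_add2l.
by apply: leq_trans IH _; rewrite leq_addr.
Qed.

Lemma schur_det_expand (R : comNzRingType) (h : nat -> R) (la : intpart) :
  schur_det h la = \sum_(s : 'S_(size la))
    (if [forall i : 'I_(size la), (i <= nth 0%N la i + s i)%N] then (-1) ^+ s else 0)
      * \prod_(i < size la) h (nth 0%N la i + s i - i)%N.
Proof.
rewrite /schur_det /determinant; apply: eq_bigr => s _.
case: ifP => [/forallP val|/negbT/forallPn[i Hi]].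
  by congr (_ * _); apply: eq_bigr => i _; rewrite mxE val.
by rewrite mul0r (bigD1 i) //= mxE (negbTE Hi) mul0r mulr0.
Qed.

(** Straightening: h_mu is the identity term of the Schur determinant of mu, and every other term
    has the same total but a larger sum of squares ([square_increase]). The latter is bounded by
    [sumsq_le], so the recursion ends. *)
Lemma mono_schur_span mu : schur_span (sumn mu) (hmonom mu).
Proof.
have [m] := ubnP (sumn mu ^ 2 - sumsq mu); elim: m mu => // m IH mu mu_m.
(* Zero parts may be dropped because h_0 = 1. *)
pose nu := sort geq [seq k <- mu | k != 0%N].
have nu_part : is_partition nu.
  apply/andP; split; first by apply: sort_sorted => x y; apply: leq_total.
  by rewrite mem_sort mem_filter eqxx.
pose la := IntPart nu_part.
have perm_nu : perm_eq nu [seq k <- mu | k != 0%N] by rewrite perm_sort.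
have sum_nu : sumn nu = sumn mu.
  rewrite (perm_sumn perm_nu); elim: (mu) => //= k t <-; case: eqP => [->|] //.
have sq_nu : sumsq nu = sumsq mu.
  rewrite /sumsq (perm_big _ perm_nu) /= big_filter big_mkcond /=; apply: eq_bigr => k _.
  by case: eqP => [->|].
have prod_nu (R : comNzRingType) (h : nat -> R) : h 0%N = 1 ->
    \prod_(k <- mu) h k = \prod_(k <- nu) h k.
  move=> h0; rewrite (perm_big _ perm_nu) /= big_filter [RHS]big_mkcond /=.
  by apply: eq_bigr => k _; case: eqP => [->|].
pose row (s : 'S_(size la)) := [seq (nth 0%N la i + s i - i)%N | i : 'I_(size la)].
pose valid (s : 'S_(size la)) := [forall i : 'I_(size la), (i <= nth 0%N la i + s i)%N].
have rowE (R : comNzRingType) (h : nat -> R) (s : 'S_(size la)) :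
    \prod_(i < size la) h (nth 0%N la i + s i - i)%N = \prod_(k <- row s) h k.
  by rewrite big_map big_enum.
apply: (hspan_ext (Psi := fun R h => schur_det h la +
   \sum_(s : 'S_(size la) | (s != 1%g)) (-1)%:~R * ((if valid s then (-1) ^+ s else 0)%:~R * \prod_(k <- row s) h k))).
  move=> R h h0; rewrite schur_det_expand (bigD1 1%g) //= /hmonom prod_nu //.
  rewrite -addrA -[LHS]addr0; congr (_ + _).
    rewrite (_ : [forall i, _] = true) ?odd_perm1 ?expr0 ?mul1r; last first.
      by apply/forallP => i; rewrite perm1 leq_addl.
    rewrite (big_nth 0%N) big_mkord; apply: eq_bigr => i _.
    by rewrite perm1 addnK.
  rewrite -big_split big1 //= => s _; rewrite rowE -/(valid s).
  by case: (valid s); rewrite ?rmorph0 ?mul0r ?mulr0 ?addr0 // rmorph_sign mulN1r addrN.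
apply: hspanD; first by rewrite -sum_nu; exact: (hspan_val (fun la : intpart => sumn la) hschur la).
have H : forall s : 'S_(size la), s != 1%g -> valid s -> schur_span (sumn mu) (hmonom (row s)).
  move=> s s1 /forallP vs.
  have row_sum : sumn (row s) = sumn mu.
    rewrite -sum_nu !sumnE big_map big_enum /= [RHS](big_nth 0%N) big_mkord.
    apply/eqP; rewrite -(eqn_add2r (\sum_(i < size la) i)) -big_split /=; apply/eqP.
    rewrite (eq_bigr (fun i : 'I_(size la) => nth 0%N la i + s i)%N); last by move=> i _; rewrite subnK.
    by rewrite big_split /=; congr (_ + _)%N; rewrite [RHS](reindex_inj (@perm_inj _ s)).
  rewrite -row_sum; apply: IH; rewrite row_sum.
  have row_sq : (sumsq mu < sumsq (row s))%N.
    rewrite -sq_nu /sumsq big_map big_enum /= (big_nth 0%N) big_mkord.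
    apply: square_increase => // i j ij.
    have srt : sorted geq nu by have /andP[] := nu_part.
    have geq_tr : transitive geq by move=> x y z /= xy yz; apply: leq_trans yz xy.
    by apply: (sorted_leq_nth geq_tr leqnn 0%N srt); rewrite ?inE.
  by have := sumsq_le (row s); rewrite row_sum; lia.
apply: (hspan_ext (Psi := fun R h => \sum_(s <- enum 'S_(size la))
   (-1)%:~R * ((if (s != 1%g) && valid s then (-1) ^+ s else 0)%:~R * \prod_(k <- row s) h k))).
  move=> R h h0; rewrite big_enum big_mkcond /=; apply: eq_bigr => s _.
  by case: eqP; rewrite /= ?rmorph0 ?mul0r ?mulr0.
apply: hspan_sum => s _; apply: hspanZ; case: ifP => [/andP[s1 vs]|_].
  exact/hspanZ/H.
by apply: (hspan_ext _ (hspan0 _ _ _)) => R h _; rewrite rmorph0 mul0r.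
Qed.
End Straightening.


(** * Stanley coefficients as combinations of Schur determinants *)

Section StanleySpan.
Variable n : nat.

Lemma alternate_elem_span r : mono_span r (fun R h => alternate (elem_of_complete h) r).
Proof.
elim/ltn_ind: r => -[|r] IH.
  apply: (hspan_ext (Psi := hmonom [::])); last exact: (hspan_val sumn hmonom [::]).
  by move=> R h h0; rewrite /alternate mul1r elem_of_complete0 // /hmonom big_nil.
apply: (hspan_ext (Psi := fun R h => \sum_(i <- enum 'I_r.+1)
    (-1)%:~R * (h i.+1 * alternate (elem_of_complete h) (r - i)%N))).
  move=> R h h0; rewrite big_enum /= -mulr_sumr rmorphN1 mulN1r; apply/eqP.
  rewrite -addr_eq0; apply/eqP.
  have := congr1 (@^~ r.+1) (complete_mul h0); rewrite /seq_mul big_ord_recl h0 mul1r subn0.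
  by move=> E; rewrite -[RHS]E; congr (_ + _).
apply: hspan_sum => i _; apply: hspanZ.
have ri : (i.+1 + (r - i) = r.+1)%N by have := ltn_ord i; lia.
have hi : mono_span i.+1 (fun R h => h i.+1).
  have := hspan_val sumn hmonom [:: i.+1]; rewrite /= addn0.
  by apply: hspan_ext => R h _; rewrite /hmonom big_seq1.
have Ai : mono_span (r - i) (fun R h => alternate (elem_of_complete h) (r - i)%N).
  by apply: IH; have := ltn_ord i; lia.
by have := mono_spanM hi Ai; rewrite ri.
Qed.

Lemma elem_span r : mono_span r (fun R h => elem_of_complete h r).
Proof.
apply: (hspan_ext (Psi := fun R h => ((-1) ^+ r)%:~R * alternate (elem_of_complete h) r)).
  by move=> R h _; rewrite /alternate rmorph_sign mulrA -exprD addnn -mul2n exprM sqrrN expr1n expr1n mul1r.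
by apply: hspanZ; apply: alternate_elem_span.
Qed.

Lemma nc_lin_coef (R : comNzRingType) k (c : nat -> R) (u : 'S_n) :
  nc_lin R n k c u = (nc_hook int n k (plength u) u)%:~R * c (plength u).
Proof.
rewrite nc_sumE (bigD1 (Ordinal (plength_max u))) //= nc_scaleE big1 ?addr0 => [|r ru].
  by rewrite -(nc_map_hook _ (intr : {rmorphism int -> R})) nc_mapE mulrC.
rewrite nc_scaleE nc_homog_hook ?mulr0 // => E; case/eqP: ru; exact/val_inj.
Qed.

(** The coefficient of L_k at u is an integer times e_(l(u)), and lengths add in products, so
    degrees match lengths. *)
Lemma nc_stan_mono_span k (w : 'S_n) :
  mono_span (plength w) (fun R h => nc_stan R n k (elem_of_complete h) w).
Proof.
elim: k w => [|k IH] w.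
  apply: (hspan_ext (Psi := fun R h => (w == 1%g)%:~R * hmonom [::] h)).
    move=> R h _; rewrite ncstan0 nc_oneE /hmonom big_nil mulr1.
    by case: (w == 1%g).
  case: eqP => [->|_]; first by rewrite plength1; apply: hspanZ; exact: (hspan_val sumn hmonom [::]).
  by apply: (hspan_ext _ (hspan0 _ _ _)) => R h _; rewrite rmorph0 mul0r.
apply: (hspan_ext (Psi := fun R h => \sum_(u <- enum 'S_n) \sum_(v <- enum 'S_n)
    (lenadd u v && (pcomp u v == w))%:~R *
    ((nc_hook int n k (plength u) u)%:~R *
     (elem_of_complete h (plength u) * nc_stan R n k (elem_of_complete h) v)))).
  move=> R h _; rewrite ncstanS nc_mulE big_enum; apply: eq_bigr => u _.
  rewrite big_enum; apply: eq_bigr => v _; rewrite nc_lin_coef -mulrA.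
  by case: ifP => _; rewrite ?mul1r ?mul0r.
apply: hspan_sum => u _; apply: hspan_sum => v _.
have [/andP[/eqP uv /eqP uvw]|_] := boolP (lenadd u v && (pcomp u v == w)); last first.
  by apply: (hspan_ext _ (hspan0 _ _ _)) => R h _; rewrite rmorph0 mul0r.
do 2!apply: hspanZ; rewrite -uvw -uv; apply: mono_spanM => //; exact: elem_span.
Qed.

Lemma nc_stan_schur_span k (w : 'S_n) :
  schur_span (plength w) (fun R h => nc_stan R n k (elem_of_complete h) w).
Proof.
apply: hspan_trans (nc_stan_mono_span k w) => mu <-; exact: mono_schur_span.
Qed.
End StanleySpan.

(** * Tensor powers and uniqueness of the quiver coefficients *)

Module UniversalEval.
Import monalg.

Section Eval.
Variables (I : choiceType) (S : comNzRingType) (v : I -> S).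

Definition cm_eval (m : {cmonom I}) : S := \prod_(i <- finsupp m) v i ^+ m i.

Lemma cm_evalEw (m : {cmonom I}) (d : {fset I}) : (finsupp m `<=` d)%fset ->
  cm_eval m = \prod_(i <- d) v i ^+ m i.
Proof.
move=> le; rewrite /cm_eval (big_fset_incl _ le) // => i _.
by rewrite memNfinsupp => /eqP ->; rewrite expr0.
Qed.

Fact cm_eval_mmorphism : mmorphism cm_eval.
Proof.
split=> [m1 m2|]; last by rewrite /cm_eval mdom1 big_seq_fset0.
pose d := (finsupp m1 `|` finsupp m2)%fset.
rewrite (@cm_evalEw m1 d) ?fsubsetUl // (@cm_evalEw m2 d) ?fsubsetUr //.
rewrite (@cm_evalEw _ d) ?mdomD // -big_split /=; apply: eq_bigr => i _.
by rewrite cmM exprD.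
Qed.

HB.instance Definition _ := isMultiplicative.Build {cmonom I} S cm_eval cm_eval_mmorphism.

Lemma cm_evalU i : cm_eval (ucm i) = v i.
Proof. by rewrite /cm_eval mdomU big_seq_fset1 cmUU expr1. Qed.
End Eval.

(** The conventions c_0(j) = 1 and c_i(j) = 0 for i > j, imposed on freely chosen values. *)
Definition bounded_value (S : comNzRingType) (x : nat -> nat -> S) (j i : nat) : S :=
  if i == 0%N then 1 else if (i <= j)%N then x j i else 0.

Lemma cd_eval (S : comNzRingType) (xc xd : nat -> nat -> S) :
  exists theta : {rmorphism cd_ring -> S},
    (forall j i, theta (cvar j i) = bounded_value xc j i) /\
    (forall j i, theta (dvar j i) = bounded_value xd j i).
Proof.
pose v (p : nat * nat + nat * nat) : S :=
  match p with inl q => xc q.1 q.2 | inr q => xd q.1 q.2 end.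
pose theta : {rmorphism cd_ring -> S} := mmap (intr : int -> S) (cm_eval v).
exists theta; split=> j i; rewrite /cvar /dvar /cd_seq /bounded_value;
  case: ifP => _; rewrite ?rmorph1 //; case: ifP => _; rewrite ?rmorph0 //.
- by rewrite /theta /= mmapU [X in X * _]mulr1z mul1r cm_evalU.
- by rewrite /theta /= mmapU [X in X * _]mulr1z mul1r cm_evalU.
Qed.
End UniversalEval.
Export UniversalEval.

Section TensorSlots.
Variables (r : nat) (V : zmodType).
Implicit Types (x : 'I_r -> V) (a : 'I_r).

Definition tens_slot x a (v : V) : tpower r V := tens (fun i => if i == a then v else x i).

Lemma eq_tens x y : x =1 y -> tens x = tens y.
Proof. by move=> xy; rewrite /tens; congr (\pi << _ >>)%qT; apply/ffunP => i; rewrite !ffunE. Qed.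

Lemma tens_slotD x a v v' : tens_slot x a (v + v') = tens_slot x a v + tens_slot x a v'.
Proof.
rewrite /tens_slot /tens -raddfD; apply/eqP.
rewrite -(Quotient.idealrBE (tens_pred (V := V))); apply/asboolP.
have E w : [ffun i => if i == a then w else x i] = tens_upd [ffun i => x i] a w.
  by apply/ffunP => i; rewrite !ffunE.
by rewrite !E; apply: tens_rel_add.
Qed.

Fact tens_slot_zmod x a : zmod_morphism (tens_slot x a).
Proof. by move=> v v'; have := tens_slotD x a (v - v') v'; rewrite subrK => ->; rewrite addrK. Qed.
HB.instance Definition _ x a := GRing.isZmodMorphism.Build _ _ (tens_slot x a) (tens_slot_zmod x a).

Lemma tens_slot_id x a : tens_slot x a (x a) = tens x.
Proof. by apply: eq_tens => i; case: eqP => [->|]. Qed.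
End TensorSlots.

(** * From polynomial identities to tensors *)

Section MonomialTensor.
Variables (r D : nat).
Notation T := ('I_r * 'I_D)%type.
Notation K := #|{: T}|.
Notation ring := {mpoly int[K]}.

(** The variable of (i, j) stands for h_(j+1) in the i-th tensor factor, j being counted from 0. *)
Definition slot_seq (i : 'I_r) (k : nat) : ring :=
  if k is k'.+1 then (if insub k' is Some j then 'X_(enum_rank (i, j : 'I_D)) else 0) else 1.

Definition mono_tens (m : 'X_{1..K}) : tpower r symfun :=
  tens (fun i => \prod_(j < D) complete_sym j.+1 ^+ m (enum_rank (i, j))).

(** The additive map that replaces the variables of slot i by complete symmetric functions in the
    i-th factor; it transports identities to the tensor power, which carries only a group
    structure. *)
Definition poly_tens (p : ring) : tpower r symfun :=
  \sum_(m <- msupp p) mono_tens m *~ p@_m.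

Lemma poly_tensEw (s : seq 'X_{1..K}) p : uniq s -> {subset msupp p <= s} ->
  poly_tens p = \sum_(m <- s) mono_tens m *~ p@_m.
Proof.
move=> s_uniq ps; rewrite /poly_tens.
rewrite [RHS](bigID (mem (msupp p))) /= [X in _ + X]big1 ?addr0 => [|m mp]; last first.
  by rewrite memN_msupp_eq0.
rewrite -[RHS]big_filter; apply: perm_big; apply: uniq_perm; rewrite ?filter_uniq ?msupp_uniq //.
by move=> m; rewrite mem_filter; case: (boolP (m \in msupp p)) => //= /ps ->.
Qed.

Fact poly_tens_zmod : zmod_morphism poly_tens.
Proof.
move=> p q; pose s := undup (msupp p ++ msupp q ++ msupp (p - q)).
have sub t : {subset msupp t <= msupp p ++ msupp q ++ msupp (p - q)} -> {subset msupp t <= s}.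
  by move=> H m /H; rewrite mem_undup.
rewrite !(@poly_tensEw s) ?undup_uniq //; try by apply: sub => m mt; rewrite !mem_cat mt ?orbT.
by rewrite -sumrB; apply: eq_bigr => m _; rewrite mcoeffB mulrzBr.
Qed.
HB.instance Definition _ := GRing.isZmodMorphism.Build _ _ poly_tens poly_tens_zmod.

Lemma poly_tensX m : poly_tens 'X_[m] = mono_tens m.
Proof. by rewrite /poly_tens msuppX big_seq1 mcoeffX eqxx. Qed.

Lemma prod_count (R : comNzRingType) (h : nat -> R) (mu : seq nat) :
  h 0%N = 1 -> all (fun k => k <= D)%N mu ->
  \prod_(k <- mu) h k = \prod_(j < D) h j.+1 ^+ count_mem j.+1 mu.
Proof.
move=> h0; elim: mu => [|k mu IH] /=; first by rewrite big_nil big1 // => j _; rewrite expr0.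
case/andP=> kD /IH E; rewrite big_cons E; under [RHS]eq_bigr => j _ do rewrite exprD.
rewrite big_split /=; congr (_ * _); case: k kD => [|k] kD.
  by rewrite h0 big1 // => j _; rewrite expr0.
rewrite (bigD1 (Ordinal kD)) //= eqxx expr1 big1 ?mulr1 // => j jk.
rewrite eqSS; case: eqP => [kE|_]; last by rewrite expr0.
by case/eqP: jk; apply/val_inj.
Qed.

Definition mono_eval (R : comNzRingType) (h : nat -> R) (s : seq (int * seq nat)) : R :=
  \sum_(p <- s) p.1%:~R * \prod_(k <- p.2) h k.

Lemma poly_tens_mono (mu : 'I_r -> seq nat) :
  (forall i, all (fun k => k <= D)%N (mu i)) ->
  poly_tens (\prod_(i < r) \prod_(k <- mu i) slot_seq i k)
    = tens (fun i => \prod_(k <- mu i) complete_sym k).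
Proof.
move=> muD; pose m := [multinom count_mem (enum_val t).2.+1 (mu (enum_val t).1) | t < K].
have -> : \prod_(i < r) \prod_(k <- mu i) slot_seq i k = 'X_[m].
  rewrite mpolyXE_id (reindex enum_rank) /=; last exact: onW_bij (enum_rank_bij _).
  transitivity (\prod_(p : T) 'X_(enum_rank (p.1, p.2)) ^+ m (enum_rank (p.1, p.2)) : ring); last first.
    by apply: eq_bigr => -[].
  rewrite -(pair_bigA _ (fun i j => 'X_(enum_rank (i, j)) ^+ m (enum_rank (i, j)))) /=.
  apply: eq_bigr => i _; rewrite prod_count //; apply: eq_bigr => j _.
  by rewrite /= valK mnmE enum_rankK.
rewrite poly_tensX; apply: eq_tens => i.
rewrite [RHS]prod_count //; last exact: complete_sym0.
by apply: eq_bigr => j _; rewrite mnmE enum_rankK.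
Qed.

(* By multilinearity, one slot at a time.                                     *)
Lemma poly_tens_prod (S : 'I_r -> seq (int * seq nat)) :
  (forall i p, p \in S i -> all (fun k => k <= D)%N p.2) ->
  poly_tens (\prod_(i < r) mono_eval (slot_seq i) (S i))
    = tens (fun i => mono_eval complete_sym (S i)).
Proof.
(* k bounds the slots that may hold a proper combination; from slot k on there is one monomial with
   coefficient 1. *)
suff H k : forall S : 'I_r -> seq (int * seq nat),
    (forall i p, p \in S i -> all (fun k => k <= D)%N p.2) ->
    (forall i : 'I_r, (k <= i)%N -> exists mu, S i = [:: (1, mu)]) ->
  poly_tens (\prod_(i < r) mono_eval (slot_seq i) (S i))
    = tens (fun i => mono_eval complete_sym (S i)).
  by move=> SD; apply: (H r) => // i; rewrite leqNgt ltn_ord.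
elim: k => [|k IH] {}S SD Sk.
  have /boolp.choice[mu muE] : forall i, exists mu, S i = [:: (1, mu)] by move=> i; apply: Sk.
  have ev (R : comNzRingType) (h : nat -> R) i : mono_eval h (S i) = \prod_(k <- mu i) h k.
    by rewrite /mono_eval muE big_seq1 mul1r.
  under eq_bigr => i _ do rewrite ev.
  rewrite poly_tens_mono; first by apply: eq_tens => i; rewrite ev.
  by move=> i; apply: (SD i (1, mu i)); rewrite muE mem_head.
have [kr|rk] := ltnP k r; last first.
  by apply: IH => // i ki; have := ltn_ord i; lia.
pose a := Ordinal kr.
pose S' (p : int * seq nat) i := if i == a then [:: (1, p.2)] else S i.
have IH' p : p \in S a -> poly_tens (\prod_(i < r) mono_eval (slot_seq i) (S' p i))
    = tens (fun i => mono_eval complete_sym (S' p i)).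
  move=> pS; apply: IH => [i q|i ki]; rewrite /S'.
    by case: eqP => [_|_]; [rewrite inE => /eqP -> /=; apply: (SD a p pS)|apply: SD].
  case: eqP => [_|ia]; first by exists p.2.
  apply: Sk; rewrite ltn_neqAle ki andbT; apply/eqP => kE.
  by apply: ia; apply/val_inj.
have slotE : tens (fun i => mono_eval complete_sym (S i)) =
    tens_slot (fun i => mono_eval complete_sym (S i)) a (mono_eval complete_sym (S a)).
  by rewrite tens_slot_id.
rewrite slotE [X in tens_slot _ _ X]/mono_eval raddf_sum /=.
rewrite (bigD1 a) //= [X in X * _]/mono_eval mulr_suml raddf_sum /= big_seq [RHS]big_seq.
apply: eq_bigr => p pS.
have := IH' p pS; rewrite (bigD1 a) //= {1}/S' eqxx {1}/mono_eval big_seq1 mul1r /=.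
have -> : \prod_(i < r | i != a) mono_eval (slot_seq i) (S' p i)
    = \prod_(i < r | i != a) mono_eval (slot_seq i) (S i).
  by apply: eq_bigr => i /negbTE ia; rewrite /S' ia.
move=> E; rewrite -mulrA !mulrzl !raddfMz /= E; congr (_ *~ _); apply: eq_tens => i.
rewrite /S'; case: eqP => //= _.
by rewrite /mono_eval big_seq1 mul1r.
Qed.
End MonomialTensor.

Section MonomialSpan.

Lemma leq_sumn (mu : seq nat) k : k \in mu -> (k <= sumn mu)%N.
Proof.
elim: mu => //= a mu IH; rewrite inE => /orP[/eqP ->|/IH le]; first exact: leq_addr.
exact: leq_trans le (leq_addl _ _).
Qed.

Lemma schur_mono_span (la : intpart) : mono_span (sumn la) (hschur la).
Proof.
pose row (s : 'S_(size la)) := [seq (nth 0%N la i + s i - i)%N | i : 'I_(size la)].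
pose valid (s : 'S_(size la)) := [forall i : 'I_(size la), (i <= nth 0%N la i + s i)%N].
apply: (hspan_ext (Psi := fun R h => \sum_(s <- enum 'S_(size la))
   (if valid s then (-1) ^+ s else 0)%:~R * hmonom (if valid s then row s else [:: sumn la]) h)).
  move=> R h _; rewrite /hschur schur_det_expand big_enum /=; apply: eq_bigr => s _.
  rewrite -/(valid s); case: (valid s); last by rewrite rmorph0 !mul0r.
  by rewrite rmorph_sign /hmonom big_map big_enum.
apply: hspan_sum => s _; apply: hspanZ; case: ifP => [/forallP vs|_]; last first.
  by rewrite -[X in hspan _ _ X]/(sumn la) -{1}[sumn la]addn0; apply: (hspan_val sumn hmonom [:: sumn la]).
rewrite (_ : sumn la = sumn (row s)); first exact: (hspan_val sumn hmonom).
rewrite !sumnE big_map big_enum /= [LHS](big_nth 0%N) big_mkord.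
apply/eqP; rewrite -(eqn_add2r (\sum_(i < size la) i)) -big_split /=; apply/eqP.
rewrite -[RHS]big_split /= [RHS](eq_bigr (fun i : 'I_(size la) => nth 0%N la i + s i)%N).
  by rewrite !big_split /=; congr (_ + _)%N; rewrite [LHS](reindex_inj (@perm_inj _ s)).
by move=> i _; rewrite subnK.
Qed.

Lemma mono_eval_local (R : comNzRingType) D (h h' : nat -> R) (s : seq (int * seq nat)) :
  (forall p, p \in s -> all (fun k => k <= D)%N p.2) ->
  (forall k, (k <= D)%N -> h k = h' k) -> mono_eval h s = mono_eval h' s.
Proof.
move=> sD hh; apply: eq_big_seq => p /sD /allP pD.
by congr (_ * _); apply: eq_big_seq => k /pD /hh.
Qed.

(** In degree at most D an expression involves only h_0, .., h_D, where h agrees with the generic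
    slot. *)
Lemma poly_tens_span r D (Phi : 'I_r -> hfun) (d : 'I_r -> nat)
    (h : 'I_r -> nat -> {mpoly int[#|{: 'I_r * 'I_D}|]}) :
  (forall i, mono_span (d i) (Phi i)) -> (forall i, d i <= D)%N ->
  (forall i k, (k <= D)%N -> h i k = slot_seq D i k) ->
  poly_tens (\prod_(i < r) Phi i _ (h i)) = tens (fun i => Phi i symfun complete_sym).
Proof.
move=> Phi_span dD hE.
have c0 := complete_sym0.
have /boolp.choice[S SE] : forall i, exists s : seq (int * seq nat),
    (forall p, p \in s -> all (fun k => k <= D)%N p.2) /\
    forall (R : comNzRingType) (h : nat -> R), h 0%N = 1 -> Phi i R h = mono_eval h s.
  move=> i; have [s [s1 s2]] := Phi_span i; exists s; split=> // p ps.
  by apply/allP => k /leq_sumn kp; rewrite (leq_trans kp) // s1.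
rewrite (eq_bigr (fun i => mono_eval (slot_seq D i) (S i))) => [|i _]; last first.
  have [SD E] := SE i; rewrite E; last by rewrite hE.
  exact: mono_eval_local SD (hE i).
rewrite poly_tens_prod => [|i p]; last by have [SD _] := SE i; apply: SD.
by apply: eq_tens => i; have [_ E] := SE i; rewrite E.
Qed.
End MonomialSpan.

(** * Generic specializations of the universal variables *)

Section TruncatedQuotient.
Variable R : comNzRingType.

Lemma hdiff_rec (c d : nat -> R) k : hdiff c d k =
  (-1) ^+ k * with1 d k - \sum_(1 <= i < k.+1) (-1) ^+ i * with1 c i * hdiff c d (k - i).
Proof.
by apply/eqP; rewrite -(hdiffE c d) -subr_eq0 big_ltn // expr0 !mul1r subn0 addrK subrr.
Qed.

Lemma hdiff_local K (c d c' d' : nat -> R) :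
  (forall k, (k <= K)%N -> c k = c' k) -> (forall k, (k <= K)%N -> d k = d' k) ->
  forall k, (k <= K)%N -> hdiff c d k = hdiff c' d' k.
Proof.
have with1E (e e' : nat -> R) : (forall k, (k <= K)%N -> e k = e' k) ->
    forall k, (k <= K)%N -> with1 e k = with1 e' k by move=> H [|k] // /H.
move=> /with1E cE /with1E dE; elim/ltn_ind => k IH kK.
rewrite hdiff_rec [RHS]hdiff_rec dE //; congr (_ - _).
apply: eq_big_nat => i /andP[i0 ik]; rewrite cE ?IH //; lia.
Qed.

Lemma hdiff_mul_elem (d h : nat -> R) : d 0%N = 1 -> h 0%N = 1 ->
  hdiff (seq_mul d (elem_of_complete h)) d = h.
Proof.
move=> d0 h0; set c := seq_mul _ _.
have c0 : c 0%N = 1 by rewrite /c seq_mul0 d0 elem_of_complete0 // mulr1.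
apply: (@seq_inv_unique _ (alternate c)); first by rewrite /alternate c0 mul1r.
have := hdiff_mul c d; rewrite !with1_id // => ->.
rewrite /c alternate_mul -seq_mulA [seq_mul _ h]seq_mulC.
by rewrite complete_mul // seq_mul1.
Qed.

End TruncatedQuotient.

Lemma rmorph_hdiff (R R' : comNzRingType) (f : {rmorphism R -> R'}) (c d : nat -> R) k :
  f (hdiff c d k) = hdiff (f \o c) (f \o d) k.
Proof.
have with1E (e : nat -> R) i : f (with1 e i) = with1 (f \o e) i by case: i => //=; rewrite rmorph1.
elim/ltn_ind: k => k IH; rewrite hdiff_rec [RHS]hdiff_rec rmorphB rmorphM rmorph_sign with1E.
congr (_ - _); rewrite rmorph_sum /=; apply: eq_big_nat => i /andP[i0 ik].
by rewrite !rmorphM rmorph_sign /= with1E IH //; lia.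
Qed.

Section GenericChain.
Variables (n D : nat).
Hypothesis n_gt0 : (0 < n)%N.
Notation r := n.*2.-1.
Notation ring := {mpoly int[#|{: 'I_r * 'I_D}|]}.

(** Each sequence is the preceding one times the elementary sequence of a fresh slot, so that
    consecutive differences are the slots ([hdiff_generic_chain]). *)
Fixpoint generic_chain (i : nat) : nat -> ring :=
  if i is i'.+1 then
    seq_mul (generic_chain i')
      (elem_of_complete (if insub i' is Some j then slot_seq D (j : 'I_r) else seq_one ring))
  else seq_one ring.

Lemma generic_chain0 i : generic_chain i 0%N = 1.
Proof.
elim: i => [|i IH] //=; rewrite seq_mul0 IH elem_of_complete0 ?mulr1 //.
by case: insub.
Qed.

Lemma hdiff_generic_chain (i : 'I_r) :
  hdiff (generic_chain i.+1) (generic_chain i) = slot_seq D i.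
Proof. by rewrite /= valK hdiff_mul_elem // generic_chain0. Qed.

(* For large m the universal variables can be specialized so that the slots of *)
(* the quiver formula become generic up to degree D.                          *)
Lemma generic_specialization m : (D <= m)%N ->
  exists theta : {rmorphism cd_ring -> ring}, forall (i : 'I_r) k, (k <= D)%N ->
    let ch := chain n (fun j => cvar (m + j)) (fun j => dvar (m + j)) in
    theta (hdiff (ch i.+1) (ch i) k) = slot_seq D i k.
Proof.
(* c(m + j) and d(m + j) go to the positions 2n - j and j - 1 that they occupy in [chain]. As m >=
   D, the forced zeros c_l(m + j) with l > m + j lie above degree D. *)
move=> Dm; have [theta [thetac thetad]] := cd_eval
   (fun j => generic_chain (n.*2 - (j - m))) (fun j => generic_chain (j - m).-1).
exists theta => i k kD ch.
have chE j l : (j < n.*2)%N -> (l <= D)%N -> (theta \o ch j) l = generic_chain j l.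
  move=> jn lD; rewrite /= /ch /chain; case: (ltnP j n) => [j_n|n_j].
    rewrite thetad /bounded_value; case: eqP => [->|_]; first by rewrite generic_chain0.
    by rewrite (_ : (l <= m + j.+1)%N); [congr (generic_chain _ _)|]; lia.
  rewrite thetac /bounded_value; case: eqP => [->|_]; first by rewrite generic_chain0.
  by rewrite (_ : (l <= m + (n.*2 - j))%N); [congr (generic_chain _ _)|]; lia.
have i_r := ltn_ord i.
rewrite rmorph_hdiff -hdiff_generic_chain; apply: (@hdiff_local _ D) => // l lD; apply: chE => //; lia.
Qed.
End GenericChain.

Lemma mono_span_rmorph d (Phi : hfun) (R R' : comNzRingType) (f : {rmorphism R -> R'}) (h : nat -> R) :
  mono_span d Phi -> h 0%N = 1 -> f (Phi R h) = Phi R' (f \o h).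
Proof.
move=> [s [_ E]] h0; rewrite !E //=; last by rewrite h0 rmorph1.
rewrite rmorph_sum /=; apply: eq_bigr => p _.
by rewrite rmorphM rmorph_int /= /hmonom rmorph_prod.
Qed.

Lemma fsfun_of_seq (T : choiceType) (s : seq (int * T)) :
  exists q : {fsfun T -> int with 0},
    (forall x, x \in finsupp q -> exists c, (c, x) \in s) /\
    forall (R : nzRingType) (G : T -> R),
      \sum_(x <- finsupp q) (q x)%:~R * G x = \sum_(p <- s) p.1%:~R * G p.2.
Proof.
pose F := [fset p.2 | p in s]%fset.
pose q : {fsfun T -> int with 0} := [fsfun x in F => \sum_(p <- s | p.2 == x) p.1].
have qF : (finsupp q `<=` F)%fset by apply/fsubsetP => x; apply: contraTT => xF; rewrite memNfinsupp fsfunE (negbTE xF).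
exists q; split=> [x /(fsubsetP qF)/imfsetP[p /= ps ->]|R G]; first by exists p.1; rewrite -surjective_pairing.
rewrite (big_fset_incl _ qF) => [|x _ xq]; last first.
  by move: xq; rewrite memNfinsupp => /eqP ->; rewrite mul0r.
rewrite (eq_big_seq (fun x => \sum_(p <- s | p.2 == x) p.1%:~R * G x)) => [|x xF]; last first.
  by rewrite fsfunE xF rmorph_sum mulr_suml.
rewrite (exchange_big_dep xpredT) //= [LHS]big_seq [RHS]big_seq; apply: eq_bigr => p ps.
have pF : p.2 \in F by apply/imfsetP; exists p.
rewrite big_mkcond /= (big_fsetD1 _ pF) /= eqxx big_seq big1 ?addr0 // => x.
by rewrite !inE => /andP[/negbTE xp _]; rewrite eq_sym xp.
Qed.

Lemma prod_of_sums r (T : eqType) (S : 'I_r -> seq (int * T)) :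
  exists s : seq (int * r.-tuple T),
    (forall p, p \in s -> forall i, exists c, (c, tnth p.2 i) \in S i) /\
    forall (R : comNzRingType) (G : 'I_r -> T -> R),
      \prod_(i < r) \sum_(p <- S i) p.1%:~R * G i p.2
        = \sum_(p <- s) p.1%:~R * \prod_(i < r) G i (tnth p.2 i).
Proof.
elim: r S => [|r IH] S.
  exists [:: (1, [tuple])]; split=> [p _ [] //|R G].
  by rewrite !big_ord0 big_seq1 big_ord0 mulr1.
have [s [s1 s2]] := IH (fun i => S (fintype.lift ord0 i)).
pose glue (p : int * T) (q : int * r.-tuple T) := (p.1 * q.1, [tuple of p.2 :: q.2]).
exists [seq glue p q | p <- S ord0, q <- s]; split.
  move=> _ /allpairsP[[p q] /= [pS qs ->]] i /=.
  have [j ->|->] := unliftP ord0 i; first by rewrite tnthS; apply: s1.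
  by exists p.1; rewrite tnth0 -surjective_pairing.
move=> R G; rewrite big_ord_recl (s2 _ (fun i => G (fintype.lift ord0 i))) big_allpairs_dep mulr_suml; apply: eq_bigr => p _.
rewrite mulr_sumr; apply: eq_bigr => q _ /=.
rewrite big_ord_recl tnth0 intrM mulrACA; congr (_ * (_ * _)).
by apply: eq_bigr => i _; rewrite tnthS.
Qed.

(** * Existence of quiver coefficients and their tensor *)

Section QuiverCoefficients.
Variables (n : nat) (w : 'S_n.+1).
Hypothesis n_gt0 : (0 < n)%N.
Notation r := n.*2.-1.
Notation is_fact u := (is_reduced_fact w u &&
  [forall i : 'I_r, in_sym (minn i.+1 (n.*2 - i.+1)).+1 (u i)]).

Fact prod_middle (R : comNzRingType) (F : nat -> R) : \prod_(i < r) F i.+1 =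
  (\prod_(1 <= i < n) F i) * F n * \prod_(n.+1 <= i < n.*2) F i.
Proof.
rewrite -(big_mkord xpredT (fun i => F i.+1)) -(big_add1 _ _ 0%N r.+1 xpredT F).
have -> : r.+1 = n.*2 by lia.
rewrite (@big_cat_nat _ _ _ n) /=; [|lia..].
by rewrite [X in _ * X]big_ltn ?mulrA //; lia.
Qed.

(** Slot i of the quiver formula is the difference of the entries i and i - 1 of [chain]: of type d
    - d below n, c - d at n and c - c above n. *)
Lemma prod_schur_chain (R : comNzRingType) (c d : nat -> nat -> R) m (la : r.-tuple intpart) :
  let ch := chain n (fun j => c (m + j)%N) (fun j => d (m + j)%N) in
  (\prod_(1 <= i < n) schur_diff (d (i + 1 + m)%N) (d (i + m)%N) (part_at la i))
  * schur_diff (c (n + m)%N) (d (n + m)%N) (part_at la n)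
  * (\prod_(n.+1 <= i < n.*2)
       schur_diff (c (n.*2 - i + m)%N) (c (n.*2 - i + 1 + m)%N) (part_at la i)) =
  \prod_(i < r) schur_det (hdiff (ch i.+1) (ch i)) (tnth la i).
Proof.
move=> ch; pose G i := schur_diff (ch i) (ch i.-1) (part_at la i).
have low i : (i < n)%N -> ch i = d (i.+1 + m)%N by move=> i_n; rewrite addnC /ch /chain i_n.
have high i : (n <= i)%N -> ch i = c (n.*2 - i + m)%N.
  by move=> n_i; rewrite [(_ + m)%N]addnC /ch /chain ltnNge n_i.
have -> : \prod_(i < r) schur_det (hdiff (ch i.+1) (ch i)) (tnth la i) = \prod_(i < r) G i.+1.
  by apply: eq_bigr => i _; rewrite /G /part_at (tnth_nth empty_part).
rewrite prod_middle; congr (_ * _ * _).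
- apply: eq_big_nat => -[//|i] /andP[_ i_n]; rewrite /G !low //=; last exact: ltnW.
  by rewrite addn1.
- rewrite /G high // low prednK //.
  by have -> : (n.*2 - n = n)%N by lia.
- apply: eq_big_nat => -[//|i] /andP[n_i i_n]; rewrite /G !high //=; last exact: ltnW.
  by have -> : (n.*2 - i = n.*2 - i.+1 + 1)%N by lia.
Qed.

Definition cd_chain (m : nat) := chain n (fun j => cvar (m + j)) (fun j => dvar (m + j)).
Definition cd_hdiff (m i : nat) : nat -> cd_ring := hdiff (cd_chain m i.+1) (cd_chain m i).

Lemma quiver_termE m (la : r.-tuple intpart) :
  quiver_term m la = \prod_(i < r) schur_det (cd_hdiff m i) (tnth la i).
Proof. exact: prod_schur_chain. Qed.

Lemma double_usch_factorizations (R : comNzRingType) (c d : nat -> nat -> R) m :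
  (forall N, bounded_seqs N c) -> (forall N, bounded_seqs N d) ->
  (forall k, c k 0%N = 1) -> (forall k, d k 0%N = 1) ->
  let ch := chain n (fun j => c (m + j)%N) (fun j => d (m + j)%N) in
  double_usch c d (pshift m w) = \sum_(u : {ffun 'I_r -> 'S_n.+1} | is_fact u)
    \prod_(i < r) nc_stan R n.+1 n (elem_of_complete (hdiff (ch i.+1) (ch i))) (u i).
Proof.
move=> cb db c0 d0 ch; rewrite double_uschE; [|by rewrite addnS|exact: cb|exact: db].
have -> : (m + n.+1).-1 = (m + n)%N by rewrite addnS.
rewrite -nc_unshiftE rmorphM /= nc_unshift_anti !unshift_usch_gen //.
exact: usch_gen_factorizations.
Qed.

Lemma cd_seq_bounded inj N : bounded_seqs N (cd_seq inj).
Proof. by move=> k i _ ki; rewrite /cd_seq leqNgt ki /=; case: eqP ki => // ->. Qed.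

Lemma universal_factorizations m : double_usch cvar dvar (pshift m w) =
  \sum_(u : {ffun 'I_r -> 'S_n.+1} | is_fact u)
    \prod_(i < r) nc_stan cd_ring n.+1 n (elem_of_complete (cd_hdiff m i)) (u i).
Proof. by apply: double_usch_factorizations => [N|N|k|k]; try exact: cd_seq_bounded. Qed.

(** The Schur expansions of the factors have coefficients independent of the ring and of the
    sequence, so multiplying out [universal_factorizations] gives one family valid for every m. *)
Lemma quiver_coef_exists : exists q, is_quiver_coef w q.
Proof.
have /boolp.choice[b bE] (u : 'S_n.+1) : exists s : seq (int * intpart),
    (forall p, p \in s -> sumn p.2 = plength u) /\
    forall (R : comNzRingType) (h : nat -> R), h 0%N = 1 ->
      nc_stan R n.+1 n (elem_of_complete h) u = \sum_(p <- s) p.1%:~R * schur_det h p.2.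
  by have [s [s1 s2]] := nc_stan_schur_span n u; exists s.
have /boolp.choice[t tE] (u : {ffun 'I_r -> 'S_n.+1}) := prod_of_sums (fun i => b (u i)).
pose facts := [seq u : {ffun 'I_r -> 'S_n.+1} <- enum {: {ffun 'I_r -> 'S_n.+1}} | is_fact u].
have [q [q1 q2]] := fsfun_of_seq (flatten [seq t u | u <- facts]).
exists q; split=> [la la_w|m].
  apply/eqP; rewrite -memNfinsupp; apply/negP => /q1 [k /flatten_mapP[u]].
  rewrite mem_filter => /andP[/andP[/andP[_ /eqP uw] _] _] /((tE u).1) kS; case: la_w.
  rewrite -uw big_tuple; apply: eq_bigr => i _.
  by have [c cS] := kS i; rewrite -((bE (u i)).1 _ cS).
rewrite q2 universal_factorizations big_flatten big_map big_filter big_enum_cond /=.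
apply: eq_big => [//|u _].
transitivity (\prod_(i < r) \sum_(p <- b (u i)) p.1%:~R * schur_det (cd_hdiff m i) p.2).
  by apply: eq_bigr => i _; rewrite ((bE (u i)).2 cd_ring (cd_hdiff m i) (hdiff0 _ _)).
rewrite ((tE u).2 _ (fun i => schur_det (cd_hdiff m i))).
by apply: eq_bigr => p _; rewrite quiver_termE.
Qed.

(** The quiver identity at m = l(w) equates two sums of products over the 2n - 1 slots, each product
    of total degree l(w). The specialization [theta] makes the slots generic up to that degree, and
    [poly_tens] then reads the two sums as the two tensors. *)
Lemma quiver_coef_tens q : is_quiver_coef w q ->
  \sum_(la <- finsupp q) tens (fun i => schur_fun (tnth la i)) *~ q la =
  \sum_(u : {ffun 'I_r -> 'S_n.+1} | is_fact u) tens (fun i => stanley (u i)).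
Proof.
move=> [q_deg qE]; pose D := plength w.
have [theta thetaE] := generic_specialization n_gt0 (leqnn D).
(* Serves both sides: Stanley coefficients on one, Schur determinants on the other. *)
have evalE (Phi : 'I_r -> hfun) (d : 'I_r -> nat) :
    (forall i, mono_span (d i) (Phi i)) -> (\sum_i d i = plength w)%N ->
    poly_tens (theta (\prod_(i < r) Phi i _ (cd_hdiff D i)))
      = tens (fun i => Phi i symfun complete_sym).
  move=> Phi_span dw; rewrite rmorph_prod.
  rewrite (eq_bigr (fun i : 'I_r => Phi i _ (theta \o cd_hdiff D i))) => [|i _]; last first.
    by apply: (mono_span_rmorph _ (Phi_span i)); apply: hdiff0.
  apply: (poly_tens_span Phi_span) => [i|i k kD]; last exact: thetaE.
  by rewrite /D -dw (bigD1 i) //= leq_addr.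
have := congr1 (fun p => poly_tens (theta p)) (qE D).
rewrite universal_factorizations !rmorph_sum /= !raddf_sum /=.
move=> E; symmetry; apply: etrans (etrans E _).
  apply: eq_bigr => u /andP[/andP[_ /eqP uw] _].
  rewrite (evalE (fun i R h => nc_stan R n.+1 n (elem_of_complete h) (u i)) _ _ uw).
    by apply: eq_tens => i; rewrite stanleyE.
  by move=> i; apply: nc_stan_mono_span.
apply: eq_big_seq => la la_q.
have la_w : (\sum_i sumn (tnth la i) = plength w)%N.
  apply: contraTeq la_q => /eqP; rewrite memNfinsupp => la_w; apply/eqP/q_deg.
  by rewrite big_tuple.
rewrite quiver_termE mulrzl rmorphMz raddfMz /=; congr (_ *~ _).
exact: (evalE (fun i => hschur (tnth la i)) _ (fun i => schur_mono_span _) la_w).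
Qed.
End QuiverCoefficients.

(* The factor u_j is [u i] for the ordinal i of value j - 1. *)
Theorem theorem3 (n : nat) (hn : (1 <= n)%N) (w : 'S_n.+1) :
  quiver_poly w =
  \sum_(u : {ffun 'I_(n.*2.-1) -> 'S_n.+1} |
          is_reduced_fact w u &&
          [forall i : 'I_(n.*2.-1), in_sym (minn i.+1 (n.*2 - i.+1)).+1 (u i)])
    tens (fun i => stanley (u i)).
Proof.
(* Existence ensures that the choice made by [quiver_coef] satisfies [is_quiver_coef], rather than
   being the default value. *)
apply: quiver_coef_tens => //; have [q qw] := quiver_coef_exists w hn.
by apply: (xgetPex [fsfun] (P := [set q | is_quiver_coef w q]%classic)); exists q.
Qed.
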